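(* Let $P$ be a CPPOS. The number $\delta_{\operatorname{ART}}(P)$ is dimensionless and invariant under every nonsingular affine transformation. The set $\mathcal C_{\operatorname{ART}}(P)$ is non-empty, compact, and affine covariant (that is, $\mathcal C_{\operatorname{ART}}(F(P))=F(\mathcal C_{\operatorname{ART}}(P))$ for every nonsingular affine map $F$). If $\max\mathcal E_P>0$, then $\mathcal C_{\operatorname{ART}}(P)\subset\operatorname{int}(P)$. Moreover, $$\delta_{\operatorname{ART}}(P)=0\quad\text{if and only if}\quad P\text{ is centrally symmetric}.$$ In that case $\mathcal E_P\equiv0$, $\delta_{\operatorname{ART}}(P)=0$, and $\mathcal C_{\operatorname{ART}}(P)=P$.
   Context: A CPPOS (convex polygon with parallel opposite sides) is a positively oriented convex polygon $P=(P_0,\dots,P_{2n-1})$, indices modulo $2n$, all $P_i$ genuine vertices (consecutive edge vectors linearly independent), whose edge vectors $e_i=P_{i+1}-P_i$ satisfy $e_{i+n}\parallel e_i$. $P$ also denotes the closed convex region it bounds. Boundary involution: $\sigma_P(P_i+s e_i)=P_{i+n}+s e_{i+n}$, $0\le s\le1$. For a line $\ell$ meeting $\operatorname{int}(P)$ with boundary intersection points $x_\ell,y_\ell$, $\Phi_P(\ell)=\overline{\sigma_P(x_\ell)\sigma_P(y_\ell)}$. $\Lambda_p$ is the pencil of lines through $p\in\operatorname{int}(P)$. A cell is a maximal open arc of $\Lambda_p$ on which the boundary points of the line lie in two fixed open sides; at a cell transition the line passes through a vertex. Put $n(\theta)=(\cos\theta,\sin\theta)$, $\tau(\theta)=(-\sin\theta,\cos\theta)$.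 For each $\theta$ there is exactly one line of $\Phi_P(\Lambda_p)$ with normal $n(\theta)$, written $n(\theta)\cdot(z-p)=q_p(\theta)$, where $q_p$ is continuous, smooth on each cell, with one-sided derivatives at transitions, and $q_p(\theta+\pi)=-q_p(\theta)$. The completed affine reflection transform $\operatorname{ART}_P(p)$ is the closed front made of the cellwise envelopes $X(\theta)=p+q_pn+q_p'\tau$ and, at each transition angle, of the oriented segment joining the two one-sided envelope points $X^-$ to $X^+$, traversed once as $\theta$ runs over one period $\pi$. Its oriented area is $A^*=\frac12\oint[X,dX]$, with $[u,v]=\det(u,v)$. Energy: $\mathcal E_P(p)=-A^*(\operatorname{ART}_P(p))$ for $p\in\operatorname{int}(P)$ and $\mathcal E_P(p)=0$ for $p\in\partial P$. With $A(P)$ the area of $P$, $$\delta_{\operatorname{ART}}(P)=\frac{\max_{p\in P}\mathcal E_P(p)}{A(P)},\qquad \mathcal C_{\operatorname{ART}}(P)=\operatorname*{arg\,max}_{p\in P}\mathcal E_P(p).$$ *)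

(* Defs.v *)
From HB Require Import structures.
From mathcomp Require Import all_boot all_order all_algebra.
From mathcomp Require Import all_classical all_reals all_analysis.

Set Implicit Arguments.
Unset Strict Implicit.
Unset Printing Implicit Defensive.

Import Order.TTheory GRing.Theory Num.Theory.
Import numFieldNormedType.Exports.

Local Open Scope classical_set_scope.
Local Open Scope ring_scope.

Section Plane.
Context {R : realType}.
Implicit Types (u v a b p z : 'rV[R]_2) (t r : R).

Definition dot u v : R := u 0 0 * v 0 0 + u 0 1 * v 0 1.

Definition det2 u v : R := u 0 0 * v 0 1 - u 0 1 * v 0 0.

Definition vec2 (x y : R) : 'rV[R]_2 := \row_(j < 2) (if j == 0 then x else y).

Definition nvec t : 'rV[R]_2 := vec2 (cos t) (sin t).

Definition tvec t : 'rV[R]_2 := vec2 (- sin t) (cos t).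

Definition line a b : set 'rV[R]_2 := [set a + s *: (b - a) | s in [set: R]].

Definition normal_line p t r : set 'rV[R]_2 :=
  [set z | dot (nvec t) (z - p) = r].

Definition pencil p : set (set 'rV[R]_2) :=
  [set line p z | z in [set z | z != p]].

Definition affmap (A : 'M[R]_2) (b : 'rV[R]_2) z : 'rV[R]_2 := z *m A + b.

Definition dleft (f : R -> R) t : R :=
  lim ((f (t + h) - f t) / h @[h --> 0^'-]).

Definition dright (f : R -> R) t : R :=
  lim ((f (t + h) - f t) / h @[h --> 0^'+]).

End Plane.

(* Vertices are indexed by 'Z_(n.*2), so that [i + 1] and [i + n%:R] are taken *)
(* modulo 2n; 'Z_(n.*2) has the right size because CPPOS imposes 1 < n.        *)
Section Polygon.
Context {R : realType} {n : nat}.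
Implicit Types (P : 'Z_(n.*2) -> 'rV[R]_2) (p x y z : 'rV[R]_2) (t s : R).
Implicit Types (l : set 'rV[R]_2).

Definition edge P (i : 'Z_(n.*2)) : 'rV[R]_2 := P (i + 1) - P i.

(* [cppos_convex] says that the polygon lies to the left of each of its sides. *)
(* Without [cppos_inj], a polygon traversed several times would be allowed.    *)
Record CPPOS P : Prop := {
  cppos_size : (1 < n)%N;
  cppos_inj : injective P;
  cppos_convex : forall i j, 0 <= det2 (edge P i) (P j - P i);
  cppos_genuine : forall i, free [:: edge P i; edge P (i + 1)];
  cppos_parallel : forall i : 'Z_(n.*2),
    exists c : R, edge P (i + n%:R) = c *: edge P i
}.

Definition region P : set 'rV[R]_2 :=
  [set z | exists w : 'Z_(n.*2) -> R,
     [/\ forall i, 0 <= w i, \sum_i w i = 1 & z = \sum_i w i *: P i]].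

Definition side_pt P (i : 'Z_(n.*2)) s : 'rV[R]_2 := P i + s *: edge P i.

Definition boundary P : set 'rV[R]_2 :=
  [set x | exists i s, 0 <= s <= 1 /\ x = side_pt P i s].

(* The boundary involution; its value outside the boundary is irrelevant. *)
Definition sigma P x : 'rV[R]_2 :=
  xget x [set y | exists i s,
    [/\ 0 <= s <= 1, x = side_pt P i s & y = side_pt P (i + n%:R) s]].

(* The line through [sigma P x] and [sigma P y], where x and y are the two     *)
(* boundary points of l; the set is empty if l does not have exactly two.      *)
Definition Phi P l : set 'rV[R]_2 :=
  [set z | exists x y, [/\ x != y, l `&` boundary P = [set x; y]
                         & line (sigma P x) (sigma P y) z]].

(* The signed distance from p of the line of [Phi P @` pencil p] with normal   *)
(* [nvec t], which exists and is unique for p interior to a CPPOS.             *)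
Definition qfun P p t : R :=
  xget 0 [set r | (Phi P @` pencil p) (normal_line p t r)].

(* The angles of the images of the lines of the pencil through a vertex. *)
Definition transitions P p : set R :=
  [set t | exists i, Phi P (line p (P i)) = normal_line p t (qfun P p t)].

(* The point of the line of angle t with tangential coordinate d: the envelope *)
(* point for d the derivative of [qfun P p] at t.                              *)
Definition front_pt P p t (d : R) : 'rV[R]_2 :=
  p + qfun P p t *: nvec t + d *: tvec t.

Definition envelope P p t : 'rV[R]_2 := front_pt P p t (derive1 (qfun P p) t).

Definition envelope_left P p t : 'rV[R]_2 :=
  front_pt P p t (dleft (qfun P p) t).

Definition envelope_right P p t : 'rV[R]_2 :=
  front_pt P p t (dright (qfun P p) t).

(* 1/2 \oint [X, dX] over one period: the cells contribute the integral of     *)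
(* [X, X'], and the segment from X^- to X^+ contributes                        *)
(* \int_0^1 [X^- + s(X^+ - X^-), X^+ - X^-] ds = [X^-, X^+ - X^-].             *)
Definition ART_area P p : R :=
  2^-1 * (\int[lebesgue_measure]_(t in `[0, pi] `\` transitions P p)
             det2 (envelope P p t) (derive1 (envelope P p) t)
          + \sum_(t \in `[0, pi[ `&` transitions P p)
              det2 (envelope_left P p t)
                   (envelope_right P p t - envelope_left P p t)).

Definition energy P p : R :=
  if `[< (region P)° p >] then - ART_area P p else 0.

(* 1/2 \oint [X, dX] over the positively oriented boundary. *)
Definition area P : R := 2^-1 * \sum_i det2 (P i) (P (i + 1)).

Definition max_energy P : R := sup [set energy P p | p in region P].

Definition delta_ART P : R := max_energy P / area P.

Definition C_ART P : set 'rV[R]_2 :=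
  [set p | region P p /\ forall z, region P z -> energy P z <= energy P p].

Definition centrally_symmetric P : Prop :=
  exists c : 'rV[R]_2, [set c *+ 2 - z | z in region P] = region P.

(* The image polygon F(P), listed in reverse order when F reverses the         *)
(* orientation so that it is again positively oriented.                        *)
Definition affine_image (A : 'M[R]_2) (b : 'rV[R]_2) P :
    'Z_(n.*2) -> 'rV[R]_2 :=
  fun i => affmap A b (P (if 0 < \det A then i else - i)).

End Polygon.

(* Main.v *)
(* Let h(t) be the value of n(t).z on the image line with normal n(t). The      *)
(* cells of the front contribute [h (h + h'')] to [X, dX]; integrating by parts *)
(* absorbs the jumps of h' into the transition segments, so that the energy of  *)
(* p is 1/2 \int_0^pi (h'^2 - h^2).                                             *)
(* As h(t + pi) = - h(t), h vanishes at some a, and h = g sin(t - a) gives      *)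
(* \int (h'^2 - h^2) = \int (g' sin(t - a))^2, which is nonnegative and zero    *)
(* only if all image lines pass through one point. If this happens at every p,  *)
(* looking at points near a corner shows that the ratios of the opposite sides  *)
(* all equal -1, that is, P is centrally symmetric.                             *)
(* A linear map of determinant D rescales h and reparametrizes the angle, which *)
(* multiplies the form (h'^2 - h^2) dt by D up to an exact form.                *)
(* For almost all t, the envelope point depends continuously on p; when p tends *)
(* to the boundary it tends to [sigma p], the limit h is a sinusoid, and by     *)
(* dominated convergence the energy tends to 0. The energy is thus continuous   *)
(* on the compact region P and reaches its maximum.                             *)

Require Import Defs.
From mathcomp Require Import all_boot all_order all_algebra.
From mathcomp Require Import all_classical all_reals all_analysis.
From mathcomp Require Import ring lra zify.
Import Order.TTheory GRing.Theory Num.Theory numFieldNormedType.Exports.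
Local Open Scope classical_set_scope.
Local Open Scope ring_scope.
Set Implicit Arguments.
Unset Strict Implicit.
Unset Printing Implicit Defensive.

(** * Convex polygons *)

Section PlaneAlgebra.
Context {R : realType}.
Implicit Types (u v w x y z : 'rV[R]_2) (r s t : R).

(** For an interior point p and an angle t, [pchord] singles out the chord x y through p whose image
    chord, directed from x' to y', has normal [nvec t] and direction [tvec t]; it exists by the
    intermediate value theorem ([pchord_exists]) and is unique ([pchord_unique]). The level h is the
    common value of [dot (nvec t)] on the image line. The geometric root of everything is
    [sigma_orient]: the involution preserves the cyclic order of the boundary, hence the orientation
    of triples, so the images of two chords crossing at p still cross ([pchord_cross]). This gives
    uniqueness, a Lipschitz bound on h uniform in p ([level_lipschitz]) and the monotone motion of
    the ends along the sides ([spar_monotone]). While the ends stay on two given sides, h is a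
    simple root of a polynomial of degree at most 2 with smooth coefficients, so h is piecewise C2
    ([level_pwC2]) and the oriented area becomes a Dirichlet form ([ART_area_dirichlet], [energyE]).

    By the Wirtinger inequality this form is nonnegative on antiperiodic functions and zero only on
    sinusoids ([dirichlet_ge0], [dirichlet_eq0]). A sinusoid means that all image lines are
    concurrent ([energy_eq0]). In a centrally symmetric polygon they are, sigma being the point
    reflection ([energy_symmetric]). Conversely, if they are concurrent for every p, computing the
    common point from two adjacent corners relates the ratios of opposite sides ([ratio_relation]),
    and an argument on the parity of n makes all ratios -1 ([energy0_ratio]), which is central
    symmetry.

    An affine map carries chords and sigma along, and multiplies the Dirichlet form by the absolute
    value of its determinant ([dirichlet_image], [energy_image]), exactly like the area; hence the
    invariance of the quotient and the covariance of the maximizers.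

    The maximum exists by continuity on a compact set ([energy_continuous]). The delicate case is a
    limit point on the boundary: chords are encoded by polynomial conditions on a compact cube
    ([config]), whose solutions over a boundary point p all give [sigma p] as contact point
    ([config_boundary]), and dominated convergence carries h and h' to the limit ([dirichlet_cvg]).
    As the energy vanishes on the boundary, a positive maximum is attained only inside. *)

Lemma eq_rV2 u v : u 0 0 = v 0 0 -> u 0 1 = v 0 1 -> u = v.
Proof.
move=> h0 h1; apply/rowP => j; case: (unliftP 0 j) => [k ->|->]; last exact: h0.
by rewrite (ord1 k); have -> : lift 0 0 = 1 :> 'I_2 by apply/val_inj.
Qed.

Lemma det2C u v : det2 u v = - det2 v u.
Proof. rewrite /det2; ring. Qed.

Lemma det2xx u : det2 u u = 0.
Proof. rewrite /det2; ring. Qed.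

Lemma det2_free u v : free [:: u; v] -> det2 u v != 0.
Proof.
move=> uvF; apply/eqP => duv0.
have /freeP F := uvF.
have H (a b : R) : a *: u + b *: v = 0 -> a = 0 /\ b = 0.
  move=> ab0.
  have := F (fun i => if i == 0 then a else b).
  rewrite !big_ord_recl big_ord0 /= addr0 => /(_ ab0) k0.
  by split; [have := k0 0|have := k0 (lift 0 0)].
have [|a0 b0] := H (v 0 0) (- u 0 0).
- by apply: eq_rV2; rewrite !mxE; move: duv0; rewrite /det2; lra.
have [|a1 b1] := H (v 0 1) (- u 0 1).
- by apply: eq_rV2; rewrite !mxE; move: duv0; rewrite /det2; lra.
have [|/eqP] := H 1 0; last by rewrite oner_eq0.
by apply: eq_rV2; rewrite !mxE; lra.
Qed.

Lemma det2_eq0P u v : u != 0 -> det2 u v = 0 -> exists c, v = c *: u.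
Proof.
move=> u0 duv.
have [u00|u00] := eqVneq (u 0 0) 0.
  have u01 : u 0 1 != 0.
    by apply: contra_neq u0 => u01; apply: eq_rV2; rewrite ?u00 ?u01 mxE.
  exists (v 0 1 / u 0 1); apply: eq_rV2; rewrite !mxE ?u00 ?divfK // mulr0.
  by move: duv; rewrite /det2 u00 mul0r add0r => /eqP;
    rewrite oppr_eq0 mulf_eq0 (negbTE u01) => /eqP.
exists (v 0 0 / u 0 0); apply: eq_rV2; rewrite !mxE ?divfK //.
by apply: (mulfI u00); rewrite mulrA mulrCA mulfV // mulr1; move: duv; rewrite /det2; lra.
Qed.

Lemma scale_inj u (a b : R) : u != 0 -> a *: u = b *: u -> a = b.
Proof.
move=> u0 /eqP; rewrite -subr_eq0 -scalerBl scaler_eq0 (negbTE u0) orbF subr_eq0.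
by move=> /eqP.
Qed.

Definition det3 x y z : R := det2 (y - x) (z - x).

Lemma det3_rot x y z : det3 x y z = det3 y z x.
Proof. rewrite /det3 /det2 !mxE; ring. Qed.

Lemma det3_swap x y z : det3 x z y = - det3 x y z.
Proof. rewrite /det3 /det2 !mxE; ring. Qed.

Lemma plucker u v w z :
  det2 u w * det2 v z = det2 u v * det2 w z + det2 u z * det2 v w.
Proof. rewrite /det2; ring. Qed.

End PlaneAlgebra.

Section Indices.
Context {n : nat} (n_gt1 : (1 < n)%N).
Implicit Types i j : 'Z_(n.*2).

Lemma size_gt3 : (3 < n.*2)%N. Proof. lia. Qed.

Lemma ZpE : (Zp_trunc n.*2).+2 = n.*2.
Proof. by rewrite Zp_cast //; have := size_gt3; lia. Qed.

Lemma ZpN : (n.*2)%:R = 0 :> 'Z_(n.*2).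
Proof. by apply: pchar_Zp; have := size_gt3; lia. Qed.

Lemma Zp_half i : i + n%:R + n%:R = i.
Proof. by rewrite -addrA -natrD addnn ZpN addr0. Qed.

Lemma Zp_natr_inj (a b : nat) : (a < n.*2)%N -> (b < n.*2)%N ->
  a%:R = b%:R :> 'Z_(n.*2) -> a = b.
Proof.
move=> an bn /(congr1 val); rewrite /= !val_Zp_nat; try by have := size_gt3; lia.
by rewrite !modn_small.
Qed.

Lemma Zp_offset i j : exists2 m : nat, (m < n.*2)%N & j = i + m%:R.
Proof.
exists (val (j - i)); last by rewrite natr_Zp addrC subrK.
by rewrite -[X in (_ < X)%N]ZpE ltn_ord.
Qed.

Lemma Zp_add_inj i (a b : nat) : (a < n.*2)%N -> (b < n.*2)%N ->
  i + a%:R = i + b%:R -> a = b.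
Proof. by move=> an bn /addrI; apply: Zp_natr_inj. Qed.

Lemma Zp_addS_neq i (m : nat) : (0 < m < n.*2)%N -> i + m%:R != i.
Proof.
move=> /andP[m0 mn]; apply/eqP => h.
have /(@Zp_add_inj i) : i + m%:R = i + 0%:R by rewrite h addr0.
by move=> /(_ mn); lia.
Qed.

End Indices.

Section Convex.
Context {R : realType} {n : nat} {P : 'Z_(n.*2) -> 'rV[R]_2}.
Hypothesis hP : CPPOS P.
Let n1 := cppos_size hP.
Implicit Types i j k : 'Z_(n.*2).
Local Notation e := (edge P).

Lemma edge_turn i : 0 < det2 (e i) (e (i + 1)).
Proof.
have := cppos_convex hP i (i + 1 + 1); have := det2_free (cppos_genuine hP i).
have -> : det2 (e i) (P (i + 1 + 1) - P i) = det2 (e i) (e (i + 1)).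
  by rewrite /det2 /edge !mxE; ring.
by rewrite lt_neqAle eq_sym => -> ->.
Qed.

Lemma edge_turn1 i : 0 < det2 (e (i - 1)) (e i).
Proof. by have := edge_turn (i - 1); rewrite subrK. Qed.

Lemma edge_neq0 i : e i != 0.
Proof.
by apply/eqP => h; have := edge_turn i; rewrite h /det2 !mxE; lra.
Qed.

Lemma succ_neq i : i + 1 != i.
Proof. by apply: (@Zp_addS_neq _ n1 _ 1); lia. Qed.

(** Convexity is only assumed weakly, so a third vertex on the line of side i has to be excluded.
    Writing P k = P i + l e i, the value l < 0 contradicts side i - 1, l > 1 contradicts side i + 1,
    and 0 < l < 1 makes both edges at P k parallel to e i, although P k is a genuine vertex. *)
Lemma convex_strict i k : k != i -> k != i + 1 -> 0 < det2 (e i) (P k - P i).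
Proof.
move=> ki ki1; rewrite lt_neqAle eq_sym cppos_convex // andbT.
apply/eqP => h0.
have [l Pk] := det2_eq0P (edge_neq0 i) h0.
have ePk j : P j = P k - (P k - P j) by rewrite subKr.
have [l0|l0|l0] := ltrgtP l 0; last first.
- by move: Pk; rewrite l0 scale0r => /subr0_eq /(cppos_inj hP) /eqP; apply/negP.
- have [l1|l1|l1] := ltrgtP l 1; last first.
  + move: Pk; rewrite l1 scale1r /edge => /addIr /(cppos_inj hP) /eqP.
    exact/negP.
  + have h1 := cppos_convex hP (i + 1) k; have h2 := edge_turn i.
    have : det2 (e (i + 1)) (P k - P (i + 1)) = (1 - l) * det2 (e i) (e (i + 1)).
      have -> : P k - P (i + 1) = (l - 1) *: e i.
        by rewrite scalerBl -Pk scale1r /edge opprB addrA subrK.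
      by rewrite /det2 !mxE; ring.
    by move: h1 h2 => + + E; rewrite E; nra.
  (* For 0 < l < 1 the vertices P i and P (i + 1) lie on opposite sides of P k, yet both must be to
     the left of the two edges at P k. *)
  have key j : det2 (e j) (P i - P k) = - l * det2 (e j) (e i) /\
    det2 (e j) (P (i + 1) - P k) = (1 - l) * det2 (e j) (e i).
    have -> : P i - P k = - (l *: e i) by rewrite -Pk opprB.
    have -> : P (i + 1) - P k = (1 - l) *: e i.
      by rewrite scalerBl -Pk scale1r /edge opprB addrA subrK.
    by rewrite /det2 !mxE; split; ring.
  have [a1 a2] := key k; have [b1 b2] := key (k - 1).
  have A1 := cppos_convex hP k i; have A2 := cppos_convex hP k (i + 1).
  have B1 := cppos_convex hP (k - 1) i.
  have B2 := cppos_convex hP (k - 1) (i + 1).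
  have sh j : det2 (e (k - 1)) (P j - P (k - 1)) = det2 (e (k - 1)) (P j - P k).
    by rewrite /edge subrK /det2 !mxE; ring.
  rewrite sh in B1; rewrite sh in B2.
  have dk : det2 (e k) (e i) = 0.
    apply/eqP; rewrite eq_le; apply/andP; split; nra.
  have dk1 : det2 (e (k - 1)) (e i) = 0.
    apply/eqP; rewrite eq_le; apply/andP; split; nra.
  have := plucker (e i) (e (k - 1)) (e k) (e i).
  have := edge_turn1 k.
  have [ci ->] : exists c, e k = c *: e i.
    by apply: (det2_eq0P (edge_neq0 i)); rewrite det2C dk oppr0.
  have [cj ->] : exists c, e (k - 1) = c *: e i.
    by apply: (det2_eq0P (edge_neq0 i)); rewrite det2C dk1 oppr0.
  by rewrite /det2 !mxE; lra.
- have h1 := cppos_convex hP (i - 1) k; have h2 := edge_turn1 i.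
  have : det2 (e (i - 1)) (P k - P (i - 1)) = l * det2 (e (i - 1)) (e i).
    have -> : P k - P (i - 1) = l *: e i + e (i - 1).
      by rewrite -Pk /edge subrK addrA subrK.
    by rewrite /det2 !mxE; ring.
  by move: h1 h2 => + + E; rewrite E; nra.
Qed.

Lemma convex_strict_succ i k : k != i -> k != i + 1 ->
  0 < det2 (P i - P k) (P (i + 1) - P k).
Proof.
move=> ki ki1; have := convex_strict ki ki1.
by rewrite /det2 /edge !mxE; lra.
Qed.

(** Seen from P i, all other vertices lie weakly to the left of [e i], and consecutive ones turn
    left. Induction on c: the Plücker relation with reference vector [e i] makes turning left
    transitive in that half-plane. *)
Lemma ccw_strict i (b c : nat) : (0 < b < c)%N -> (c < n.*2)%N ->
  0 < det3 (P i) (P (i + b%:R)) (P (i + c%:R)).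
Proof.
move=> /andP[b0 bc] cn; rewrite /det3.
have side m : (1 < m < n.*2)%N -> 0 < det2 (e i) (P (i + m%:R) - P i).
  move=> hm; apply: convex_strict; first by apply: Zp_addS_neq; lia.
  by apply/eqP => /(@Zp_add_inj _ n1 i m 1); lia.
have [b1|b1] := eqVneq b 1%N; first by rewrite b1; apply: side; lia.
elim: c bc cn => [|c IH] bc cn; first lia.
have step : 0 < det2 (P (i + c%:R) - P i) (P (i + c.+1%:R) - P i).
  rewrite -natr1 addrA; apply: convex_strict_succ.
    by rewrite eq_sym; apply: Zp_addS_neq; lia.
  by rewrite eq_sym -addrA natr1; apply: Zp_addS_neq; lia.
have [->//|bc'] := eqVneq b c.
have IHc := IH ltac:(lia) ltac:(lia).
have := plucker (e i) (P (i + b%:R) - P i) (P (i + c%:R) - P i)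
  (P (i + c.+1%:R) - P i).
have := side b ltac:(lia); have := side c ltac:(lia).
have := side c.+1 ltac:(lia).
by move: IHc step; nra.
Qed.

Lemma ccw_weak i (b c : nat) : (b <= c <= n.*2)%N ->
  0 <= det3 (P i) (P (i + b%:R)) (P (i + c%:R)).
Proof.
move=> /andP[bc cn].
have [->|b0] := eqVneq b 0%N; first by rewrite addr0 /det3 subrr /det2 !mxE; lra.
have [->|cN] := eqVneq c (n.*2); first by rewrite ZpN // addr0 /det3 subrr /det2 !mxE; lra.
have [->|bc'] := eqVneq b c; first by rewrite /det3 det2xx.
by apply/ltW/ccw_strict; lia.
Qed.

End Convex.

(** * The boundary involution *)

Section Boundary.
Context {R : realType} {n : nat} {P : 'Z_(n.*2) -> 'rV[R]_2}.
Hypothesis hP : CPPOS P.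
Let n1 := cppos_size hP.
Implicit Types (i j k : 'Z_(n.*2)) (s u v : R) (x y z : 'rV[R]_2).
Local Notation e := (edge P).
Local Notation pt := (side_pt P).

(** The distance from z to the line of side i, scaled by the length of the side and positive on the
    inner side. *)
Definition height (P : 'Z_(n.*2) -> 'rV[R]_2) i z : R := det2 (edge P i) (z - P i).
Local Notation ht := (height P).

Lemma height_conv i z w (c : R) : ht i ((1 - c) *: z + c *: w) = (1 - c) * ht i z + c * ht i w.
Proof. by rewrite /height /det2 !mxE; ring. Qed.

Lemma height_shift i z w (t : R) : ht i (z + t *: w) = ht i z + t * det2 (e i) w.
Proof. by rewrite /height /det2 !mxE; ring. Qed.

Lemma side_ptE i s : pt i s = (1 - s) *: P i + s *: P (i + 1).
Proof. by apply: eq_rV2; rewrite /side_pt /edge !mxE; ring. Qed.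

Lemma side_pt0 i : pt i 0 = P i.
Proof. by rewrite /side_pt scale0r addr0. Qed.

Lemma side_pt1 i : pt i 1 = pt (i + 1) 0.
Proof. by rewrite side_pt0 /side_pt scale1r /edge addrC subrK. Qed.

Lemma height_vertex_ge0 i j : 0 <= ht i (P j).
Proof. exact: cppos_convex. Qed.

Lemma height_self i s : ht i (pt i s) = 0.
Proof. by rewrite /height /side_pt /det2 !mxE; ring. Qed.

Lemma height_side_ge0 i j s : 0 <= s <= 1 -> 0 <= ht i (pt j s).
Proof.
move=> s01; rewrite side_ptE height_conv.
by have := height_vertex_ge0 i j; have := height_vertex_ge0 i (j + 1); nra.
Qed.

Lemma height_vertex_eq0 i j : ht i (P j) = 0 -> j = i \/ j = i + 1.
Proof.
move=> h; have [->|ji] := eqVneq j i; first by left.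
have [->|ji1] := eqVneq j (i + 1); first by right.
by have := convex_strict hP ji ji1; rewrite [X in _ < X]h ltxx.
Qed.

Lemma height_side_eq0 i j s : 0 <= s < 1 -> ht i (pt j s) = 0 ->
  j = i \/ (j = i + 1 /\ s = 0).
Proof.
move=> s01; rewrite side_ptE height_conv => h.
have := height_vertex_ge0 i j; have := height_vertex_ge0 i (j + 1) => h2 h1.
have /height_vertex_eq0[->|ji] : ht i (P j) = 0 by nra.
  by left.
right; split=> //; apply/eqP/negP => /negP s0.
have : ht i (P (j + 1)) = 0.
  have : s * ht i (P (j + 1)) = 0 by nra.
  by move=> /eqP; rewrite mulf_eq0 (negbTE s0) => /eqP.
move=> /height_vertex_eq0; rewrite ji => -[/eqP|/eqP].
  have : i + 2%:R != i by apply: Zp_addS_neq; lia.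
  by rewrite [2%:R]mulrSr addrA => /negbTE ->.
by rewrite (negbTE (succ_neq hP _)).
Qed.

Lemma side_pt_inj i j s u : 0 <= s < 1 -> 0 <= u < 1 ->
  pt i s = pt j u -> i = j /\ s = u.
Proof.
move=> s01 u01 E.
have same k : pt k s = pt k u -> s = u.
  by move=> /addrI/(scale_inj (edge_neq0 hP k)).
have : ht i (pt j u) = 0 by rewrite -E height_self.
move=> /(height_side_eq0 u01)[ji|[ji u0]].
  by move: E; rewrite ji => /same.
move: E; rewrite ji u0 -side_pt1 => /addrI/(scale_inj (edge_neq0 hP i)).
by move: s01 => /[swap] ->; lra.
Qed.

(* The graph of [sigma]; as s < 1, each boundary point is on exactly one side. *)
Definition srel (P : 'Z_(n.*2) -> 'rV[R]_2) x x' :=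
  exists i s, [/\ 0 <= s < 1, x = side_pt P i s & x' = side_pt P (i + n%:R) s].

Lemma srel_closed x x' : srel P x x' <->
  exists i s, [/\ 0 <= s <= 1, x = pt i s & x' = pt (i + n%:R) s].
Proof.
split=> -[i [s [s01 -> ->]]].
  by exists i, s; split=> //; lra.
have [s1|s1] := eqVneq s 1; last by exists i, s; split=> //; lra.
exists (i + 1), 0; split; first by lra.
  by rewrite s1 side_pt1.
by rewrite s1 side_pt1 addrAC.
Qed.

Lemma srel_pt i s : 0 <= s <= 1 -> srel P (pt i s) (pt (i + n%:R) s).
Proof. by move=> s01; apply/srel_closed; exists i, s. Qed.

Lemma srel_fun x x' x'' : srel P x x' -> srel P x x'' -> x' = x''.
Proof.
move=> [i [s [s01 -> ->]]] [j [u [u01 E ->]]].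
by have [-> ->] := side_pt_inj s01 u01 E.
Qed.

Lemma srel_sym x x' : srel P x x' -> srel P x' x.
Proof.
by move=> [i [s [s01 -> ->]]]; exists (i + n%:R), s; rewrite Zp_half.
Qed.

Lemma srel_inj x y z : srel P x z -> srel P y z -> x = y.
Proof.
by move=> /srel_sym h1 /srel_sym h2; exact: (srel_fun h1 h2). Qed.

Lemma boundary_srel x : boundary P x <-> exists x', srel P x x'.
Proof.
split=> [[i [s [s01 ->]]]|[x' [i [s [s01 -> _]]]]].
  by exists (pt (i + n%:R) s); apply: srel_pt.
by exists i, s; split=> //; lra.
Qed.

Lemma sigmaE x x' : srel P x x' -> sigma P x = x'.
Proof.
move=> xx'; rewrite /sigma; apply: xget_unique; first by apply/srel_closed.
by move=> y /srel_closed yy; rewrite (srel_fun xx' yy).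
Qed.

Definition pos_orient (i : 'Z_(n.*2)) s (a : nat) u (b : nat) v :=
  0 < det3 (pt i s) (pt (i + a%:R) u) (pt (i + b%:R) v).

Lemma det3_sides x0 x1 y0 y1 z0 z1 s u v :
  det3 ((1 - s) *: x0 + s *: x1) ((1 - u) *: y0 + u *: y1)
       ((1 - v) *: z0 + v *: z1) =
  (1 - s) * (1 - u) * (1 - v) * det3 x0 y0 z0 +
  (1 - s) * (1 - u) * v * det3 x0 y0 z1 +
  (1 - s) * u * (1 - v) * det3 x0 y1 z0 +
  (1 - s) * u * v * det3 x0 y1 z1 +
  s * (1 - u) * (1 - v) * det3 x1 y0 z0 +
  s * (1 - u) * v * det3 x1 y0 z1 +
  s * u * (1 - v) * det3 x1 y1 z0 +
  s * u * v * det3 x1 y1 z1.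
Proof. by rewrite /det3 /det2 !mxE; ring. Qed.

(** The determinant is affine in each of s, u, v, hence a combination with nonnegative coefficients
    of the determinants of vertices, all nonnegative; the term of the three initial vertices is
    positive because s, u, v < 1. *)
Lemma orient_increasing i s u v (a b : nat) :
  0 <= s < 1 -> 0 <= u < 1 -> 0 <= v < 1 ->
  (0 < a < b)%N -> (b < n.*2)%N -> pos_orient i s a u b v.
Proof.
move=> s01 u01 v01 ab bn; rewrite /pos_orient !side_ptE det3_sides.
have C0 := ccw_strict hP i ab bn.
have W (a' b' : nat) : (a' <= b' <= n.*2)%N ->
  0 <= det3 (P i) (P (i + a'%:R)) (P (i + b'%:R)).
  exact: ccw_weak.
have W1 (a' b' : nat) : (0 < a' <= b')%N -> (b' <= n.*2)%N ->
    0 <= det3 (P (i + 1)) (P (i + a'%:R)) (P (i + b'%:R)).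
  case: a' b' => [|a'] [|b'] // h1 h2; try lia.
  by rewrite -(add1n a') -(add1n b') !natrD !addrA; apply: ccw_weak => //; lia.
have := W a b.+1 ltac:(lia); have := W a.+1 b ltac:(lia).
have := W a.+1 b.+1 ltac:(lia); have := W1 a b ltac:(lia) ltac:(lia).
have := W1 a b.+1 ltac:(lia) ltac:(lia); have := W1 a.+1 b ltac:(lia) ltac:(lia).
have := W1 a.+1 b.+1 ltac:(lia) ltac:(lia).
rewrite -(natr1 a) -(natr1 b) !addrA => h1 h2 h3 h4 h5 h6 h7.
have ps : 0 < 1 - s by lra.
have pu : 0 < 1 - u by lra.
have pv : 0 < 1 - v by lra.
have : 0 < (1 - s) * (1 - u) * (1 - v) * det3 (P i) (P (i + a%:R)) (P (i + b%:R)).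
  by rewrite !mulr_gt0.
have nn (c1 c2 c3 c4 : R) : 0 <= c1 -> 0 <= c2 -> 0 <= c3 -> 0 <= c4 ->
  0 <= c1 * c2 * c3 * c4.
  by move=> *; rewrite !mulr_ge0.
rewrite -!addrA => h0; apply: ltr_pwDl => //.
have [s0 u0 v0] : [/\ 0 <= s, 0 <= u & 0 <= v] by move/andP: s01 => []; move/andP: u01 => []; move/andP: v01 => [].
have [{}ps {}pu {}pv] : [/\ 0 <= 1 - s, 0 <= 1 - u & 0 <= 1 - v] by rewrite !ltW.
by rewrite !addr_ge0 //; apply: nn; rewrite ?addrA.
Qed.

(* The orientation of three boundary points only depends on their relative    *)
(* cyclic position, which [sigma] preserves.                                  *)
Lemma orient_transfer i i' s u v (a b : nat) :
  0 <= s < 1 -> 0 <= u < 1 -> 0 <= v < 1 -> (a < n.*2)%N -> (b < n.*2)%N ->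
  pos_orient i s a u b v -> pos_orient i' s a u b v.
Proof.
move=> s01 u01 v01 an bn.
have two_on_side k s1 s2 z : det3 (pt k s1) (pt k s2) z = (s2 - s1) * ht k z.
  by rewrite /det3 /height /side_pt /det2 !mxE; ring.
have pos k j w : 0 <= w < 1 -> (j != k) -> ~ (j = k + 1 /\ w = 0) -> 0 < ht k (pt j w).
  move=> w01 jk jk1; rewrite lt_neqAle eq_sym height_side_ge0 ?andbT; last lra.
  by apply/eqP => /(height_side_eq0 w01)[/eqP|//]; apply/negP.
have pair k k' s1 s2 (c : nat) w : 0 <= w < 1 -> (c < n.*2)%N ->
    0 < (s2 - s1) * ht k (pt (k + c%:R) w) ->
    0 < (s2 - s1) * ht k' (pt (k' + c%:R) w).
  move=> w01 cn h.
  have [c0|c0] := eqVneq c 0%N.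
    by move: h; rewrite c0 addr0 height_self mulr0 ltxx.
  have [[c1 w0]|c1] := pselect (c = 1%N /\ w = 0).
    by move: h; rewrite c1 w0 -side_pt1 height_self mulr0 ltxx.
  have H k0 : 0 < ht k0 (pt (k0 + c%:R) w).
    have cn' : (0 < c < n.*2)%N by rewrite lt0n c0.
    have n2 : (1 < n.*2)%N by clear -n1; lia.
    apply: pos => //; first exact: Zp_addS_neq.
    by move=> [/(@Zp_add_inj _ n1 k0 c 1) E w0]; apply: c1; split=> //; apply: E.
  by move: h; rewrite pmulr_lgt0 ?H// => h; rewrite mulr_gt0.
have wrap k (c : nat) : (c < n.*2)%N -> k = k + c%:R + (n.*2 - c)%:R.
  by move=> cn; rewrite -addrA -natrD subnKC ?ZpN ?addr0 //; lia.
have [a0|a0] := eqVneq a 0%N.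
  by rewrite /pos_orient a0 !addr0 !two_on_side; apply: pair.
have [b0|b0] := eqVneq b 0%N.
  rewrite /pos_orient b0 !addr0 -!(det3_rot (pt _ v)) !two_on_side.
  exact: pair.
have [ab|ab] := eqVneq a b.
  rewrite /pos_orient -ab !(det3_rot (pt _ s)) !two_on_side => h.
  have := @pair (i + a%:R) (i' + a%:R) u v (n.*2 - a)%N s s01.
  by rewrite -!wrap //; apply=> //; lia.
have [ab'|ab'] := ltnP a b; first by move=> _; apply: orient_increasing => //; lia.
have := @orient_increasing i s v u b a s01 v01 u01 ltac:(lia) an.
by rewrite /pos_orient det3_swap; lra.
Qed.

Lemma sigma_orient x x' y y' z z' : srel P x x' -> srel P y y' -> srel P z z' ->
  0 < det3 x y z -> 0 < det3 x' y' z'.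
Proof.
move=> [i [s [s01 -> ->]]] [j [u [u01 -> ->]]] [k [v [v01 -> ->]]].
have [a an ->] := Zp_offset n1 i j; have [b bn ->] := Zp_offset n1 i k.
rewrite !(addrAC _ _ n%:R).
exact: orient_transfer.
Qed.

Lemma sigma_orient_neg x x' y y' z z' : srel P x x' -> srel P y y' -> srel P z z' ->
  det3 x y z < 0 -> det3 x' y' z' < 0.
Proof.
move=> hx hy hz h; have := sigma_orient hx hz hy.
by rewrite !(det3_swap _ y) !(det3_swap _ y'); lra.
Qed.

(** P (i + n) is strictly to the left of side i and P i is weakly to the left of side i + n; for
    parallel edges this forces opposite directions. *)
Lemma edge_opp i : exists2 c, c < 0 & e (i + n%:R) = c *: e i.
Proof.
have [c Ec] := cppos_parallel hP i; exists c => //.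
have n2 : (0 < n < n.*2)%N by lia.
have h1 : 0 < ht i (P (i + n%:R)).
  apply: convex_strict => //; first exact: Zp_addS_neq.
  by apply/eqP => /(@Zp_add_inj _ n1 i n 1); lia.
have h2 := height_vertex_ge0 (i + n%:R) i.
have E2 : ht (i + n%:R) (P i) = - c * ht i (P (i + n%:R)).
  by rewrite /height Ec /det2 !mxE; ring.
rewrite ltNge le_eqVlt; apply/negP => /orP[/eqP c0|c0].
  by have := edge_neq0 hP (i + n%:R); rewrite Ec -c0 scale0r eqxx.
by move: h2; rewrite E2; nra.
Qed.

(** Half-plane descriptions of the region and of its interior, identified with them in [regionE] and
    [interior_regionE]. *)
Definition inK (P : 'Z_(n.*2) -> 'rV[R]_2) z := forall i, 0 <= height P i z.
Definition inI (P : 'Z_(n.*2) -> 'rV[R]_2) z := forall i, 0 < height P i z.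

Lemma inI_inK z : inI P z -> inK P z.
Proof. by move=> h i; apply: ltW. Qed.

Lemma inK_conv z w (k : R) : 0 <= k <= 1 -> inK P z -> inK P w ->
  inK P ((1 - k) *: z + k *: w).
Proof.
by move=> k01 hz hw i; rewrite height_conv; have := hz i; have := hw i; nra.
Qed.

Lemma boundary_inK z : boundary P z -> inK P z.
Proof. by move=> [i [s [s01 ->]]] j; apply: height_side_ge0. Qed.

(** On the line of side i, with parameter s, the heights over the two neighbouring sides are
    positive multiples of s and of 1 - s. *)
Lemma inK_height0 z i : inK P z -> ht i z = 0 ->
  exists2 s, 0 <= s <= 1 & z = pt i s.
Proof.
move=> hz h0; have [s E] := det2_eq0P (edge_neq0 hP i) h0.
have zE : z = pt i s by rewrite /side_pt -E addrC subrK.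
exists s => //.
have h1 := hz (i - 1); have h2 := hz (i + 1).
have E1 : ht (i - 1) z = s * det2 (e (i - 1)) (e i).
  have ee : e (i - 1) = P i - P (i - 1) by rewrite /edge subrK.
  by rewrite zE /height /side_pt ee /det2 !mxE; ring.
have E2 : ht (i + 1) z = (1 - s) * det2 (e i) (e (i + 1)).
  by rewrite zE /height /side_pt /det2 /edge !mxE; ring.
have := edge_turn hP i; have := edge_turn1 hP i.
by move: h1 h2; rewrite E1 E2; nra.
Qed.

Lemma boundaryP z : boundary P z <-> inK P z /\ exists i, ht i z = 0.
Proof.
split=> [hz|[hz [i h0]]].
  split; first exact: boundary_inK.
  by case: hz => i [s [s01 ->]]; exists i; rewrite height_self.
by have [s s01 ->] := inK_height0 hz h0; exists i, s.
Qed.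

Lemma inK_cases z : inK P z -> inI P z \/ boundary P z.
Proof.
move=> hz; have [[i h0]|h] := pselect (exists i, ht i z = 0).
  by right; apply/boundaryP; split=> //; exists i.
left=> i; rewrite lt_neqAle eq_sym hz andbT; apply/eqP => h0.
by apply: h; exists i.
Qed.

Lemma inI_nboundary z : inI P z -> ~ boundary P z.
Proof. by move=> hz /boundaryP[_ [i h0]]; have := hz i; rewrite h0 ltxx. Qed.

Lemma side_pt_inK i s : 0 <= s <= 1 -> inK P (pt i s).
Proof. by move=> s01 j; apply: height_side_ge0. Qed.

Lemma srel_inK x x' : srel P x x' -> inK P x /\ inK P x'.
Proof. by move=> [i [s [s01 -> ->]]]; split; apply: side_pt_inK; lra. Qed.

Lemma srel_boundary x x' : srel P x x' -> boundary P x /\ boundary P x'.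
Proof.
by move=> h; split; apply/boundary_srel; [exists x'|exists x; apply: srel_sym].
Qed.

End Boundary.

(** * Chords through an interior point *)

Section DotAlgebra.
Context {R : realType}.
Implicit Types (u v w : 'rV[R]_2) (r s t : R).

Lemma dotDr u v w : dot u (v + w) = dot u v + dot u w.
Proof. by rewrite /dot !mxE; ring. Qed.
Lemma dotBr u v w : dot u (v - w) = dot u v - dot u w.
Proof. by rewrite /dot !mxE; ring. Qed.
Lemma dotZr u r w : dot u (r *: w) = r * dot u w.
Proof. by rewrite /dot !mxE; ring. Qed.
Lemma dot_conv u v w r :
  dot u ((1 - r) *: v + r *: w) = (1 - r) * dot u v + r * dot u w.
Proof. by rewrite /dot !mxE; ring. Qed.

Lemma dot_self_gt0 u : u != 0 -> 0 < dot u u.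
Proof.
move=> u0; rewrite lt_neqAle eq_sym /dot addr_ge0 ?andbT ?sqr_ge0 -?expr2 ?sqr_ge0 //.
apply: contra_neq u0 => /eqP.
rewrite paddr_eq0 ?sqr_ge0 // !sqrf_eq0 => /andP[/eqP h0 /eqP h1].
by apply: eq_rV2; rewrite mxE.
Qed.

Lemma cos2Dsin2' t : cos t * cos t + sin t * sin t = 1 :> R.
Proof. by rewrite -!expr2 cos2Dsin2. Qed.

Lemma frame t w : w = dot (nvec t) w *: nvec t + dot (tvec t) w *: tvec t.
Proof.
have h := cos2Dsin2' t.
apply: eq_rV2; rewrite /dot !mxE /=.
  by rewrite -[LHS]mul1r -h; ring.
by rewrite -[LHS]mul1r -h; ring.
Qed.

Lemma dot_nt_eq0 t w : dot (nvec t) w = 0 -> w = dot (tvec t) w *: tvec t.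
Proof. by move=> h; rewrite {1}(frame t w) h scale0r add0r. Qed.

Lemma det2_nt t w v : dot (nvec t) w = 0 ->
  det2 w v = - dot (tvec t) w * dot (nvec t) v.
Proof.
move=> h; rewrite {1}(dot_nt_eq0 h).
by rewrite /dot /det2 !mxE /=; ring.
Qed.

Lemma nvecDpi t : nvec (t + pi) = - nvec t.
Proof. by apply: eq_rV2; rewrite !mxE /= ?cosDpi ?sinDpi. Qed.
Lemma tvecDpi t : tvec (t + pi) = - tvec t.
Proof. by apply: eq_rV2; rewrite !mxE /= ?cosDpi ?sinDpi. Qed.

Lemma polar_unit (a b : R) : a ^+ 2 + b ^+ 2 = 1 -> exists t, a = cos t /\ b = sin t.
Proof.
move=> ab; have a1 : -1 <= a <= 1 by apply/andP; split; nra.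
have ca : cos (acos a) = a by rewrite acosK.
have sa := sin_acos a1.
have sb : Num.sqrt (1 - a ^+ 2) = `|b|.
  by rewrite -sqrtr_sqr; congr Num.sqrt; lra.
have [b0|b0] := leP 0 b; [exists (acos a)|exists (- acos a)].
  by rewrite ca sa sb ger0_norm.
by rewrite cosN sinN ca sa sb ltr0_norm // opprK.
Qed.

Lemma polar_tvec w : w != 0 -> exists t, dot (nvec t) w = 0 /\ 0 < dot (tvec t) w.
Proof.
move=> w0; have r2 := dot_self_gt0 w0; set r := Num.sqrt (dot w w).
have r0 : 0 < r by rewrite sqrtr_gt0.
have rr : r ^+ 2 = dot w w by rewrite sqr_sqrtr // ltW.
have [|t [ct st]] := @polar_unit (w 0 1 / r) (- w 0 0 / r).
  rewrite !expr_div_n rr -mulrDl sqrrN; apply: (canLR (mulfK _)).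
    by rewrite gt_eqF.
  by rewrite /dot; ring.
exists t; rewrite /dot !mxE /= -ct -st; split; first by field; rewrite gt_eqF.
have -> : - (- w 0 0 / r) * w 0 0 + w 0 1 / r * w 0 1 = dot w w / r.
  by rewrite /dot; field; rewrite gt_eqF.
by rewrite divr_gt0.
Qed.

End DotAlgebra.

Section Chords.
Context {R : realType} {n : nat} {P : 'Z_(n.*2) -> 'rV[R]_2}.
Hypothesis hP : CPPOS P.
Let n1 := cppos_size hP.
Implicit Types (i j : 'Z_(n.*2)) (s t : R) (p v x y z : 'rV[R]_2).
Local Notation e := (edge P).
Local Notation pt := (side_pt P).
Local Notation ht := (height P).

(** The Minkowski gauge of the polygon centred at p: the ray from p along v leaves the polygon at p
    + v / gauge. *)
Definition gauge (P : 'Z_(n.*2) -> 'rV[R]_2) p v : R :=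
  \big[Num.max/0]_i (det2 v (edge P i) / height P i p).

Lemma gauge_ge p v i : det2 v (e i) / ht i p <= gauge P p v.
Proof. exact: le_bigmax. Qed.

Lemma gauge_attained p v : 0 < gauge P p v ->
  exists i, gauge P p v = det2 v (e i) / ht i p.
Proof.
move=> g0; suff [g|//] : gauge P p v = 0 \/ exists i, gauge P p v = det2 v (e i) / ht i p.
  by rewrite g ltxx in g0.
rewrite /gauge; apply: (big_ind (fun r => r = 0 \/ exists i, r = det2 v (e i) / ht i p)).
- by left.
- by move=> r s hr hs; rewrite /Num.max; case: ifP.
- by move=> i _; right; exists i.
Qed.

Lemma det2_edge_gt0 v : v != 0 -> exists i, 0 < det2 v (e i).
Proof.
move=> v0; have key i : det2 v (e i) != 0 -> exists j, 0 < det2 v (e j).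
  move=> h; have [c c0 E] := edge_opp hP i.
  have E' : det2 v (e (i + n%:R)) = c * det2 v (e i).
    by rewrite E /det2 !mxE; ring.
  have [h1|h1|h1] := ltrgtP (det2 v (e i)) 0; last by rewrite h1 eqxx in h.
    by exists (i + n%:R); rewrite E'; nra.
  by exists i.
have [h0|/key//] := eqVneq (det2 v (e 0)) 0.
have [h1|/key//] := eqVneq (det2 v (e (0 + 1))) 0.
have [a Ea] := det2_eq0P v0 h0; have [b Eb] := det2_eq0P v0 h1.
have := edge_turn hP 0; rewrite Ea Eb /det2 !mxE.
have -> : a * v 0 0 * (b * v 0 1) - a * v 0 1 * (b * v 0 0) = 0 by ring.
by rewrite ltxx.
Qed.

Lemma gauge_gt0 p v : inI P p -> v != 0 -> 0 < gauge P p v.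
Proof.
move=> hp /det2_edge_gt0[i h]; apply: lt_le_trans (gauge_ge p v i).
by rewrite divr_gt0.
Qed.

Lemma height_ray i p v s : ht i (p + s *: v) = ht i p - s * det2 v (e i).
Proof. by rewrite height_shift det2C mulrN. Qed.

Lemma gauge_boundary p v : inI P p -> v != 0 ->
  boundary P (p + (gauge P p v)^-1 *: v).
Proof.
move=> hp v0; have g0 := gauge_gt0 hp v0.
apply/(boundaryP hP); split=> [i|].
  rewrite height_ray subr_ge0 ler_pdivrMl // mulrC -ler_pdivrMl // mulrC.
  exact: gauge_ge.
have [i gE] := gauge_attained g0; exists i.
have d0 : det2 v (e i) != 0.
  by apply/eqP => d0; move: g0; rewrite gE d0 mul0r ltxx.
by rewrite height_ray gE invf_div mulrVK ?unitfE // ?subrr // divfK // subrr.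
Qed.

(** The height of the side met first vanishes there and is negative further along the ray. *)
Lemma ray_unique p v s t : inI P p -> 0 < s -> 0 < t ->
  boundary P (p + s *: v) -> boundary P (p + t *: v) -> s = t.
Proof.
move=> hp; wlog st : s t / s < t.
  move=> W s0 t0 hs ht'; have [st|st|//] := ltrgtP s t; first exact: W.
  by apply/esym/W.
move=> s0 t0 /(boundaryP hP)[_ [i]] + /(boundaryP hP)[/(_ i)].
rewrite !height_ray => E h _; have h0 := hp i.
have D0 : 0 < det2 v (e i) by rewrite -(pmulr_rgt0 _ s0); lra.
exfalso; have : s * det2 v (e i) < t * det2 v (e i) by rewrite ltr_pM2r.
by move: E h; lra.
Qed.

Lemma gauge_continuous p (w : R -> 'rV[R]_2) t0 :
  (forall j : 'I_2, {for t0, continuous (fun t => w t 0 j)}) ->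
  {for t0, continuous (fun t => gauge P p (w t))}.
Proof.
move=> hw; rewrite /gauge.
elim: (index_enum _) => [|i r IH].
  under [X in {for _, continuous X}]eq_fun do rewrite big_nil.
  exact: cvg_cst.
under [X in {for _, continuous X}]eq_fun do rewrite big_cons.
apply: (@continuous_max R R _ _ t0) IH.
apply: cvgM; last exact: cvg_cst.
by rewrite /det2; apply: cvgB; apply: cvgM; try exact: cvg_cst; exact: hw.
Qed.

Lemma inI_neq p x : inI P p -> boundary P x -> x != p.
Proof. by move=> hp hx; apply/eqP => E; apply: (inI_nboundary hP hp); rewrite -E. Qed.

Lemma line_boundary p x y k a : inI P p -> boundary P x -> boundary P y ->
  0 < k < 1 -> p = (1 - k) *: x + k *: y -> boundary P a ->
  det3 x y a = 0 -> a = x \/ a = y.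
Proof.
move=> hp hx hy k01 pE ha d0.
have xy : y - x != 0.
  rewrite subr_eq0; apply/eqP => E; apply: (inI_nboundary hP hp).
  by rewrite pE E -scalerDl subrK scale1r.
have [l E] := det2_eq0P xy d0.
have aE : a = p + (l - k) *: (y - x).
  have -> : a = x + l *: (y - x) by rewrite -E addrC subrK.
  by apply: eq_rV2; rewrite pE !mxE; ring.
have xE : x = p + k *: - (y - x) by apply: eq_rV2; rewrite pE !mxE; ring.
have yE : y = p + (1 - k) *: (y - x) by apply: eq_rV2; rewrite pE !mxE; ring.
have [lk|lk|lk] := ltrgtP l k.
- left; have aE' : a = p + (k - l) *: - (y - x).
    by rewrite aE scalerN -scaleNr opprB.
  have kl : 0 < k - l by lra.
  have k0 : 0 < k by lra.
  rewrite aE' in ha; rewrite xE in hx.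
  by rewrite aE' xE (ray_unique hp kl k0 ha hx) -xE.
- right; have kl : 0 < l - k by lra.
  have k0 : 0 < 1 - k by lra.
  rewrite aE in ha; rewrite yE in hy.
  by rewrite aE yE (ray_unique hp kl k0 ha hy) -yE.
- by exfalso; move/eqP: (inI_neq hp ha); rewrite aE lk subrr scale0r addr0.
Qed.

(** The chord x y through p together with its image x' y'. Requiring the image to point along
    [tvec t], and not only to have normal [nvec t], orders the two ends, so that there is exactly
    one such chord for each t. *)
Record pchord p t x x' y y' : Prop := PChord {
  pc_x : srel P x x';
  pc_y : srel P y y';
  pc_p : exists2 k, 0 < k < 1 & p = (1 - k) *: x + k *: y;
  pc_n : dot (nvec t) x' = dot (nvec t) y';
  pc_t : 0 < dot (tvec t) (y' - x')
}.

Lemma det3_nt t x y z : dot (nvec t) x = dot (nvec t) y ->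
  det3 x y z = - dot (tvec t) (y - x) * (dot (nvec t) z - dot (nvec t) x).
Proof.
by move=> h; rewrite /det3 (@det2_nt _ t) ?dotBr //; rewrite h subrr.
Qed.

(* Two chords through p cross at p, so their images under [sigma] cross. *)
Lemma pchord_cross p t1 t2 x x' y y' a a' b b' : inI P p ->
  pchord p t1 x x' y y' -> pchord p t2 a a' b b' ->
  (dot (nvec t1) a' - dot (nvec t1) x') * (dot (nvec t1) b' - dot (nvec t1) x') <= 0.
Proof.
move=> hp [hx hy [k k01 pE] hn ht1] [ha hb [m m01 pE'] _ _].
have [bx _] := srel_boundary hP hx; have [by_ _] := srel_boundary hP hy.
have [ba _] := srel_boundary hP ha; have [bb _] := srel_boundary hP hb.
have side z z' (hz : srel P z z') :
    [/\ 0 < det3 x y z -> dot (nvec t1) z' < dot (nvec t1) x',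
        det3 x y z < 0 -> dot (nvec t1) x' < dot (nvec t1) z' &
        det3 x y z = 0 -> dot (nvec t1) z' = dot (nvec t1) x'].
  split=> [/(sigma_orient hP hx hy hz)|/(sigma_orient_neg hP hx hy hz)|d0].
  - by rewrite (det3_nt _ hn); nra.
  - by rewrite (det3_nt _ hn); nra.
  have [bz _] := srel_boundary hP hz.
  have [E|E] := line_boundary hp bx by_ k01 pE bz d0; rewrite E in hz.
    by rewrite (srel_fun hP hz hx).
  by rewrite (srel_fun hP hz hy).
have S : (1 - m) * det3 x y a + m * det3 x y b = 0.
  have -> : (1 - m) * det3 x y a + m * det3 x y b = det3 x y p.
    by rewrite pE' /det3 /det2 !mxE; ring.
  by rewrite pE /det3 /det2 !mxE; ring.
have [a1 a2 a3] := side _ _ ha; have [b1 b2 b3] := side _ _ hb.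
have [h|h|h] := ltrgtP (det3 x y a) 0.
- have /b1 : 0 < det3 x y b by nra.
  by have := a2 h; nra.
- have /b2 : det3 x y b < 0 by nra.
  by have := a1 h; nra.
- by rewrite (a3 h) subrr mul0r.
Qed.

(** With equal angles the two factors in [pchord_cross] coincide, so a square is at most 0. *)
Lemma pchord_level p t x x' y y' a a' b b' : inI P p ->
  pchord p t x x' y y' -> pchord p t a a' b b' ->
  dot (nvec t) a' = dot (nvec t) x'.
Proof.
move=> hp h1 h2; have := pchord_cross hp h1 h2; rewrite -(pc_n h2) -expr2.
by move=> h; apply/eqP; rewrite -subr_eq0 -sqrf_eq0 eq_le h sqr_ge0.
Qed.

Lemma pchord_neq p t x x' y y' : pchord p t x x' y y' -> x <> y.
Proof.
move=> h E; have [hx hy _ _ +] := h; rewrite E in hx.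
by rewrite (srel_fun hP hx hy) subrr /dot !mxE !mulr0 addr0 ltxx.
Qed.

(** The images of a and b lie on the image line of x y. As sigma preserves strict orientations, a
    and b are themselves aligned with x and y, hence equal to them; the direction along [tvec t]
    excludes the exchange. *)
Lemma pchord_unique p t x x' y y' a a' b b' : inI P p ->
  pchord p t x x' y y' -> pchord p t a a' b b' -> a = x /\ b = y.
Proof.
move=> hp h1 h2; have L := pchord_level hp h1 h2.
have [hx hy [k k01 pE] hn ht1] := h1; have [ha hb _ hn' ht2] := h2.
have [bx _] := srel_boundary hP hx; have [by_ _] := srel_boundary hP hy.
have zero z z' (hz : srel P z z') : dot (nvec t) z' = dot (nvec t) x' -> z = x \/ z = y.
  move=> E; have [bz _] := srel_boundary hP hz.
  apply: (line_boundary hp bx by_ k01 pE bz).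
  have d0 : det3 x' y' z' = 0 by rewrite (det3_nt _ hn) E subrr mulr0.
  have [h|h|//] := ltrgtP (det3 x y z) 0.
    by have := sigma_orient_neg hP hx hy hz h; rewrite d0 ltxx.
  by have := sigma_orient hP hx hy hz h; rewrite d0 ltxx.
have [Ea|Ea] := zero _ _ ha L; have [Eb|Eb] := zero _ _ hb (etrans (esym hn') L).
- by have := pchord_neq h2; rewrite Ea Eb.
- by [].
- exfalso; rewrite Ea in ha; rewrite Eb in hb; move: ht1 ht2.
  rewrite (srel_fun hP ha hy) (srel_fun hP hb hx) !dotBr; lra.
- by have := pchord_neq h2; rewrite Ea Eb.
Qed.

Lemma pchord_of_line p x x' y y' k : inI P p -> srel P x x' -> srel P y y' ->
  0 < k < 1 -> p = (1 - k) *: x + k *: y -> x' != y' /\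
  exists t, pchord p t x x' y y'.
Proof.
move=> hp hx hy k01 pE.
have xy' : x' != y'.
  apply/eqP => E; rewrite -E in hy; have E' := srel_inj hP hx hy.
  apply: (inI_nboundary hP hp); have [bx _] := srel_boundary hP hx.
  by rewrite pE -E' -scalerDl subrK scale1r.
split=> //; have [|t [h1 h2]] := @polar_tvec _ (y' - x').
  by rewrite subr_eq0 eq_sym.
exists t; split=> //; first by exists k.
by move: h1; rewrite dotBr; lra.
Qed.

Lemma pchord_flip p t x x' y y' : pchord p t x x' y y' ->
  pchord p (t + pi) y y' x x'.
Proof.
move=> [hx hy [k k01 pE] hn ht1]; split=> //.
- by exists (1 - k); [lra|rewrite pE subKr addrC].
- by move: hn; rewrite nvecDpi /dot !mxE /=; lra.
- by move: ht1; rewrite tvecDpi /dot !mxE /=; lra.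
Qed.

End Chords.

Arguments pchord {R n} P p t x x' y y'.

(** * The region and its interior *)

Section RealAux.
Context {R : realType}.

Lemma opp_conv (u v : R) : u * v <= 0 -> exists2 m, 0 <= m <= 1 & (1 - m) * u + m * v = 0.
Proof.
move=> uv; have [->|u0] := eqVneq u 0; first by exists 0; lra.
have u2 : 0 < u ^+ 2 by rewrite exprn_even_gt0.
have uv0 : u - v != 0.
  apply/eqP => E; have vu : v = u by lra.
  by move: uv; rewrite vu -expr2 leNgt u2.
exists (u / (u - v)); last by field.
have -> : u / (u - v) = (u ^+ 2 - u * v) / (u - v) ^+ 2 by field.
have d2 : 0 < (u - v) ^+ 2 by rewrite exprn_even_gt0.
apply/andP; split; first by rewrite divr_ge0 ?ltW //; lra.
by rewrite ler_pdivrMr // mul1r; have := sqr_ge0 v; lra.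
Qed.

Lemma cos_lipschitz (a b : R) : `|cos a - cos b| <= `|a - b|.
Proof.
wlog ab : a b / a < b.
  move=> W; have [h|h|->] := ltgtP a b; last by rewrite !subrr !normr0 .
    exact: W.
  by rewrite distrC (distrC a); apply: W.
have [|c _ E] := @MVT R cos (fun x => - sin x) a b ab _.
  by apply: continuous_subspaceT => x; apply: continuous_cos.
by rewrite distrC (distrC a) E normrM normrN ler_piMl // ler_norml sin_geN1 sin_le1.
Qed.

Lemma sin_lipschitz (a b : R) : `|sin a - sin b| <= `|a - b|.
Proof.
wlog ab : a b / a < b.
  move=> W; have [h|h|->] := ltgtP a b; last by rewrite !subrr !normr0 .
    exact: W.
  by rewrite distrC (distrC a); apply: W.
have [|c _ E] := @MVT R sin cos a b ab _.
  by apply: continuous_subspaceT => x; apply: continuous_sin.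
by rewrite distrC (distrC a) E normrM ler_piMl // ler_norml cos_geN1 cos_le1.
Qed.

Lemma nvec_neq0 (t : R) : nvec t != 0.
Proof.
apply/eqP => /rowP h; have := cos2Dsin2' t.
by have := h 0; have := h 1; rewrite !mxE /= => -> ->; lra.
Qed.

Lemma line_eq_normal (p a b : 'rV[R]_2) t r : a != b ->
  line a b = normal_line p t r <->
  dot (nvec t) (a - p) = r /\ dot (nvec t) (b - p) = r.
Proof.
move=> ab; have [aL bL] : line a b a /\ line a b b.
  by split; [exists 0|exists 1]; rewrite ?scale0r ?addr0 // scale1r addrC subrK.
split=> [E|[ha hb]]; first by move: aL bL; rewrite E.
apply/seteqP; split=> z.
  move=> [s _ <-]; rewrite /normal_line /=.
  have -> : dot (nvec t) (a + s *: (b - a) - p) =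
    (1 - s) * dot (nvec t) (a - p) + s * dot (nvec t) (b - p).
    by rewrite /dot !mxE; ring.
  by rewrite ha hb; ring.
rewrite /normal_line /= => hz.
have d0 : det2 (b - a) (z - a) = 0.
  rewrite (@det2_nt _ t); last by move: ha hb; rewrite !dotBr; lra.
  have -> : dot (nvec t) (z - a) = 0 by move: ha hz; rewrite !dotBr; lra.
  by rewrite mulr0.
have [|s E] := det2_eq0P _ d0; first by rewrite subr_eq0 eq_sym.
by exists s => //; rewrite -E addrC subrK.
Qed.

End RealAux.

Lemma coordB_continuous (R : realType) (a : 'rV[R]_2) (j : 'I_2) :
  continuous (fun z : 'rV[R]_2 => (z - a) 0 j).
Proof.
move=> z.
have -> : (fun z' : 'rV[R]_2 => (z' - a) 0 j) = (fun z' => z' 0 j - a 0 j).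
  by apply/funext => z'; rewrite !mxE.
apply: continuousB; last exact: cst_continuous.
exact: coord_continuous.
Qed.

Lemma continuous_near_gt (R : realType) (T : topologicalType) (f : T -> R) z a :
  {for z, continuous f} -> a < f z -> \forall w \near z, a < f w.
Proof. by move=> fz az; apply: (cvgr_gt (f z)) => //; exact: fz. Qed.

Lemma continuous_near_lt (R : realType) (T : topologicalType) (f : T -> R) z a :
  {for z, continuous f} -> f z < a -> \forall w \near z, f w < a.
Proof. by move=> fz az; apply: (cvgr_lt (f z)) => //; exact: fz. Qed.

Lemma near_forall_fin (T : topologicalType) (I : finType) (z : T)
    (Q : I -> T -> Prop) :
  (forall i, \forall w \near z, Q i w) -> \forall w \near z, forall i, Q i w.
Proof. exact: (@filter_forall _ _ Q _ (nbhs_filter z)). Qed.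

Section Region.
Context {R : realType} {n : nat} {P : 'Z_(n.*2) -> 'rV[R]_2}.
Hypothesis hP : CPPOS P.
Let n1 := cppos_size hP.
Implicit Types (i j : 'Z_(n.*2)) (s t : R) (p v x y z : 'rV[R]_2).
Local Notation e := (edge P).
Local Notation pt := (side_pt P).
Local Notation ht := (height P).

Lemma region_vertex i : region P (P i).
Proof.
exists (fun j => (j == i)%:R); split.
- by move=> j; rewrite ler0n.
- by rewrite (bigD1 i) //= eqxx big1 ?addr0 // => j /negbTE ->.
rewrite (bigD1 i) //= eqxx scale1r big1 ?addr0 // => j /negbTE ->.
by rewrite scale0r.
Qed.

Lemma region_conv z w (k : R) : 0 <= k <= 1 -> region P z -> region P w ->
  region P ((1 - k) *: z + k *: w).
Proof.
move=> k01 [a [a0 a1 ->]] [b [b0 b1 ->]].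
exists (fun i => (1 - k) * a i + k * b i); split.
- by move=> i; have := a0 i; have := b0 i; nra.
- by rewrite big_split /= -!mulr_sumr a1 b1; lra.
rewrite !scaler_sumr -big_split; apply: eq_bigr => i _ /=.
by rewrite !scalerA scalerDl.
Qed.

(** A point satisfying all half-plane conditions is either on a side or between the two boundary
    points of a line through it, hence a convex combination of vertices. *)
Lemma regionE : region P = inK P.
Proof.
apply/seteqP; split=> z.
  move=> [w [w0 w1 ->]] i.
  have -> : ht i (\sum_j w j *: P j) = \sum_j w j * ht i (P j).
    have -> : ht i (\sum_j w j *: P j) =
      det2 (e i) (\sum_j w j *: P j) - (\sum_j w j) * det2 (e i) (P i).
      by rewrite w1 /height /det2 !mxE; ring.
    have -> : det2 (e i) (\sum_j w j *: P j) = \sum_j w j * det2 (e i) (P j).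
      rewrite /det2 !summxE !mulr_sumr -sumrB.
      by apply: eq_bigr => j _; rewrite !mxE; ring.
    rewrite mulr_suml -sumrB; apply: eq_bigr => j _.
    by rewrite /height /det2 !mxE; ring.
  by apply: sumr_ge0 => j _; rewrite mulr_ge0 //; apply: height_vertex_ge0.
have bd x : boundary P x -> region P x.
  by move=> [i [s [s01 ->]]]; rewrite side_ptE; apply: region_conv => //;
    apply: region_vertex.
move=> hz; have [hI|] := inK_cases hP hz; last exact: bd.
have v0 := @nvec_neq0 R 0; have v0' : - @nvec R 0 != 0 by rewrite oppr_eq0.
have b1 := gauge_boundary hP hI v0; have b2 := gauge_boundary hP hI v0'.
have g1 : 0 < (gauge P z (nvec 0))^-1 by rewrite invr_gt0 (gauge_gt0 hP hI v0).
have g2 : 0 < (gauge P z (- nvec 0))^-1 by rewrite invr_gt0 (gauge_gt0 hP hI v0').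
move: b1 b2 g1 g2; set a := _^-1; set b := _^-1 => b1 b2 g1 g2.
have -> : z = (1 - a / (a + b)) *: (z + a *: nvec 0) + (a / (a + b)) *: (z + b *: - nvec 0).
  have ab : a + b != 0 by rewrite gt_eqF // addr_gt0.
  by apply: eq_rV2; rewrite !mxE; field.
apply: region_conv; try exact: bd.
have ab : 0 < a + b by rewrite addr_gt0.
by apply/andP; split; [rewrite ltW // divr_gt0|rewrite ler_pdivrMr // mul1r; lra].
Qed.

Lemma height_continuous i z : {for z, continuous (ht i)}.
Proof.
have E : ht i = (fun w => e i 0 0 * (w - P i) 0 1 - e i 0 1 * (w - P i) 0 0).
  by apply/funext.
rewrite E; by apply: continuousB; apply: continuousM; try exact: cst_continuous;
  exact: coordB_continuous.
Qed.

Lemma interior_regionE : (region P)° = inI P.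
Proof.
rewrite regionE; apply/seteqP; split=> z; last first.
  move=> hz; change (\forall w \near z, forall i, 0 <= ht i w).
  apply: near_forall_fin => i.
  by have := continuous_near_gt (@height_continuous i z) (hz i);
    apply: filterS => y /ltW.
move=> hz i; have hK : inK P z by exact: (nbhs_singleton hz).
rewrite lt_neqAle eq_sym hK andbT; apply/eqP => h0.
(* Moving against this direction lowers the height over side i, so a point of height 0 has no
   neighbourhood in the region. *)
pose v := e (i + 1).
have hv : 0 < det2 (e i) v by exact: edge_turn.
have c : (fun t : R => z - t *: v) @ (0 : R) --> z - (0 : R) *: v.
  by apply: cvgB; [exact: cvg_cst|apply: cvgZr_tmp; exact: cvg_id].
rewrite scale0r subr0 in c.
have H : \forall t \near (0 : R), inK P (z - t *: v) by exact: c.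
have [t [/= t0 /(_ i)]] : exists t : R, 0 < t /\ inK P (z - t *: v).
  apply: (@filter_ex _ ((0 : R)^'+)); near=> t; split; near: t.
    exact: nbhs_right_gt.
  exact: cvg_within.
rewrite -scalerN height_shift h0.
have -> : det2 (e i) (- v) = - det2 (e i) v by rewrite /det2 !mxE; ring.
by nra.
Unshelve. all: by end_near. Qed.

Definition bound (P : 'Z_(n.*2) -> 'rV[R]_2) : R := \sum_i (`|P i 0 0| + `|P i 0 1|).

Lemma region_bound z (c : 'I_2) : inK P z -> `|z 0 c| <= bound P.
Proof.
rewrite -regionE => -[w [w0 w1 ->]]; rewrite summxE.
apply: le_trans (ler_norm_sum _ _ _) _; apply: ler_sum => i _.
have wi : w i <= 1 by rewrite -w1 (bigD1 i) //= lerDl sumr_ge0.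
rewrite mxE normrM ger0_norm //; apply: le_trans (ler_piMl _ wi) _ => //.
case: (unliftP 0 c) => [k ->|->]; last by rewrite lerDl.
by rewrite (ord1 k) (_ : lift 0 0 = 1) ?lerDr //; apply/val_inj.
Qed.

Lemma bound_ge0 : 0 <= bound P.
Proof. by apply: sumr_ge0 => i _; rewrite addr_ge0. Qed.

Section Existence.
Variables (p : 'rV[R]_2) (hp : inI P p) (t : R).

Definition ray_pt (f : R) := p + (gauge P p (nvec f))^-1 *: nvec f.

Lemma ray_pt_boundary f : boundary P (ray_pt f).
Proof. by apply: gauge_boundary => //; apply: nvec_neq0. Qed.

Lemma ray_pt_continuous f (c : 'I_2) : {for f, continuous (fun f => ray_pt f 0 c)}.
Proof.
have nc (d : 'I_2) : {for f, continuous (fun f : R => nvec f 0 d)}.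
  under [X in {for _, continuous X}]eq_fun do rewrite mxE.
  by case: (d == 0); [exact: continuous_cos|exact: continuous_sin].
rewrite /ray_pt; under [X in {for _, continuous X}]eq_fun do rewrite !mxE.
apply: cvgD; first exact: cvg_cst.
apply: cvgM; last first.
  by case: (c == 0); [exact: continuous_cos|exact: continuous_sin].
apply: cvgV; last by apply: gauge_continuous.
by rewrite gt_eqF // gauge_gt0 // nvec_neq0.
Qed.

Lemma sigma_ray_continuous : continuous (fun f => dot (nvec t) (sigma P (ray_pt f))).
Proof.
move=> f0.
have htc i : {for f0, continuous (fun f => ht i (ray_pt f))}.
  rewrite /height /det2.
  have c (j : 'I_2) : {for f0, continuous (fun f => (ray_pt f - P i) 0 j)}.
    under [X in {for _, continuous X}]eq_fun do rewrite mxE.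
    apply: cvgD; first exact: ray_pt_continuous.
    exact: cvg_cst.
  by apply: cvgB; apply: cvgM; try exact: cvg_cst; exact: c.
(* Along side i, sigma is affine, and the level of the image varies as [C i * dot (e i) x]. *)
pose C i := dot (nvec t) (e (i + n%:R)) / dot (e i) (e i).
have dc i : {for f0, continuous (fun f => C i * dot (e i) (ray_pt f))}.
  apply: cvgM; first exact: cvg_cst.
  rewrite /dot; apply: cvgD; apply: cvgM; try exact: cvg_cst;
    exact: ray_pt_continuous.
apply/cvgrPdist_lt => eps eps0.
(* For f near f0, the boundary point stays on the sides that contain the point at f0, so both points
   can be compared on a common side. *)
have N1 : \forall f \near f0, forall i, 0 < ht i (ray_pt f0) -> 0 < ht i (ray_pt f).
  apply: near_forall_fin => i; have [h|h] := ltP 0 (ht i (ray_pt f0)).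
    by have := continuous_near_gt (htc i) h; apply: filterS.
  by near=> f.
have N2 : \forall f \near f0, forall i,
    `|C i * dot (e i) (ray_pt f0) - C i * dot (e i) (ray_pt f)| < eps.
  by apply: near_forall_fin => i; have /cvgrPdist_lt := dc i; exact.
near=> f.
have h1 : forall i, 0 < ht i (ray_pt f0) -> 0 < ht i (ray_pt f) by near: f.
have h2 : forall i, `|C i * dot (e i) (ray_pt f0) - C i * dot (e i) (ray_pt f)| < eps.
  by near: f.
have [i [s [s01 fE]]] := ray_pt_boundary f.
have h0 : ht i (ray_pt f0) = 0.
  apply/eqP; rewrite eq_le boundary_inK ?andbT; [|exact: hP|exact: ray_pt_boundary].
  by rewrite leNgt; apply/negP => /h1; rewrite fE height_self ltxx.
have [s0 s001 f0E] := inK_height0 hP (boundary_inK hP (ray_pt_boundary f0)) h0.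
have := h2 i; rewrite f0E fE !(sigmaE hP (srel_pt _ _)) //.
rewrite -!mulrBr -!dotBr /side_pt.
have E k (a b : R) : P k + a *: e k - (P k + b *: e k) = (a - b) *: e k.
  by apply: eq_rV2; rewrite !mxE; ring.
rewrite !E !dotZr mulrCA /C divfK //.
by rewrite gt_eqF // dot_self_gt0 // edge_neq0.
Unshelve. all: by end_near. Qed.

(** Rotate a line about p: the difference F of the levels of the images of its two ends changes sign
    after a half turn, hence vanishes for some direction. The ends are then ordered so that the
    image points along [tvec t]. *)
Lemma pchord_exists : exists x x' y y', pchord P p t x x' y y'.
Proof.
pose sb f := dot (nvec t) (sigma P (ray_pt f)).
pose F f := sb f - sb (f + pi).
have F0 : F pi = - F 0.
  rewrite /F add0r opprB; congr (_ - _); rewrite /sb /ray_pt.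
  by rewrite !nvecDpi -[pi as X in nvec X]add0r nvecDpi opprK.
have cF : {within `[0, pi], continuous F}.
  apply: continuous_subspaceT => f; apply: cvgB; first exact: sigma_ray_continuous.
  apply: (@continuous_comp _ _ _ (fun f => f + pi) sb); last exact: sigma_ray_continuous.
  by apply: cvgD; [exact: cvg_id|exact: cvg_cst].
have [||c _ Fc] := @IVT R F 0 pi 0 _ cF; first exact: pi_ge0.
  by rewrite F0 ge_min le_max !oppr_le0 !oppr_ge0 orbC; case: (leP 0 (F 0)) => //= h;
    rewrite ltW.
have [x' hx] := (boundary_srel _).1 (ray_pt_boundary c).
have [y' hy] := (boundary_srel _).1 (ray_pt_boundary (c + pi)).
have hn : dot (nvec t) x' = dot (nvec t) y'.
  by move: Fc; rewrite /F /sb (sigmaE hP hx) (sigmaE hP hy); lra.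
have [a a0 xE] : exists2 a, 0 < a & ray_pt c = p + a *: nvec c.
  by exists (gauge P p (nvec c))^-1 => //; rewrite invr_gt0 gauge_gt0 ?nvec_neq0.
have [b b0 yE] : exists2 b, 0 < b & ray_pt (c + pi) = p - b *: nvec c.
  exists (gauge P p (nvec (c + pi)))^-1.
    by rewrite invr_gt0 gauge_gt0 ?nvec_neq0.
  by rewrite /ray_pt nvecDpi scalerN.
have ab : a + b != 0 by rewrite gt_eqF // addr_gt0.
have pE : p = (1 - a / (a + b)) *: ray_pt c + (a / (a + b)) *: ray_pt (c + pi).
  by rewrite xE yE; apply: eq_rV2; rewrite !mxE; field.
have k01 : 0 < a / (a + b) < 1.
  by rewrite divr_gt0 ?addr_gt0 //= ltr_pdivrMr ?addr_gt0 // mul1r; lra.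
have [xy' _] := pchord_of_line hP hp hx hy k01 pE.
have [h|h|h] := ltrgtP 0 (dot (tvec t) (y' - x')).
- exists (ray_pt c), x', (ray_pt (c + pi)), y'; split=> //.
  by exists (a / (a + b)).
- exists (ray_pt (c + pi)), y', (ray_pt c), x'; split=> //.
    exists (1 - a / (a + b)); first lra.
    by rewrite subKr addrC -pE.
  by move: h; rewrite !dotBr; lra.
- exfalso; move/eqP: xy'; apply; apply/eqP; rewrite eq_sym -subr_eq0; apply/eqP.
  have hw : dot (nvec t) (y' - x') = 0 by rewrite dotBr hn subrr.
  by rewrite (dot_nt_eq0 hw) -h scale0r.
Qed.

End Existence.

End Region.

(** * The level of the image line *)

Section LevelFunction.
Context {R : realType} {n : nat} {P : 'Z_(n.*2) -> 'rV[R]_2}.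
Hypothesis hP : CPPOS P.
Let n1 := cppos_size hP.
Implicit Types (i j : 'Z_(n.*2)) (s t : R) (p v x y z : 'rV[R]_2).
Local Notation e := (edge P).
Local Notation pt := (side_pt P).
Local Notation ht := (height P).

Lemma line_sym (a b : 'rV[R]_2) : line a b = line b a.
Proof.
have sub (c d : 'rV[R]_2) : line c d `<=` line d c.
  move=> z [s _ <-]; exists (1 - s) => //.
  by apply: eq_rV2; rewrite !mxE; ring.
by apply/seteqP; split; apply: sub.
Qed.

Lemma line_inter p x y z k (c : R) : inI P p -> boundary P x -> boundary P y ->
  0 < k < 1 -> p = (1 - k) *: x + k *: y -> z != p -> z = p + c *: (y - x) ->
  line p z `&` boundary P = [set x; y].
Proof.
move=> hp hx hy k01 pE zp zE.
have c0 : c != 0 by apply: contra_neq zp => c0; rewrite zE c0 scale0r addr0.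
apply/seteqP; split=> w.
  move=> [[s _ <-] hw]; apply: (line_boundary hP hp hx hy k01 pE hw).
  by rewrite zE pE /det3 /det2 !mxE; ring.
have cl (m : R) : line p z (p + m *: (y - x)).
  exists (m / c) => //.
  by apply: eq_rV2; rewrite zE !mxE; field.
move=> [->|->]; split=> //.
  have -> : x = p + (- k) *: (y - x) by apply: eq_rV2; rewrite pE !mxE; ring.
  exact: cl.
have -> : y = p + (1 - k) *: (y - x) by apply: eq_rV2; rewrite pE !mxE; ring.
exact: cl.
Qed.

Lemma line_chord p z : inI P p -> z != p -> exists x x' y y' k,
  [/\ srel P x x', srel P y y', 0 < k < 1, p = (1 - k) *: x + k *: y &
      line p z `&` boundary P = [set x; y]].
Proof.
move=> hp zp; have v0 : z - p != 0 by rewrite subr_eq0.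
have v0' : - (z - p) != 0 by rewrite oppr_eq0.
have b1 := gauge_boundary hP hp v0; have b2 := gauge_boundary hP hp v0'.
have g1 := gauge_gt0 hP hp v0; have g2 := gauge_gt0 hP hp v0'.
rewrite -invr_gt0 in g1; rewrite -invr_gt0 in g2.
move: b1 b2 g1 g2; set a := _^-1; set b := _^-1; set v := z - p => b1 b2 a0 b0.
have [y' hy] := (boundary_srel _).1 b1; have [x' hx] := (boundary_srel _).1 b2.
have ab : a + b != 0 by rewrite gt_eqF // addr_gt0.
have pE : p = (1 - b / (a + b)) *: (p + b *: - v) + (b / (a + b)) *: (p + a *: v).
  by apply: eq_rV2; rewrite !mxE; field.
have k01 : 0 < b / (a + b) < 1.
  by rewrite divr_gt0 ?addr_gt0 //= ltr_pdivrMr ?addr_gt0 // mul1r; lra.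
exists (p + b *: - v), x', (p + a *: v), y', (b / (a + b)); split=> //.
apply: (@line_inter _ _ _ _ _ (a + b)^-1 hp b2 b1 k01 pE) => //.
rewrite -[z in LHS](subrK p) addrC -/v; congr (_ + _).
by apply: eq_rV2; rewrite !mxE; field.
Qed.

Lemma PhiE (l : set 'rV[R]_2) x x' y y' : srel P x x' -> srel P y y' -> x != y ->
  l `&` boundary P = [set x; y] -> Phi P l = line x' y'.
Proof.
move=> hx hy xy lE; apply/seteqP; split=> z.
  move=> [a [b [ab abE]]]; rewrite lE in abE.
  have [ha hb] : [set x; y] a /\ [set x; y] b by rewrite abE; split; [left|right].
  case: ha hb ab => -> [] -> ab; rewrite ?eqxx // in ab *.
  - by rewrite (sigmaE hP hx) (sigmaE hP hy).
  - by rewrite (sigmaE hP hx) (sigmaE hP hy) line_sym.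
by exists x, y; rewrite (sigmaE hP hx) (sigmaE hP hy).
Qed.

Lemma chord_ends_neq p x y (k : R) : inI P p -> boundary P x -> 0 < k < 1 ->
  p = (1 - k) *: x + k *: y -> x != y.
Proof.
move=> hp hx k01 pE; apply/eqP => E; apply: (inI_nboundary hP hp).
by rewrite pE -E -scalerDl subrK scale1r.
Qed.

(** Passing from an unoriented image line to [pchord] costs a choice of the order of the ends; both
    orders give the same level. *)
Lemma normal_pchord p t r x x' y y' k : inI P p -> srel P x x' -> srel P y y' ->
  0 < k < 1 -> p = (1 - k) *: x + k *: y -> line x' y' = normal_line p t r ->
  r = dot (nvec t) (x' - p) /\
  (pchord P p t x x' y y' \/ pchord P p t y y' x x').
Proof.
move=> hp hx hy k01 pE E; have [xy' _] := pchord_of_line hP hp hx hy k01 pE.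
have [E1 E2] := (line_eq_normal p t r xy').1 E; split=> //.
have hn : dot (nvec t) x' = dot (nvec t) y' by move: E1 E2; rewrite !dotBr; lra.
have [h|h|h] := ltrgtP 0 (dot (tvec t) (y' - x')).
- by left; split=> //; exists k.
- right; split=> //; last by move: h; rewrite !dotBr; lra.
  by exists (1 - k); [lra|rewrite subKr addrC].
- exfalso; move/eqP: xy'; apply; apply/eqP; rewrite eq_sym -subr_eq0; apply/eqP.
  have hw : dot (nvec t) (y' - x') = 0 by rewrite dotBr hn subrr.
  by rewrite (dot_nt_eq0 hw) -h scale0r.
Qed.

Lemma qfunE p t x x' y y' : inI P p -> pchord P p t x x' y y' ->
  qfun P p t = dot (nvec t) (x' - p).
Proof.
move=> hp hc; have [hx hy [k k01 pE] hn _] := hc.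
have [bx _] := srel_boundary hP hx; have [by_ _] := srel_boundary hP hy.
have xy := chord_ends_neq hp bx k01 pE.
have [xy' _] := pchord_of_line hP hp hx hy k01 pE.
rewrite /qfun; apply: xget_unique.
  exists (line p y); first by exists y => //=; apply: (inI_neq hP).
  rewrite (PhiE hx hy xy).
    by apply/line_eq_normal => //; move: hn; rewrite !dotBr => ->.
  apply: (@line_inter _ _ _ _ _ (1 - k) hp bx by_ k01 pE); first exact: (inI_neq hP).
  by apply: eq_rV2; rewrite pE !mxE; ring.
move=> r [l [z /= zp <-]].
have [a [a' [b [b' [m [ha hb m01 pE' lE]]]]]] := line_chord hp zp.
have [ba _] := srel_boundary hP ha.
rewrite (PhiE ha hb (chord_ends_neq hp ba m01 pE') lE) => E.
have [-> hc'] := normal_pchord hp ha hb m01 pE' E; rewrite !dotBr; congr (_ - _).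
case: hc' => hc'; first exact: (pchord_level hP hp hc hc').
by rewrite -(pc_n hc'); exact: (pchord_level hP hp hc hc').
Qed.

(** Unlike [qfun], this is measured from the origin and thus depends on the image line only; it is
    the function h used throughout. *)
Definition level (P : 'Z_(n.*2) -> 'rV[R]_2) p t : R := dot (nvec t) p + qfun P p t.

Lemma levelE p t x x' y y' : inI P p -> pchord P p t x x' y y' ->
  level P p t = dot (nvec t) x'.
Proof. by move=> hp hc; rewrite /level (qfunE hp hc) dotBr addrC subrK. Qed.

Lemma levelE2 p t x x' y y' : inI P p -> pchord P p t x x' y y' ->
  level P p t = dot (nvec t) y'.
Proof. by move=> hp hc; rewrite -(pc_n hc); apply: levelE hc. Qed.

Lemma transitionsP p t x x' y y' : inI P p -> pchord P p t x x' y y' ->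
  transitions P p t <-> exists i, x = P i \/ y = P i.
Proof.
move=> hp hc; have [hx hy [k k01 pE] hn _] := hc.
have [bx _] := srel_boundary hP hx; have [by_ _] := srel_boundary hP hy.
have xy := chord_ends_neq hp bx k01 pE.
have [xy' _] := pchord_of_line hP hp hx hy k01 pE.
have bi i : boundary P (P i) by exists i, 0; rewrite side_pt0; split=> //; lra.
split=> [[i hi]|[i hi]]; exists i.
  have [a [a' [b [b' [m [ha hb m01 pE' lE]]]]]] := line_chord hp (inI_neq hP hp (bi i)).
  have [ba _] := srel_boundary hP ha.
  rewrite (PhiE ha hb (chord_ends_neq hp ba m01 pE') lE) in hi.
  have [_ hc'] := normal_pchord hp ha hb m01 pE' hi.
  have : [set a; b] (P i).
    rewrite -lE; split; last exact: bi.
    by exists 1 => //; rewrite scale1r addrC subrK.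
  case: hc' => hc'; have [<- <-] := pchord_unique hP hp hc hc'; case=> ->;
    by [left|right].
have hl : line p (P i) `&` boundary P = [set x; y].
  case: hi => hi.
    apply: (@line_inter _ _ _ _ _ (- k) hp bx by_ k01 pE); first exact: (inI_neq hP).
    by rewrite -hi; apply: eq_rV2; rewrite pE !mxE; ring.
  apply: (@line_inter _ _ _ _ _ (1 - k) hp bx by_ k01 pE); first exact: (inI_neq hP).
  by rewrite -hi; apply: eq_rV2; rewrite pE !mxE; ring.
rewrite (PhiE hx hy xy hl); apply/line_eq_normal => //.
by rewrite (qfunE hp hc); move: hn; rewrite !dotBr => ->.
Qed.

Lemma level_antiperiodic p t : inI P p -> level P p (t + pi) = - level P p t.
Proof.
move=> hp; have [x [x' [y [y' hc]]]] := pchord_exists hP hp t.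
rewrite (levelE2 hp hc) (levelE hp (pchord_flip hc)) nvecDpi /dot !mxE; ring.
Qed.

Lemma pchord_cross_pt p t1 t2 x x' y y' a a' b b' : inI P p ->
  pchord P p t1 x x' y y' -> pchord P p t2 a a' b b' ->
  exists2 m, 0 <= m <= 1 & dot (nvec t1) ((1 - m) *: a' + m *: b') = level P p t1.
Proof.
move=> hp h1 h2; have [m m01 E] := opp_conv (pchord_cross hP hp h1 h2).
exists m => //; rewrite (levelE hp h1) dot_conv; lra.
Qed.

Lemma dot_diff_le t1 t2 z (M : R) : `|z 0 0| <= M -> `|z 0 1| <= M ->
  `|dot (nvec t1) z - dot (nvec t2) z| <= 2 * M * `|t1 - t2|.
Proof.
move=> h0 h1; have c := cos_lipschitz t1 t2; have s := sin_lipschitz t1 t2.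
have -> : dot (nvec t1) z - dot (nvec t2) z =
  (cos t1 - cos t2) * z 0 0 + (sin t1 - sin t2) * z 0 1.
  by rewrite /dot !mxE /=; ring.
apply: le_trans (ler_normD _ _) _; rewrite !normrM.
rewrite -mulrA mulr_natl mulr2n (mulrC M).
by apply: lerD; apply: ler_pM.
Qed.

(** The image line of angle t1 meets the image chord of angle t2 at a point z of the region, so both
    levels are values at z, of [nvec t1] and of [nvec t2]. The constant does not depend on p. *)
Lemma level_lipschitz p t1 t2 : inI P p ->
  `|level P p t1 - level P p t2| <= 2 * bound P * `|t1 - t2|.
Proof.
move=> hp.
have [x [x' [y [y' h1]]]] := pchord_exists hP hp t1.
have [a [a' [b [b' h2]]]] := pchord_exists hP hp t2.
have [m m01 <-] := pchord_cross_pt hp h1 h2.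
have -> : level P p t2 = dot (nvec t2) ((1 - m) *: a' + m *: b').
  by rewrite dot_conv -(pc_n h2) (levelE hp h2); ring.
have [_ ka] := srel_inK hP (pc_x h2); have [_ kb] := srel_inK hP (pc_y h2).
by apply: dot_diff_le; apply: (region_bound hP); apply: inK_conv.
Qed.

Lemma level_bound p t : inI P p -> `|level P p t| <= 2 * bound P.
Proof.
move=> hp; have [x [x' [y [y' h1]]]] := pchord_exists hP hp t.
have [_ ka] := srel_inK hP (pc_x h1).
rewrite (levelE hp h1) /dot !mxE /=; apply: le_trans (ler_normD _ _) _.
rewrite mulr_natl mulr2n !normrM; apply: lerD.
  rewrite -[leRHS]mul1r; apply: ler_pM => //; last exact: (region_bound hP).
  by rewrite ler_norml cos_geN1 cos_le1.
rewrite -[leRHS]mul1r; apply: ler_pM => //; last exact: (region_bound hP).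
by rewrite ler_norml sin_geN1 sin_le1.
Qed.

End LevelFunction.

(** * Piecewise continuous functions *)

From mathcomp Require Import measurable_realfun.

Lemma near_to_right (R : realType) (Q : R -> Prop) (c : R) :
  (\forall t \near c, Q t) -> \forall t \near c^'+, Q t.
Proof. exact: cvg_within. Qed.

Lemma near_to_left (R : realType) (Q : R -> Prop) (c : R) :
  (\forall t \near c, Q t) -> \forall t \near c^'-, Q t.
Proof. exact: cvg_within. Qed.

Section LocalToGlobal.
Context {R : realType}.
Implicit Types (a b c t x y : R) (Q : R -> Prop).

Lemma near_ballP Q c : (\forall t \near c, Q t) <->
  exists2 eps, 0 < eps & forall t, `|t - c| < eps -> Q t.
Proof.
split=> [/nbhs_ballP[eps /= eps0 H]|[eps eps0 H]].
  by exists eps => // t tc; apply: H; rewrite /ball /= distrC.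
by apply/nbhs_ballP; exists eps => //= t; rewrite /ball /= distrC => /H.
Qed.

Lemma near_rightP Q c : (\forall t \near c^'+, Q t) <->
  exists2 eps, 0 < eps & forall t, c < t < c + eps -> Q t.
Proof.
split=> [|[eps eps0 H]].
  rewrite near_withinE => /near_ballP[eps eps0 H]; exists eps => // t tc.
  by apply: H; [rewrite ger0_norm; lra|lra].
rewrite near_withinE; apply/near_ballP; exists eps => // t tc ct; apply: H.
by move: tc; rewrite ger0_norm; lra.
Qed.

Lemma near_leftP Q c : (\forall t \near c^'-, Q t) <->
  exists2 eps, 0 < eps & forall t, c - eps < t < c -> Q t.
Proof.
split=> [|[eps eps0 H]].
  rewrite near_withinE => /near_ballP[eps eps0 H]; exists eps => // t tc.
  by apply: H; [rewrite ler0_norm; lra|lra].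
rewrite near_withinE; apply/near_ballP; exists eps => // t tc ct; apply: H.
by move: tc; rewrite ler0_norm; lra.
Qed.

Lemma near_right_near Q c : (\forall t \near c^'+, Q t) ->
  \forall t \near c^'+, \forall s \near t, Q s.
Proof.
move=> /near_rightP[eps eps0 H]; apply/near_rightP; exists eps => // t tc.
have h1 : \forall s \near t, c < s by apply: lt_nbhsr; lra.
have h2 : \forall s \near t, s < c + eps by apply: lt_nbhsl; lra.
by near=> s; apply: H; apply/andP; split; near: s.
Unshelve. all: by end_near. Qed.

Lemma near_left_near Q c : (\forall t \near c^'-, Q t) ->
  \forall t \near c^'-, \forall s \near t, Q s.
Proof.
move=> /near_leftP[eps eps0 H]; apply/near_leftP; exists eps => // t tc.
have h1 : \forall s \near t, c - eps < s by apply: lt_nbhsr; lra.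
have h2 : \forall s \near t, s < c by apply: lt_nbhsl; lra.
by near=> s; apply: H; apply/andP; split; near: s.
Unshelve. all: by end_near. Qed.

Lemma near_near Q c : (\forall t \near c, Q t) ->
  \forall t \near c, \forall s \near t, Q s.
Proof. exact: nbhs_interior. Qed.

(* An additive property of intervals that holds near every point, on either   *)
(* side of it, holds for all intervals.                                       *)
Lemma interval_induction (Q : R -> R -> Prop) a b :
  a <= b ->
  (forall x, Q x x) ->
  (forall x y z, x <= y <= z -> Q x y -> Q y z -> Q x z) ->
  (forall c, a <= c <= b -> exists2 eps, 0 < eps &
    (forall x y, c <= x <= y -> y < c + eps -> Q x y) /\
    (forall x y, c - eps < x -> x <= y <= c -> Q x y)) ->
  Q a b.
Proof.
move=> ab Q0 Qadd Qloc.
pose S := [set t | a <= t <= b /\ Q a t].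
have Sa : S a by split; [lra|].
have supS : has_sup S by split; [exists a|exists b => t [/andP[]]].
(* Left locality at s carries the property up to s, and right locality carries it beyond s unless s
   = b. *)
set s := sup S.
have as_ : a <= s by apply: (sup_upper_bound supS).
have sb : s <= b by apply: sup_le_ub; [exists a|move=> t [/andP[]]].
have [|eps eps0 [Qr Ql]] := Qloc s; first lra.
have [t [tab Qt] ts] : exists2 t, S t & s - eps < t.
  by apply: sup_adherent.
have ts' : t <= s by apply: (sup_upper_bound supS).
have Qs : Q a s by apply: (Qadd _ t) => //; [lra|apply: Ql; lra].
have [->//|sb'] := eqVneq b s.
have {}sb' : s < b by rewrite lt_neqAle eq_sym sb'.
pose y := Num.min b (s + eps / 2).
have sy : s < y by rewrite lt_min sb' /=; lra.
have ye : y <= s + eps / 2 by rewrite ge_min lexx orbT.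
have yb : y <= b by rewrite ge_min lexx.
have Sy : S y.
  by split; [lra|apply: (Qadd _ s) => //; [lra|apply: Qr; lra]].
by have := sup_upper_bound supS Sy; rewrite -/s; lra.
Qed.

End LocalToGlobal.

Section IntervalIntegral.
Context {R : realType}.
Implicit Types (a b c t x y : R) (f g : R -> R).
Local Notation mu := (@lebesgue_measure R).
Local Notation itg a b f := (mu.-integrable `[a, b] (EFin \o f)).
Local Notation int a b f := (\int[mu]_(t in `[a, b]) f t).

Lemma itv_eq_integral a b f g : itg a b f -> (forall t, a < t < b -> f t = g t) ->
  itg a b g /\ int a b g = int a b f.
Proof.
move=> itf fg.
have fg' : {in `]a, b[%classic, EFin \o f =1 EFin \o g}.
  by move=> t; rewrite inE /= in_itv /= => /fg /= ->.
have itf' : mu.-integrable `]a, b[ (EFin \o f).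
  by apply: integrableS itf => //; apply: subset_itvW.
have itg' : mu.-integrable `]a, b[ (EFin \o g).
  by apply: eq_integrable itf'.
have mg : measurable_fun `[a, b] (EFin \o g).
  by apply: emeasurable_fun_itv_cc; exact: (measurable_int mu itg').
split.
  apply/integrableP; split=> //.
  have [_] := integrableP _ _ _ itg'.
  rewrite -[X in (X < _)%E -> _](@integral_itv_bndoo _ _ _ _ true false) //.
  apply: measurableT_comp => //; exact: (measurable_int mu itg').
have oo (k : R -> R) : mu.-integrable `]a, b[ (EFin \o k) ->
    int a b k = \int[mu]_(t in `]a, b[) k t.
  move=> ik; rewrite /Rintegral (@integral_itv_bndoo _ _ _ _ true false) //.
  exact: (measurable_int mu ik).
rewrite !oo //; apply: eq_Rintegral => t.
by rewrite inE /= in_itv /= => /fg.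
Qed.

Lemma itv_integral_add a b c f : a <= b <= c -> itg a b f -> itg b c f ->
  itg a c f /\ int a c f = int a b f + int b c f.
Proof.
move=> /andP[ab bc] h1 h2.
have E : `[a, c]%classic = `[a, b]%classic `|` `]b, c]%classic.
  by rewrite -itv_bndbnd_setU // bnd_simp.
have h3 : mu.-integrable `]b, c] (EFin \o f).
  by apply: integrableS h2 => //; apply: subset_itv_oc_cc.
have mU : measurable_fun (`[a, b]%classic `|` `]b, c]%classic) (EFin \o f).
  by apply/measurable_funU => //; split; exact: (measurable_int mu).
have mf : measurable_fun `[a, c] (EFin \o f) by rewrite E.
have it : itg a c f.
  apply/integrableP; split=> //.
  rewrite E ge0_integral_setU //.
  - by apply: lte_add_pinfty; [case/integrableP: h1|case/integrableP: h3].
  - by apply: measurableT_comp.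
  - by apply/disj_setPS => y [/=]; rewrite 2!in_itv/= => /andP[_ yx] /andP[]; rewrite ltNge yx.
split=> //.
have := @Rintegral_itvB R f (BLeft a) (BRight c) b it.
rewrite !bnd_simp => /(_ ab bc) /(canRL (subrK _)) ->.
rewrite addrC Rintegral_itv_obnd_cbnd //.
Qed.

Lemma itv_integral_point a f : itg a a f /\ int a a f = 0.
Proof.
rewrite set_itv1; split; last exact: Rintegral_set1.
apply/integrableP; split; first exact: measurable_fun_set1.
by rewrite integral_set1.
Qed.

Lemma continuous_itg a b f : (forall t, a <= t <= b -> {for t, continuous f}) -> itg a b f.
Proof.
move=> cf; apply: continuous_compact_integrable; first exact: segment_compact.
by apply: continuous_in_subspaceT => t; rewrite inE /= in_itv /=; apply: cf.
Qed.

(** The one-sided pieces are continuous on a full neighbourhood of c, so that they are integrable up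
    to c; the value of g at c is left free. *)
Definition pwc_at g c := exists gl gr,
  [/\ \forall t \near c, {for t, continuous gl}, \forall t \near c, {for t, continuous gr},
      \forall t \near c^'-, g t = gl t & \forall t \near c^'+, g t = gr t].

Lemma pwc_local g c : pwc_at g c -> exists2 eps, 0 < eps & exists gl gr,
  [/\ forall t, c - eps < t < c + eps -> {for t, continuous gl},
      forall t, c - eps < t < c + eps -> {for t, continuous gr},
      forall t, c - eps < t < c -> g t = gl t & forall t, c < t < c + eps -> g t = gr t].
Proof.
move=> [gl [gr [/near_ballP[e1 e10 H1] /near_ballP[e2 e20 H2] /near_leftP[e3 e30 H3]
  /near_rightP[e4 e40 H4]]]].
pose e := Num.min (Num.min e1 e2) (Num.min e3 e4).
have [l1 l2 l3 l4] : [/\ e <= e1, e <= e2, e <= e3 & e <= e4].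
  by split; rewrite /e !ge_min lexx ?orbT.
exists e; first by rewrite !lt_min e10 e20 e30.
exists gl, gr; split=> t tc.
- by apply: H1; rewrite ltr_norml; lra.
- by apply: H2; rewrite ltr_norml; lra.
- by apply: H3; lra.
- by apply: H4; lra.
Qed.

Lemma pwc_integrable g a b : a <= b -> (forall c, a <= c <= b -> pwc_at g c) -> itg a b g.
Proof.
move=> ab hg; apply: (interval_induction (Q := fun x y => itg x y g)) => //.
- by move=> x; have [] := itv_integral_point x g.
- by move=> x y z xyz h1 h2; have [] := itv_integral_add xyz h1 h2.
move=> c /hg /pwc_local[eps eps0 [gl [gr [cl cr el er]]]]; exists eps => //; split.
  move=> x y cxy yc; have it : itg x y gr by apply: continuous_itg => t txy; apply: cr; lra.
  by have [] := itv_eq_integral it (g := g); first by move=> t txy; rewrite er //; lra.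
move=> x y cx xyc; have it : itg x y gl by apply: continuous_itg => t txy; apply: cl; lra.
by have [] := itv_eq_integral it (g := g); first by move=> t txy; rewrite el //; lra.
Qed.

Lemma C1_ftc f g a b : a <= b -> {for a, continuous f} -> {for b, continuous f} ->
  (forall t, a <= t <= b -> {for t, continuous g}) ->
  (forall t, a < t < b -> is_derive t 1 f (g t)) -> int a b g = f b - f a.
Proof.
move=> ab fa fb cg df; have [->|ab'] := eqVneq b a.
  by rewrite subrr; have [] := itv_integral_point a g.
have {}ab' : a < b by rewrite lt_neqAle eq_sym ab'.
have := @continuous_FTC2 R g f a b ab'; rewrite /Rintegral => -> //.
- by apply: continuous_in_subspaceT => t; rewrite inE /= in_itv /=; apply: cg.
- split.
  + by move=> t; rewrite in_itv /= => /df[].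
  + exact: (cvg_at_right_filter fa).
  + exact: (cvg_at_left_filter fb).
- by move=> t; rewrite in_itv /= => /df d; rewrite derive1E; apply: derive_val.
Qed.

(** The fundamental theorem for a continuous f whose derivative exists off a discrete set and is
    piecewise continuous; continuity of f makes the pieces telescope. *)
Lemma pw_ftc f g a b : a <= b ->
  (forall c, a <= c <= b -> [/\ {for c, continuous f}, pwc_at g c &
    \forall t \near c^', is_derive (t : R) 1 f (g t)]) ->
  itg a b g /\ int a b g = f b - f a.
Proof.
move=> ab H; split; first by apply: pwc_integrable => // c /H[].
suff [] : a <= b -> itg a b g /\ int a b g = f b - f a by [].
apply: (interval_induction (Q := fun x y => x <= y -> itg x y g /\ int x y g = f y - f x)) => //.
- by move=> x _; rewrite subrr; apply: itv_integral_point.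
- move=> x y z xyz h1 h2 _; have [xy yz] := andP xyz.
  have [i1 e1] := h1 xy; have [i2 e2] := h2 yz.
  by have [i3 ->] := itv_integral_add xyz i1 i2; split=> //; rewrite e1 e2; lra.
move=> c /H[fc /pwc_local[e1 e10 [gl [gr [cl cr el er]]]] df].
have /near_ballP[e2 e20 {}df] : \forall t \near c, t != c -> is_derive t 1 f (g t).
  by move: df; rewrite near_withinE.
pose eps := Num.min e1 e2.
have [l1 l2] : eps <= e1 /\ eps <= e2 by split; rewrite /eps !ge_min lexx ?orbT.
have cf t : c - eps < t < c + eps -> {for t, continuous f}.
  move=> tc; have [->//|tc'] := eqVneq t c.
  apply: differentiable_continuous; apply/derivable1_diffP.
  by have [] : is_derive t 1 f (g t) by apply: df => //; rewrite ltr_norml; lra.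
exists eps; first by rewrite lt_min e10.
split=> x y.
  move=> cxy yc xy; have it : itg x y gr by apply: continuous_itg => t txy; apply: cr; lra.
  have [|it' ->] := itv_eq_integral it (g := g); first by move=> t txy; rewrite er //; lra.
  split=> //; apply: C1_ftc => //; try (by apply: cf; lra).
    by move=> t txy; apply: cr; lra.
  move=> t txy; rewrite -er; last lra.
  by apply: df; [rewrite ltr_norml; lra|rewrite gt_eqF //; lra].
move=> cx xyc xy; have it : itg x y gl by apply: continuous_itg => t txy; apply: cl; lra.
have [|it' ->] := itv_eq_integral it (g := g); first by move=> t txy; rewrite el //; lra.
split=> //; apply: C1_ftc => //; try (by apply: cf; lra).
  by move=> t txy; apply: cl; lra.
move=> t txy; rewrite -el; last lra.
by apply: df; [rewrite ltr_norml; lra|rewrite lt_eqF //; lra].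
Qed.

Lemma pwc_cont g c : (\forall t \near c, {for t, continuous g}) -> pwc_at g c.
Proof. by move=> h; exists g, g; split=> //; near=> t. Unshelve. all: by end_near. Qed.

Lemma pwc_bin (op : R -> R -> R) f g c :
  (forall (f g : R -> R) t, {for t, continuous f} -> {for t, continuous g} ->
     {for t, continuous (fun t => op (f t) (g t))}) ->
  pwc_at f c -> pwc_at g c -> pwc_at (fun t => op (f t) (g t)) c.
Proof.
move=> hop [fl [fr [f1 f2 f3 f4]]] [gl [gr [g1 g2 g3 g4]]].
exists (fun t => op (fl t) (gl t)), (fun t => op (fr t) (gr t)); split.
- by apply: filterS2 f1 g1 => t; apply: hop.
- by apply: filterS2 f2 g2 => t; apply: hop.
- by apply: filterS2 f3 g3 => t -> ->.
- by apply: filterS2 f4 g4 => t -> ->.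
Qed.

Lemma pwcM f g c : pwc_at f c -> pwc_at g c -> pwc_at (fun t => f t * g t) c.
Proof. by apply: (@pwc_bin ( *%R)) => *; apply: continuousM. Qed.

Lemma pwcB f g c : pwc_at f c -> pwc_at g c -> pwc_at (fun t => f t - g t) c.
Proof. by apply: (@pwc_bin (fun x y => x - y)) => *; apply: continuousB. Qed.

End IntervalIntegral.

(** * Piecewise C2 functions *)

Section PiecewiseC2.
Context {R : realType}.
Implicit Types (a b c t x y : R) (f g h : R -> R) (T : set R).
Local Notation mu := (@lebesgue_measure R).
Local Notation itg a b f := (mu.-integrable `[a, b] (EFin \o f)).
Local Notation int a b f := (\int[mu]_(t in `[a, b]) f t).

Definition C2near f f1 f2 c := \forall t \near c,
  [/\ is_derive (t : R) 1 f (f1 t), is_derive (t : R) 1 f1 (f2 t)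
    & {for t, continuous f2}].

(** T is the set of break points. Each one-sided germ of h extends to a C2 function on both sides of
    c, and T avoids a punctured neighbourhood of every c, so it is discrete. *)
Record pwC2 T h : Prop := {
  pw_right : forall c, exists f f1 f2,
    [/\ C2near f f1 f2 c, h c = f c & \forall t \near c^'+, h t = f t /\ ~ T t];
  pw_left : forall c, exists f f1 f2,
    [/\ C2near f f1 f2 c, h c = f c & \forall t \near c^'-, h t = f t /\ ~ T t];
  pw_reg : forall c, ~ T c -> exists f f1 f2,
    C2near f f1 f2 c /\ \forall t \near c, h t = f t
}.

Definition branch T h f f1 f2 t := [/\ ~ T t, h t = f t, is_derive t 1 h (f1 t),
  h^`()%classic t = f1 t & is_derive t 1 (h^`()%classic) (f2 t)].

Lemma is_derive_continuous f t l : is_derive t 1 f l -> {for t, continuous f}.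
Proof. by move=> [d _]; apply/differentiable_continuous/derivable1_diffP. Qed.

Lemma near_branch T h f f1 f2 t : C2near f f1 f2 t -> (\forall s \near t, h s = f s) ->
  ~ T t -> branch T h f f1 f2 t.
Proof.
move=> C E Tt; have ft := nbhs_singleton E.
have d1 : \forall s \near t, is_derive (s : R) 1 h (f1 s).
  have E2 := near_near E; have Cn : C2near f f1 f2 t by [].
  apply: filterS2 E2 Cn => s Es [d _ _].
  by apply: near_eq_is_derive d; near do apply/esym.
have e1 : \forall s \near t, h^`()%classic s = f1 s.
  by apply: filterS d1 => s d; rewrite derive1E derive_val.
split=> //; [exact: nbhs_singleton d1|exact: nbhs_singleton e1|].
have [_ d2 _] := nbhs_singleton C.
by apply: near_eq_is_derive d2; near do apply/esym.
Unshelve. all: by end_near. Qed.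

Variables (T : set R) (h : R -> R).
Hypothesis H : pwC2 T h.

Lemma branch_right c : exists f f1 f2, [/\ C2near f f1 f2 c, h c = f c
  & \forall t \near c^'+, branch T h f f1 f2 t].
Proof.
have [f [f1 [f2 [C E N]]]] := pw_right H c; exists f, f1, f2; split=> //.
have N2 := near_right_near N.
have C2 : \forall t \near c^'+, C2near f f1 f2 t by apply: cvg_within; exact: near_near.
near=> t; have [_ Tt] : h t = f t /\ ~ T t by near: t.
apply: near_branch => //; first by near: t.
have : \forall s \near t, h s = f s /\ ~ T s by near: t.
by apply: filterS => s [].
Unshelve. all: by end_near. Qed.

Lemma branch_left c : exists f f1 f2, [/\ C2near f f1 f2 c, h c = f c
  & \forall t \near c^'-, branch T h f f1 f2 t].
Proof.
have [f [f1 [f2 [C E N]]]] := pw_left H c; exists f, f1, f2; split=> //.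
have N2 := near_left_near N.
have C2 : \forall t \near c^'-, C2near f f1 f2 t by apply: cvg_within; exact: near_near.
near=> t; have [_ Tt] : h t = f t /\ ~ T t by near: t.
apply: near_branch => //; first by near: t.
have : \forall s \near t, h s = f s /\ ~ T s by near: t.
by apply: filterS => s [].
Unshelve. all: by end_near. Qed.

Lemma C2near_cont f f1 f2 c : C2near f f1 f2 c ->
  \forall t \near c, [/\ {for t, continuous f}, {for t, continuous f1} & {for t, continuous f2}].
Proof. by apply: filterS => t [/is_derive_continuous ? /is_derive_continuous ? ?]. Qed.

Lemma punctured Q c : (\forall t \near c^'+, Q t) -> (\forall t \near c^'-, Q t) ->
  \forall t \near c^', Q t.
Proof.
move=> hr hl; rewrite near_withinE.
move: hr hl; rewrite !near_withinE => hr hl; near=> t => tc.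
have [lt|gt|E] := ltgtP t c; last by rewrite E eqxx in tc.
- have HH : t < c -> Q t by near: t.
  exact: HH.
- have HH : c < t -> Q t by near: t.
  exact: HH.
Unshelve. all: by end_near. Qed.

Lemma pw_derive c : \forall t \near c^', is_derive (t : R) 1 h (h^`()%classic t).
Proof.
have [f [f1 [f2 [_ _ Nr]]]] := branch_right c.
have [g [g1 [g2 [_ _ Nl]]]] := branch_left c.
by apply: punctured; [apply: filterS Nr|apply: filterS Nl] => t [_ _ d E _]; rewrite E.
Qed.

Lemma pw_continuous c : {for c, continuous h}.
Proof.
have [f [f1 [f2 [Cf Ef Nr]]]] := pw_right H c.
have [g [g1 [g2 [Cg Eg Nl]]]] := pw_left H c.
have [cf _ _] := nbhs_singleton (C2near_cont Cf).
have [cg _ _] := nbhs_singleton (C2near_cont Cg).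
apply/left_right_continuousP; split.
- rewrite Eg; apply: cvg_trans (cvg_at_left_filter cg).
  by apply: near_eq_cvg; apply: filterS Nl => t [].
- rewrite Ef; apply: cvg_trans (cvg_at_right_filter cf).
  by apply: near_eq_cvg; apply: filterS Nr => t [].
Qed.

Lemma pw_derive_pwc c : pwc_at (h^`()%classic) c.
Proof.
have [f [f1 [f2 [Cf _ Nr]]]] := branch_right c.
have [g [g1 [g2 [Cg _ Nl]]]] := branch_left c.
exists g1, f1; split.
- by apply: filterS (C2near_cont Cg) => t [].
- by apply: filterS (C2near_cont Cf) => t [].
- by apply: filterS Nl => t [].
- by apply: filterS Nr => t [].
Qed.

Lemma pw_pwc c : pwc_at h c.
Proof. by apply: pwc_cont; near=> t; apply: pw_continuous. Unshelve. all: by end_near. Qed.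

End PiecewiseC2.

Section OneSided.
Context {R : realType}.
Implicit Types (c t : R) (f h : R -> R).

Lemma dright_cvg f h c l : (\forall t \near c^'+, h t = f t) -> h c = f c ->
  is_derive c 1 f l -> (h (c + k) - h c) / k @[k --> (0 : R)^'+] --> l.
Proof.
move=> /near_rightP[eps eps0 E] Ec [df <-].
have D : (fun k => k^-1 *: (f (k *: 1 + c) - f c)) @ (0 : R)^' --> 'D_1 f c by [].
have {}D := cvg_dnbhs_at_right D.
apply: cvg_trans D; apply: near_eq_cvg; apply/near_rightP; exists eps => // k k0.
have Ek : h (c + k) = f (c + k) by apply: E; lra.
by rewrite Ek Ec /GRing.scale /= mulr1 mulrC (addrC k).
Qed.

Lemma dleft_cvg f h c l : (\forall t \near c^'-, h t = f t) -> h c = f c ->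
  is_derive c 1 f l -> (h (c + k) - h c) / k @[k --> (0 : R)^'-] --> l.
Proof.
move=> /near_leftP[eps eps0 E] Ec [df <-].
have D : (fun k => k^-1 *: (f (k *: 1 + c) - f c)) @ (0 : R)^' --> 'D_1 f c by [].
have {}D := cvg_dnbhs_at_left D.
apply: cvg_trans D; apply: near_eq_cvg; apply/near_leftP; exists eps => // k k0.
have Ek : h (c + k) = f (c + k) by apply: E; lra.
by rewrite Ek Ec /GRing.scale /= mulr1 mulrC (addrC k).
Qed.

Lemma dright_eq f h c l : (\forall t \near c^'+, h t = f t) -> h c = f c ->
  is_derive c 1 f l -> dright h c = l.
Proof. by move=> E Ec d; apply/cvg_lim => //; exact: (dright_cvg E Ec d). Qed.

Lemma dleft_eq f h c l : (\forall t \near c^'-, h t = f t) -> h c = f c ->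
  is_derive c 1 f l -> dleft h c = l.
Proof. by move=> E Ec d; apply/cvg_lim => //; exact: (dleft_cvg E Ec d). Qed.

Lemma dleft_antiperiodic f h c l : (forall t, h (t + pi) = - h t) ->
  (\forall t \near c^'-, h t = f t) -> h c = f c -> is_derive c 1 f l ->
  dleft h (c + pi) = - dleft h c.
Proof.
move=> ah E Ec d; rewrite (dleft_eq E Ec d).
apply/cvg_lim => //.
have -> : (fun k => (h (c + pi + k) - h (c + pi)) / k) =
  (fun k => - ((h (c + k) - h c) / k)).
  by apply/funext => k; rewrite addrAC !ah -mulNr; congr (_ / _); ring.
by apply: cvgN; exact: (dleft_cvg E Ec d).
Qed.

Lemma is_derive_dot_nvec (p : 'rV[R]_2) t :
  is_derive t 1 (fun t => dot (nvec t) p) (dot (tvec t) p).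
Proof.
have -> : (fun t : R => dot (nvec t) p) = (fun t => cos t * p 0 0 + sin t * p 0 1).
  by apply/funext => s; rewrite /dot !mxE.
apply: is_derive_eq; rewrite /dot !mxE /= /GRing.scale /=; ring.
Qed.

(** The moving frame satisfies n' = tau and tau' = - n. *)
Lemma derive1_frame (f g f1 g1 : R -> R) t :
  is_derive t 1 f (f1 t) -> is_derive t 1 g (g1 t) ->
  derive1 (fun s => f s *: nvec s + g s *: tvec s) t =
    (f1 t - g t) *: nvec t + (f t + g1 t) *: tvec t.
Proof.
move=> df dg; rewrite derive1E.
have d0 : is_derive t 1 (fun s => (f s *: nvec s + g s *: tvec s) 0 0)
    (((f1 t - g t) *: nvec t + (f t + g1 t) *: tvec t) 0 0).
  have -> : (fun s => (f s *: nvec s + g s *: tvec s) 0 0) =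
     (fun s => f s * cos s - g s * sin s).
    by apply/funext => s; rewrite !mxE /=; ring.
  by apply: is_derive_eq; rewrite !mxE /= /GRing.scale /=; ring.
have d1 : is_derive t 1 (fun s => (f s *: nvec s + g s *: tvec s) 0 1)
    (((f1 t - g t) *: nvec t + (f t + g1 t) *: tvec t) 0 1).
  have -> : (fun s => (f s *: nvec s + g s *: tvec s) 0 1) =
     (fun s => f s * sin s + g s * cos s).
    by apply/funext => s; rewrite !mxE /=; ring.
  by apply: is_derive_eq; rewrite !mxE /= /GRing.scale /=; ring.
have dm : derivable (fun s => f s *: nvec s + g s *: tvec s) t 1.
  apply/derivable_mxP => i j; rewrite (ord1 i).
  case: (unliftP 0 j) => [k ->|->]; last by case: d0.
  by rewrite (ord1 k) (_ : lift 0 0 = 1); [case: d1|apply/val_inj].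
rewrite derive_mx //; apply: eq_rV2; rewrite mxE.
  by case: d0 => _ <-.
by case: d1 => _ <-.
Qed.

End OneSided.

(** * The area of the front *)

Section AreaFormula.
Context {R : realType} {n : nat} {P : 'Z_(n.*2) -> 'rV[R]_2} {p : 'rV[R]_2}.
Local Notation mu := (@lebesgue_measure R).
Local Notation itg a b f := (mu.-integrable `[a, b] (EFin \o f)).
Local Notation int a b f := (\int[mu]_(t in `[a, b]) f t).
Local Notation T := (transitions P p).
Local Notation h := (level P p).
Local Notation q := (qfun P p).
Local Notation h' := (h^`()%classic).
Implicit Types (a b c t x y : R).

Lemma qfun_level : q = (fun t => h t - dot (nvec t) p).
Proof. by apply/funext => t; rewrite /level addrC addKr. Qed.

Lemma is_derive_qfun f (l : R) t : is_derive t 1 f l ->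
  is_derive t 1 (fun s => f s - dot (nvec s) p) (l - dot (tvec t) p).
Proof. by move=> d; apply: is_deriveB; exact: is_derive_dot_nvec. Qed.

(** One-sided derivatives of the level, obtained from those of [qfun] by adding the derivative of
    [dot (nvec t) p]. *)
Definition lder t := dleft q t + dot (tvec t) p.
Definition rder t := dright q t + dot (tvec t) p.

Lemma lderE f c (l : R) : (\forall t \near c^'-, h t = f t) -> h c = f c ->
  is_derive c 1 f l -> lder c = l.
Proof.
move=> N E /is_derive_qfun d; rewrite /lder (dleft_eq _ _ d) ?subrK // qfun_level ?E //.
by near=> t; rewrite (near N t).
Unshelve. all: by end_near. Qed.

Lemma rderE f c (l : R) : (\forall t \near c^'+, h t = f t) -> h c = f c ->
  is_derive c 1 f l -> rder c = l.
Proof.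
move=> N E /is_derive_qfun d; rewrite /rder (dright_eq _ _ d) ?subrK // qfun_level ?E //.
by near=> t; rewrite (near N t).
Unshelve. all: by end_near. Qed.

Lemma front_ptE t (d : R) : front_pt P p t d =
  h t *: nvec t + (d + dot (tvec t) p) *: tvec t.
Proof.
rewrite /front_pt /level.
transitivity (dot (nvec t) p *: nvec t + dot (tvec t) p *: tvec t
  + q t *: nvec t + d *: tvec t); first by rewrite -frame.
have gen (x1 x2 x3 x4 : 'rV[R]_2) : x1 + x2 + x3 + x4 = x1 + x3 + (x4 + x2).
  by rewrite -!addrA [x2 + _]addrC -!addrA.
by rewrite gen -!scalerDl.
Qed.

Lemma jump_term t : det2 (envelope_left P p t) (envelope_right P p t - envelope_left P p t) =
  h t * (rder t - lder t).
Proof.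
rewrite /envelope_left /envelope_right !front_ptE -/(rder t) -/(lder t).
have c := cos2Dsin2' t.
transitivity (h t * (rder t - lder t) * (cos t * cos t + sin t * sin t)).
  by rewrite /det2 !mxE /=; ring.
by rewrite c mulr1.
Qed.

(** The envelope point is h n + h' tau, with derivative (h + h'') tau. *)
Lemma cell_term f f1 f2 t : C2near f f1 f2 t -> (\forall s \near t, h s = f s) ->
  det2 (envelope P p t) (derive1 (envelope P p) t) = f t * (f t + f2 t).
Proof.
move=> C E.
have envE : \forall s \near t, envelope P p s = f s *: nvec s + f1 s *: tvec s.
  have E2 := near_near E; have C2 : \forall s \near t, [/\ is_derive (s : R) 1 f (f1 s), is_derive (s : R) 1 f1 (f2 s)
    & {for s, continuous f2}] by [].
  apply: filterS2 E2 C2 => s Es [d _ _].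
  have dq : is_derive s 1 q (f1 s - dot (tvec s) p).
    rewrite qfun_level; apply: is_derive_qfun.
    by apply: near_eq_is_derive d; near do apply/esym.
  by rewrite /envelope front_ptE derive1E derive_val subrK (nbhs_singleton Es).
have [d1 d2 _] := nbhs_singleton C.
rewrite (nbhs_singleton envE) derive1E (near_eq_derive _ envE) -derive1E.
rewrite (derive1_frame d1 d2) subrr scale0r add0r.
have c := cos2Dsin2' t.
transitivity (f t * (f t + f2 t) * (cos t * cos t + sin t * sin t)).
  by rewrite /det2 !mxE /=; ring.
by rewrite c mulr1.
Unshelve. all: by end_near. Qed.

Hypothesis H : pwC2 T h.
Hypothesis ah : forall t, h (t + pi) = - h t.

(** Extension by 0 over the transitions turns the integral over a set difference into one over the
    whole interval. *)
Let G := (fun t => det2 (envelope P p t) (derive1 (envelope P p) t)) \_ (~` T).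
Let J t := det2 (envelope_left P p t) (envelope_right P p t - envelope_left P p t).

Lemma cell_term_branch f f1 f2 t : C2near f f1 f2 t ->
  (\forall s \near t, h s = f s) -> ~ T t -> G t = f t * (f t + f2 t).
Proof.
by move=> C E Tt; rewrite /G /patch ifT ?(cell_term C E) // inE.
Qed.

Lemma jump_regular t : ~ T t -> J t = 0.
Proof.
move=> Tt; rewrite /J jump_term; have [f [f1 [f2 [C E]]]] := pw_reg H Tt.
have [d _ _] := nbhs_singleton C.
rewrite (lderE (f := f) _ _ d) ?(rderE (f := f) _ _ d) ?subrr ?mulr0 ?(nbhs_singleton E) //;
  by apply: cvg_within.
Qed.

Lemma right_data c : exists f f1 f2,
  [/\ C2near f f1 f2 c, h c = f c, rder c = f1 c &
    \forall t \near c^'+, [/\ C2near f f1 f2 t, \forall s \near t, h s = f s & ~ T t]].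
Proof.
have [f [f1 [f2 [C E N]]]] := pw_right H c; exists f, f1, f2.
have N2 := near_right_near N.
have C2 : \forall t \near c^'+, C2near f f1 f2 t by apply: cvg_within; exact: near_near.
have [d _ _] := nbhs_singleton C.
split=> //; first by apply: rderE E d; apply: filterS N => t [].
near=> t; have [ht Tt] : h t = f t /\ ~ T t by near: t.
split=> //; first by near: t.
have : \forall s \near t, h s = f s /\ ~ T s by near: t.
by apply: filterS => s [].
Unshelve. all: by end_near. Qed.

Lemma left_data c : exists f f1 f2,
  [/\ C2near f f1 f2 c, h c = f c, lder c = f1 c &
    \forall t \near c^'-, [/\ C2near f f1 f2 t, \forall s \near t, h s = f s & ~ T t]].
Proof.
have [f [f1 [f2 [C E N]]]] := pw_left H c; exists f, f1, f2.
have N2 := near_left_near N.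
have C2 : \forall t \near c^'-, C2near f f1 f2 t by apply: cvg_within; exact: near_near.
have [d _ _] := nbhs_singleton C.
split=> //; first by apply: lderE E d; apply: filterS N => t [].
near=> t; have [ht Tt] : h t = f t /\ ~ T t by near: t.
split=> //; first by near: t.
have : \forall s \near t, h s = f s /\ ~ T s by near: t.
by apply: filterS => s [].
Unshelve. all: by end_near. Qed.

Lemma lder_branch f f1 f2 t : C2near f f1 f2 t -> (\forall s \near t, h s = f s) ->
  lder t = f1 t /\ h' t = f1 t.
Proof.
move=> C E; have [d _ _] := nbhs_singleton C; split.
  by apply: lderE (nbhs_singleton E) d; apply: cvg_within.
have d' : is_derive t 1 h (f1 t).
  by apply: near_eq_is_derive d; near do apply/esym.
by rewrite derive1E derive_val.
Unshelve. all: by end_near. Qed.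

Lemma G_pwc c : pwc_at G c.
Proof.
have [f [f1 [f2 [C _ _ N]]]] := right_data c.
have [g [g1 [g2 [D _ _ M]]]] := left_data c.
exists (fun t => g t * (g t + g2 t)), (fun t => f t * (f t + f2 t)); split.
- apply: filterS (C2near_cont D) => t [c0 c1 c2].
  by apply: continuousM => //; apply: continuousD.
- apply: filterS (C2near_cont C) => t [c0 c1 c2].
  by apply: continuousM => //; apply: continuousD.
- by apply: filterS M => t [Ct Et Tt]; apply: cell_term_branch Ct Et Tt.
- by apply: filterS N => t [Ct Et Tt]; apply: cell_term_branch Ct Et Tt.
Qed.

Lemma dirichlet_pwc c : pwc_at (fun t => h t * h t - h' t * h' t) c.
Proof.
apply: pwcB; apply: pwcM; try exact: (pw_pwc H); exact: (pw_derive_pwc H).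
Qed.

(** Integration by parts on one cell: h (h + h'') + h'^2 - h^2 is the derivative of h h'. The
    boundary terms are those of the C2 extension f, since [x, y] may end at transitions. *)
Lemma cell_area f f1 f2 x y : x <= y ->
  (forall t, x <= t <= y -> C2near f f1 f2 t) ->
  (forall t, x < t < y -> (\forall s \near t, h s = f s) /\ ~ T t) ->
  int x y G = int x y (fun t => h t * h t - h' t * h' t) + f y * f1 y - f x * f1 x.
Proof.
move=> xy C E; pose k t := G t - (h t * h t - h' t * h' t).
have kp c : pwc_at k c by apply: pwcB; [exact: G_pwc|exact: dirichlet_pwc].
have kE : int x y k = int x y G - int x y (fun t => h t * h t - h' t * h' t).
  apply: RintegralB => //; apply: pwc_integrable => // c _; first exact: G_pwc.
  exact: dirichlet_pwc.
pose k0 t := f1 t * f1 t + f t * f2 t.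
have ck t : x <= t <= y -> {for t, continuous k0}.
  move=> /C/C2near_cont/nbhs_singleton[c0 c1 c2].
  by apply: continuousD; apply: continuousM.
have it : itg x y k0 by apply: continuous_itg.
have [|_ E2] := itv_eq_integral it (g := k).
  move=> t txy; have [Et Tt] := E t txy.
  have C' : C2near f f1 f2 t by apply: C; lra.
  rewrite /k /k0 (cell_term_branch C' Et Tt) (nbhs_singleton Et).
  by rewrite (lder_branch C' Et).2; ring.
have ff t : x <= t <= y -> is_derive t 1 (fun s => f s * f1 s) (k0 t).
  move=> /C/nbhs_singleton[d1 d2 _].
  by apply: is_derive_eq; rewrite /k0 /GRing.scale /=; ring.
suff : int x y k0 = f y * f1 y - f x * f1 x by rewrite -E2 kE; lra.
apply: (@C1_ftc R (fun s => f s * f1 s)) => //.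
- by apply: is_derive_continuous (ff x _); lra.
- by apply: is_derive_continuous (ff y _); lra.
- by move=> t txy; apply: ff; lra.
Qed.

(** With left derivatives at both ends and jumps counted on [x, y[, the formula is additive, so it
    suffices to check it on each side of a point. The jump h (h'+ - h'-) at a transition is exactly
    what replaces the right derivative by the left one. Finiteness is carried along to split the sum
    of the jumps. *)
Lemma piece_area x y : x <= y ->
  finite_set (`[x, y[ `&` T) /\
  int x y G + \sum_(t \in `[x, y[ `&` T) J t =
  int x y (fun t => h t * h t - h' t * h' t) + h y * lder y - h x * lder x.
Proof.
move=> xy; move: (xy).
apply: (interval_induction (Q := fun x y => x <= y -> finite_set (`[x, y[ `&` T) /\
  int x y G + \sum_(t \in `[x, y[ `&` T) J t =
  int x y (fun t => h t * h t - h' t * h' t) + h y * lder y - h x * lder x)) xy _ _ _.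
- move=> z _; rewrite set_itvco0 set0I; split; first exact: finite_set0.
  rewrite fsbig_set0 addr0 (itv_integral_point z _).2 (itv_integral_point z _).2.
  ring.
- move=> a b c /andP[ab bc] /(_ ab)[F1 E1] /(_ bc)[F2 E2] ac.
  have U : `[a, c[ `&` T = (`[a, b[ `&` T) `|` (`[b, c[ `&` T).
    by rewrite -setIUl -itv_bndbnd_setU // bnd_simp.
  rewrite U; split; first by rewrite finite_setU.
  rewrite fsbigU //; last first.
    move=> t [[+ _] [+ _]]; rewrite /= !in_itv /= => /andP[_ h1] /andP[h2 _].
    by move: h2; rewrite leNgt h1.
  have abc : a <= b <= c by rewrite ab.
  have iG u v : u <= v -> itg u v G by move=> uv; apply: pwc_integrable => // *; apply: G_pwc.
  have iD u v : u <= v -> itg u v (fun t => h t * h t - h' t * h' t).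
    by move=> uv; apply: pwc_integrable => // *; apply: dirichlet_pwc.
  rewrite (itv_integral_add abc (iG _ _ ab) (iG _ _ bc)).2.
  rewrite (itv_integral_add abc (iD _ _ ab) (iD _ _ bc)).2 /=; lra.
move=> c _.
have [f [f1 [f2 [C Ec rc /near_rightP[e1 e10 N]]]]] := right_data c.
have [g [g1 [g2 [D Fc lc /near_leftP[e2 e20 M]]]]] := left_data c.
exists (Num.min e1 e2); first by rewrite lt_min e10.
have [l1 l2] : Num.min e1 e2 <= e1 /\ Num.min e1 e2 <= e2 by rewrite !ge_min !lexx orbT.
split=> a b.
  move=> cab be ab.
  have [->|ab'] := eqVneq b a.
    rewrite set_itvco0 set0I; split; first exact: finite_set0.
    rewrite fsbig_set0 addr0 (itv_integral_point _ _).2 (itv_integral_point _ _).2.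
    ring.
  have {}ab' : a < b by rewrite lt_neqAle eq_sym ab'.
  have Ce t : c <= t < c + e1 -> C2near f f1 f2 t.
    by move=> tc; have [->//|tc'] := eqVneq t c; case: (N t) => //; lra.
  have A := @cell_area f f1 f2 a b ab.
  have hb : h b = f b /\ lder b = f1 b.
    have [C' E' _] : [/\ C2near f f1 f2 b, \forall s \near b, h s = f s & ~ T b].
      by apply: N; lra.
    by rewrite (nbhs_singleton E') (lder_branch C' E').1.
  have {}A : int a b G = int a b (fun t => h t * h t - h' t * h' t) + f b * f1 b - f a * f1 a.
    apply: A => t tab; first by apply: Ce; lra.
    by have [] : [/\ C2near f f1 f2 t, \forall s \near t, h s = f s & ~ T t] by apply: N; lra.
  have nT t : c < t < b -> ~ T t by move=> tc; case: (N t) => //; lra.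
  have [ac|ac] := eqVneq a c; last first.
    have S0 : `[a, b[ `&` T = set0.
      apply/seteqP; split=> // t []; rewrite /= in_itv /= => tab; apply: nT; lra.
    rewrite S0; split; first exact: finite_set0.
    rewrite fsbig_set0 A hb.1 hb.2.
    have [C' E' _] : [/\ C2near f f1 f2 a, \forall s \near a, h s = f s & ~ T a].
      by apply: N; lra.
    by rewrite (nbhs_singleton E') (lder_branch C' E').1; ring.
  (* The interval starts at c itself: [cell_area] produces the right derivative at c, and the jump
     at c, zero if c is not a transition, converts it. *)
  rewrite ac in A ab' *; have [Tc|Tc] := pselect (T c).
    have S1 : `[c, b[ `&` T = [set c].
      apply/seteqP; split=> t.
        move=> []; rewrite /= in_itv /= => tcb Tt.
        have [//|tc] := eqVneq t c; exfalso; apply: (nT t) => //; lra.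
      by move=> ->; split=> //; rewrite /= in_itv /= lexx.
    rewrite S1; split; first exact: finite_set1.
    by rewrite fsbig_set1 A hb.1 hb.2 /J jump_term rc -Ec; ring.
  have S0 : `[c, b[ `&` T = set0.
    apply/seteqP; split=> // t []; rewrite /= in_itv /= => tab.
    by have [->//|tc] := eqVneq t c; apply: nT; lra.
  rewrite S0; split; first exact: finite_set0.
  have := jump_regular Tc; rewrite /J jump_term rc => J0.
  rewrite fsbig_set0 A hb.1 hb.2 -Ec; move: J0; lra.
move=> ca abc ab.
have Ce t : c - e2 < t <= c -> C2near g g1 g2 t.
  by move=> tc; have [->//|tc'] := eqVneq t c; case: (M t) => //; lra.
have ends t : c - e2 < t <= c -> h t = g t /\ lder t = g1 t.
  move=> tc; have [->//|tc'] := eqVneq t c.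
  have [C' E' _] : [/\ C2near g g1 g2 t, \forall s \near t, h s = g s & ~ T t].
    by apply: M; lra.
  by rewrite (nbhs_singleton E') (lder_branch C' E').1.
have nT t : c - e2 < t < c -> ~ T t by move=> tc; case: (M t) => //; lra.
have S0 : `[a, b[ `&` T = set0.
  apply/seteqP; split=> // t []; rewrite /= in_itv /= => tab; apply: nT; lra.
rewrite S0; split; first exact: finite_set0.
have [ha la] := ends a ltac:(lra); have [hb lb] := ends b ltac:(lra).
rewrite fsbig_set0 addr0 (@cell_area g g1 g2) ?ha ?la ?hb ?lb //.
  by move=> t tab; apply: Ce; lra.
move=> t tab.
by have [] : [/\ C2near g g1 g2 t, \forall s \near t, h s = g s & ~ T t] by apply: M; lra.
Qed.

Lemma lder_antiperiodic t : lder (t + pi) = - lder t.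
Proof.
have [f [f1 [f2 [C E N]]]] := pw_left H t.
have [d _ _] := nbhs_singleton C.
have aq s : q (s + pi) = - q s.
  by rewrite qfun_level ah nvecDpi /dot !mxE; ring.
rewrite /lder tvecDpi (dleft_antiperiodic aq _ _ (is_derive_qfun d)).
- by rewrite /dot !mxE; ring.
- by near=> s; rewrite qfun_level; congr (_ - _); near: s; apply: filterS N => s [].
- by rewrite qfun_level E.
Unshelve. all: by end_near. Qed.

(** Over [0, pi] the boundary terms of [piece_area] cancel, h and its left derivative both changing
    sign under t + pi. *)
Theorem ART_area_dirichlet :
  ART_area P p = 2^-1 * int 0 pi (fun t => h t * h t - h' t * h' t).
Proof.
rewrite /ART_area; congr (_ * _).
have [_ E] := piece_area (pi_ge0 R).
rewrite setDE Rintegral_mkcondr -/G E -[pi as X in h X]add0r -[pi as X in lder X]add0r.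
by rewrite ah lder_antiperiodic; ring.
Qed.

End AreaFormula.

(** * Regularity of the level *)

Section QuadraticBranch.
Context {R : realType}.
Implicit Types t : R.

(* For [A != 0] the root at which the derivative [2 A x + B] is negative is    *)
(* [(- B - sqrt (B^2 - 4 A C)) / (2 A)], whatever the sign of [A].             *)
Lemma quadratic_branch (A h0 t0 : R) (B B1 B2 C C1 C2 : R -> R) :
  (forall t, is_derive t 1 B (B1 t)) -> (forall t, is_derive t 1 B1 (B2 t)) ->
  (forall t, is_derive t 1 C (C1 t)) -> (forall t, is_derive t 1 C1 (C2 t)) ->
  continuous B2 -> continuous C2 ->
  A * h0 ^+ 2 + B t0 * h0 + C t0 = 0 -> 2 * A * h0 + B t0 < 0 ->
  exists f f1 f2, [/\ C2near f f1 f2 t0, f t0 = h0,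
    \forall t \near t0, A * f t ^+ 2 + B t * f t + C t = 0 /\ 2 * A * f t + B t < 0 &
    forall t, f1 t = - (B1 t * f t + C1 t) / (2 * A * f t + B t)].
Proof.
move=> dB dB1 dC dC1 cB2 cC2 E0 N0.
have cB t : {for t, continuous B} by apply: is_derive_continuous (dB t).
have cC t : {for t, continuous C} by apply: is_derive_continuous (dC t).
have [f [ft0 Nf]] : exists f : R -> R, f t0 = h0 /\
  \forall t \near t0, [/\ A * f t ^+ 2 + B t * f t + C t = 0,
    2 * A * f t + B t < 0 & derivable f (t : R) 1].
  have [A0|A0] := eqVneq A 0.
    exists (fun t => - C t / B t); split.
      have Bn : B t0 != 0 by rewrite lt_eqF //; move: N0; rewrite A0; lra.
      have -> : C t0 = - (B t0 * h0) by move: E0; rewrite A0; lra.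
      by field.
    have NB : \forall t \near t0, B t < 0.
      by apply: continuous_near_lt; [exact: cB|move: N0; rewrite A0; lra].
    apply: filterS NB => t Bt; have Bt0 : B t != 0 by rewrite lt_eqF.
    rewrite A0; split; [by field|by lra|].
    have := is_deriveV Bt0 (dB t) => dV; have := dC t => dCt.
    by have [] : is_derive t 1 (fun t => - C t * (B t)^-1) _ := is_deriveM _ _.
  pose D t := B t ^+ 2 - 4 * A * C t.
  have cD : {for t0, continuous D}.
    by apply: continuousB; [apply: continuousM; exact: cB|apply: continuousM; [exact: cst_continuous|exact: cC]].
  have D0 : D t0 = (2 * A * h0 + B t0) ^+ 2.
    transitivity ((2 * A * h0 + B t0) ^+ 2 - 4 * A * (A * h0 ^+ 2 + B t0 * h0 + C t0)).
      by rewrite /D; ring.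
    by rewrite E0; ring.
  have ND : \forall t \near t0, 0 < D t.
    by apply: continuous_near_gt => //; rewrite D0 exprn_even_gt0 //= lt_eqF.
  exists (fun t => (- B t - Num.sqrt (D t)) / (2 * A)); split.
    by rewrite D0 sqrtr_sqr ltr0_norm //; field.
  apply: filterS ND => t Dt.
  have s2 : Num.sqrt (D t) ^+ 2 = D t by rewrite sqr_sqrtr // ltW.
  have s0 : 0 < Num.sqrt (D t) by rewrite sqrtr_gt0.
  split.
  - transitivity ((Num.sqrt (D t) ^+ 2 - D t) / (4 * A)); last by rewrite s2 subrr mul0r.
    by rewrite /D; field.
  - have -> : 2 * A * ((- B t - Num.sqrt (D t)) / (2 * A)) + B t = - Num.sqrt (D t) by field.
    by rewrite oppr_lt0.
  have dD : is_derive t 1 D (2 * B t * B1 t - 4 * A * C1 t).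
    have := dB t => dBt; have := dC t => dCt.
    by apply: is_derive_eq; rewrite /GRing.scale /=; ring.
  have dS := is_derive1_sqrt Dt.
  have dSD : is_derive t 1 (fun t => Num.sqrt (D t)) ((2 * Num.sqrt (D t))^-1 * (2 * B t * B1 t - 4 * A * C1 t)).
    exact: is_derive1_comp.
  have := dB t => dBt.
  by have [] : is_derive t 1 (fun t => (- B t - Num.sqrt (D t)) * (2 * A)^-1) _ := is_deriveM _ _.
(* Implicit differentiation of the quadratic equation, once and then twice. *)
pose f1 t := - (B1 t * f t + C1 t) / (2 * A * f t + B t).
pose f2 t := - ((B2 t * f t + B1 t * f1 t + C2 t) * (2 * A * f t + B t) -
  (B1 t * f t + C1 t) * (2 * A * f1 t + B1 t)) / (2 * A * f t + B t) ^+ 2.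
exists f, f1, f2; split=> //; last by apply: filterS Nf => t [].
have df : \forall t \near t0, is_derive (t : R) 1 f (f1 t).
  have Nf2 := near_near Nf; apply: filterS2 Nf2 Nf => t Nt [_ Dt dft].
  have dfd : is_derive t 1 f ('D_1 f t) by exact: derivableP.
  have := dB t => dBt; have := dC t => dCt.
  have dg : is_derive t 1 (fun t => A * f t ^+ 2 + B t * f t + C t)
      ((2 * A * f t + B t) * 'D_1 f t + B1 t * f t + C1 t).
    by apply: is_derive_eq; rewrite /GRing.scale /=; ring.
  have dg0 : is_derive t 1 (cst 0 : R -> R) ((2 * A * f t + B t) * 'D_1 f t + B1 t * f t + C1 t).
    by apply: near_eq_is_derive dg; apply: filterS Nt => s [].
  have dg00 : is_derive t 1 (cst 0 : R -> R) (0 : R) by exact: is_derive_cst.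
  have E : (2 * A * f t + B t) * 'D_1 f t + B1 t * f t + C1 t = 0.
    by case: dg0 => _ <-; case: dg00.
  have Dn : 2 * A * f t + B t != 0 by rewrite lt_eqF.
  suff -> : f1 t = 'D_1 f t by [].
  by rewrite /f1; apply: (mulIf Dn); rewrite divfK //; move: E; lra.
apply: filterS2 Nf df => t [_ Dt _] dft.
have Dn : 2 * A * f t + B t != 0 by rewrite lt_eqF.
have := dB t => dBt; have := dC t => dCt; have := dB1 t => dB1t; have := dC1 t => dC1t.
have dD : is_derive t 1 (fun t => 2 * A * f t + B t) (2 * A * f1 t + B1 t).
  by apply: is_derive_eq; rewrite /GRing.scale /=; ring.
have dV : is_derive t 1 (fun t => (2 * A * f t + B t)^-1)
    (- (2 * A * f t + B t) ^- 2 *: (2 * A * f1 t + B1 t)) by exact: is_deriveV.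
have df1 : is_derive t 1 f1 (f2 t).
  by apply: is_derive_eq; rewrite /f2 /GRing.scale /=; field.
split=> //.
have cf := is_derive_continuous dft; have cf1 := is_derive_continuous df1.
have cBt := cB t; have cB1t := is_derive_continuous dB1t; have cC1t := is_derive_continuous dC1t.
have cDt : {for t, continuous (fun t => 2 * A * f t + B t)} := is_derive_continuous dD.
have cB2t := cB2 t; have cC2t := cC2 t.
apply: continuousM; last first.
  apply: continuousV; first by rewrite expf_neq0.
  have -> : (fun t => (2 * A * f t + B t) ^+ 2) =
      (fun t => (2 * A * f t + B t) * (2 * A * f t + B t)).
    by apply/funext => s; rewrite expr2.
  exact: continuousM.
apply: continuousN; apply: continuousB; apply: continuousM => //.
- by apply: continuousD => //; apply: continuousD; apply: continuousM.
- by apply: continuousD => //; apply: continuousM.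
- by apply: continuousD => //; apply: continuousM => //; exact: cst_continuous.
Qed.

End QuadraticBranch.

(** * The level as a root of a quadratic equation *)

Section LocalStructure.
Context {R : realType} {n : nat} {P : 'Z_(n.*2) -> 'rV[R]_2}.
Hypothesis hP : CPPOS P.
Let n1 := cppos_size hP.
Implicit Types (i j : 'Z_(n.*2)) (s t u : R) (v x y z : 'rV[R]_2).
Local Notation e := (edge P).
Local Notation pt := (side_pt P).
Local Notation ht := (height P).

Lemma is_derive_dot_tvec v t :
  is_derive t 1 (fun t => dot (tvec t) v) (- dot (nvec t) v).
Proof.
have -> : (fun t : R => dot (tvec t) v) = (fun t => - sin t * v 0 0 + cos t * v 0 1).
  by apply/funext => s; rewrite /dot !mxE.
by apply: is_derive_eq; rewrite /dot !mxE /= /GRing.scale /=; ring.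
Qed.

Lemma dot_nvec_continuous v : continuous (fun t => dot (nvec t) v).
Proof. by move=> t; apply: is_derive_continuous (is_derive_dot_nvec v t). Qed.

Lemma dot_tvec_continuous v : continuous (fun t => dot (tvec t) v).
Proof. by move=> t; apply: is_derive_continuous (is_derive_dot_tvec v t). Qed.

Lemma level_continuous p : inI P p -> continuous (level P p).
Proof.
move=> hp t; apply/cvgrPdist_lt => eps eps0.
have M0 : 0 < 2 * bound P + 1.
  have := @bound_ge0 R n P; lra.
apply/near_ballP; exists (eps / (2 * bound P + 1)); first by rewrite divr_gt0.
move=> s st; apply: le_lt_trans (level_lipschitz hP t s hp) _.
apply: (@le_lt_trans _ _ ((2 * bound P + 1) * `|s - t|)).
  by rewrite distrC ler_wpM2r // lerDl.
by rewrite mulrC -ltr_pdivlMr.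
Qed.

Variables (p : 'rV[R]_2) (hp : inI P p).
Local Notation h := (level P p).

(* A point x of side i whose image has level r satisfies                        *)
(* [acoef i t *: (x - p) = fvec i t + r *: e i]; two such points, on the sides i *)
(* and j, are thus aligned with p if and only if                                *)
(* [det2 (e i) (e j) * r ^+ 2 + qB i j t * r + qC i j t = 0].                    *)
Definition acoef i t := dot (nvec t) (e (i + n%:R)).
Definition offs i t := dot (nvec t) (P (i + n%:R)).
Definition fvec i t := acoef i t *: (P i - p) - offs i t *: e i.
Definition fvec1 i t :=
  dot (tvec t) (e (i + n%:R)) *: (P i - p) - dot (tvec t) (P (i + n%:R)) *: e i.
Definition qB i j t := det2 (fvec i t) (e j) + det2 (e i) (fvec j t).
Definition qB1 i j t := det2 (fvec1 i t) (e j) + det2 (e i) (fvec1 j t).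
Definition qC i j t := det2 (fvec i t) (fvec j t).
Definition qC1 i j t := det2 (fvec1 i t) (fvec j t) + det2 (fvec i t) (fvec1 j t).
Definition qC2 i j t := 2 * det2 (fvec1 i t) (fvec1 j t) - 2 * qC i j t.

Lemma is_derive_fvec i (c : 'I_2) t :
  is_derive t 1 (fun t => fvec i t 0 c) (fvec1 i t 0 c).
Proof.
have -> : (fun t => fvec i t 0 c) =
  (fun t => dot (nvec t) (e (i + n%:R)) * (P i - p) 0 c -
            dot (nvec t) (P (i + n%:R)) * e i 0 c).
  by apply/funext => s; rewrite /fvec !mxE.
have := is_derive_dot_nvec (e (i + n%:R)) t; have := is_derive_dot_nvec (P (i + n%:R)) t.
by move=> d1 d2; apply: is_derive_eq; rewrite !mxE /GRing.scale /=; ring.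
Qed.

Lemma is_derive_fvec1 i (c : 'I_2) t :
  is_derive t 1 (fun t => fvec1 i t 0 c) (- fvec i t 0 c).
Proof.
have -> : (fun t => fvec1 i t 0 c) =
  (fun t => dot (tvec t) (e (i + n%:R)) * (P i - p) 0 c -
            dot (tvec t) (P (i + n%:R)) * e i 0 c).
  by apply/funext => s; rewrite /fvec1 !mxE.
have := is_derive_dot_tvec (e (i + n%:R)) t; have := is_derive_dot_tvec (P (i + n%:R)) t.
by move=> d1 d2; apply: is_derive_eq; rewrite !mxE /acoef /offs /GRing.scale /=; ring.
Qed.

Lemma is_derive_qB i j t : is_derive t 1 (qB i j) (qB1 i j t).
Proof.
rewrite /qB /qB1 /det2.
have := is_derive_fvec i 0 t; have := is_derive_fvec i 1 t.
have := is_derive_fvec j 0 t; have := is_derive_fvec j 1 t => d1 d2 d3 d4.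
by apply: is_derive_eq; rewrite /GRing.scale /=; ring.
Qed.

Lemma is_derive_qB1 i j t : is_derive t 1 (qB1 i j) (- qB i j t).
Proof.
rewrite /qB /qB1 /det2.
have := is_derive_fvec1 i 0 t; have := is_derive_fvec1 i 1 t.
have := is_derive_fvec1 j 0 t; have := is_derive_fvec1 j 1 t => d1 d2 d3 d4.
by apply: is_derive_eq; rewrite /GRing.scale /=; ring.
Qed.

Lemma is_derive_qC i j t : is_derive t 1 (qC i j) (qC1 i j t).
Proof.
rewrite /qC /qC1 /det2.
have := is_derive_fvec i 0 t; have := is_derive_fvec i 1 t.
have := is_derive_fvec j 0 t; have := is_derive_fvec j 1 t => d1 d2 d3 d4.
by apply: is_derive_eq; rewrite /GRing.scale /=; ring.
Qed.

Lemma is_derive_qC1 i j t : is_derive t 1 (qC1 i j) (qC2 i j t).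
Proof.
rewrite /qC1 /qC2 /qC /det2.
have := is_derive_fvec i 0 t; have := is_derive_fvec i 1 t.
have := is_derive_fvec j 0 t; have := is_derive_fvec j 1 t => d1 d2 d3 d4.
have := is_derive_fvec1 i 0 t; have := is_derive_fvec1 i 1 t.
have := is_derive_fvec1 j 0 t; have := is_derive_fvec1 j 1 t => d5 d6 d7 d8.
by apply: is_derive_eq; rewrite /GRing.scale /=; ring.
Qed.

Lemma qB2_continuous i j : continuous (fun t => - qB i j t).
Proof.
by move=> t; apply: continuousN; exact: is_derive_continuous (is_derive_qB i j t).
Qed.

Lemma qC2_continuous i j t : {for t, continuous (qC2 i j)}.
Proof.
rewrite /qC2 /qC /det2.
have c k (c : 'I_2) : {for t, continuous (fun t => fvec k t 0 c)}.
  exact: is_derive_continuous (is_derive_fvec k c t).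
have c1 k (d : 'I_2) : {for t, continuous (fun t => fvec1 k t 0 d)}.
  exact: is_derive_continuous (is_derive_fvec1 k d t).
by apply: continuousB; apply: continuousM; try exact: cst_continuous;
  apply: continuousB; apply: continuousM.
Qed.

Lemma fvec_pt i s t (r : R) : dot (nvec t) (pt (i + n%:R) s) = r ->
  fvec i t + r *: e i = acoef i t *: (pt i s - p).
Proof.
by move=> <-; apply: eq_rV2; rewrite /fvec /acoef /offs /side_pt /dot !mxE; ring.
Qed.

Lemma fvec1_pt i s t : fvec1 i t =
  dot (tvec t) (e (i + n%:R)) *: (pt i s - p) - dot (tvec t) (pt (i + n%:R) s) *: e i.
Proof. by apply: eq_rV2; rewrite /fvec1 /side_pt /dot !mxE; ring. Qed.

(** Up to sign, the sum of the weights is the derivative of the quadratic equation in r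
    ([chord_quad_deriv]). They are also the barycentric weights of the envelope point on the image
    chord ([level_derive]). *)
Definition weight1 i j t y := - acoef j t * det2 (e i) (y - p).
Definition weight2 i j t x := acoef i t * det2 (e j) (x - p).

Section OneChord.
Variables (t : R) (i j : 'Z_(n.*2)) (s u : R).
Hypotheses (s01 : 0 <= s <= 1) (u01 : 0 <= u <= 1).
Hypothesis hc : pchord P p t (pt i s) (pt (i + n%:R) s) (pt j u) (pt (j + n%:R) u).

Lemma chord_quad :
  det2 (e i) (e j) * h t ^+ 2 + qB i j t * h t + qC i j t = 0.
Proof.
have L1 := esym (levelE hP hp hc); have L2 := esym (levelE2 hP hp hc).
transitivity (det2 (fvec i t + h t *: e i) (fvec j t + h t *: e j)).
  by rewrite /qB /qC /det2 !mxE; ring.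
rewrite (fvec_pt L1) (fvec_pt L2); have [k _ pE] := pc_p hc.
have -> : pt i s - p = - k *: (pt j u - pt i s).
  by apply: eq_rV2; rewrite pE !mxE; ring.
have -> : pt j u - p = (1 - k) *: (pt j u - pt i s).
  by apply: eq_rV2; rewrite pE !mxE; ring.
by rewrite /det2 !mxE; ring.
Qed.

Lemma chord_quad_deriv :
  2 * det2 (e i) (e j) * h t + qB i j t =
  - (weight1 i j t (pt j u) + weight2 i j t (pt i s)).
Proof.
have L1 := esym (levelE hP hp hc); have L2 := esym (levelE2 hP hp hc).
transitivity (det2 (e i) (fvec j t + h t *: e j) + det2 (fvec i t + h t *: e i) (e j)).
  by rewrite /qB /det2 !mxE; ring.
rewrite (fvec_pt L1) (fvec_pt L2) /weight1 /weight2 /det2 !mxE; ring.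
Qed.

Lemma chord_quad_deriv_t :
  qB1 i j t * h t + qC1 i j t =
  weight1 i j t (pt j u) * dot (tvec t) (pt (i + n%:R) s) +
  weight2 i j t (pt i s) * dot (tvec t) (pt (j + n%:R) u).
Proof.
have L1 := esym (levelE hP hp hc); have L2 := esym (levelE2 hP hp hc).
transitivity (det2 (fvec1 i t) (fvec j t + h t *: e j) +
              det2 (fvec i t + h t *: e i) (fvec1 j t)).
  by rewrite /qB1 /qC1 /det2 !mxE; ring.
rewrite (fvec_pt L1) (fvec_pt L2) (fvec1_pt i s) (fvec1_pt j u).
have [k _ pE] := pc_p hc; rewrite /weight1 /weight2.
have E1 : pt i s - p = - k *: (pt j u - pt i s).
  by apply: eq_rV2; rewrite pE !mxE; ring.
have E2 : pt j u - p = (1 - k) *: (pt j u - pt i s).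
  by apply: eq_rV2; rewrite pE !mxE; ring.
by rewrite E1 E2 /det2 !mxE; ring.
Qed.

Lemma height_chord1 : 0 < det2 (e i) (pt j u - p).
Proof.
have [k k01 pE] := pc_p hc; have := hp i.
have E : ht i p = k * det2 (e i) (pt j u - pt i s).
  by rewrite pE /height /side_pt /det2 !mxE; ring.
have -> : det2 (e i) (pt j u - p) = (1 - k) * det2 (e i) (pt j u - pt i s).
  by rewrite pE /det2 !mxE; ring.
by rewrite E; nra.
Qed.

Lemma height_chord2 : 0 < det2 (e j) (pt i s - p).
Proof.
have [k k01 pE] := pc_p hc; have := hp j.
have E : ht j p = (1 - k) * det2 (e j) (pt i s - pt j u).
  by rewrite pE /height /side_pt /det2 !mxE; ring.
have -> : det2 (e j) (pt i s - p) = k * det2 (e j) (pt i s - pt j u).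
  by rewrite pE /det2 !mxE; ring.
by rewrite E; nra.
Qed.

(** The image polygon side through x' has y' on its inner side, and y' - x' points along [tvec t],
    which gives the weak signs. Equality would put y' on side i + n, hence y on side i, and the
    whole chord on the line of this side, although p is interior. *)
Lemma acoef_signs : 0 < acoef i t /\ acoef j t < 0.
Proof.
have [hx hy _ hn ht0] := hc.
set x' := pt (i + n%:R) s in hx hn ht0 *; set y' := pt (j + n%:R) u in hy hn ht0 *.
have hw : dot (nvec t) (y' - x') = 0 by rewrite dotBr hn subrr.
have [_ kx] := srel_inK hP hx; have [_ ky] := srel_inK hP hy.
have E1 : ht (i + n%:R) y' = dot (tvec t) (y' - x') * acoef i t.
  have -> : ht (i + n%:R) y' = det2 (e (i + n%:R)) (y' - x').
    by rewrite /x' /height /side_pt /det2 !mxE; ring.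
  by rewrite det2C (det2_nt _ hw) /acoef; ring.
have E2 : ht (j + n%:R) x' = - dot (tvec t) (y' - x') * acoef j t.
  have -> : ht (j + n%:R) x' = - det2 (e (j + n%:R)) (y' - x').
    by rewrite /y' /height /side_pt /det2 !mxE; ring.
  by rewrite det2C (det2_nt _ hw) /acoef; ring.
split; rewrite lt_neqAle; apply/andP; split.
- apply/eqP => a0; have h0 : ht (i + n%:R) y' = 0 by rewrite E1 -a0 mulr0.
  have [u' u'01 yE'] := inK_height0 hP ky h0.
  have hy2 := srel_pt (P := P) i u'01; rewrite -yE' in hy2.
  have yE := srel_inj hP hy hy2.
  have := height_chord1; have := hp i.
  have -> : det2 (e i) (pt j u - p) = - ht i p by rewrite yE /height /side_pt /det2 !mxE; ring.
  lra.
- by have := ky (i + n%:R); rewrite E1 pmulr_rge0.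
- apply/eqP => a0; have h0 : ht (j + n%:R) x' = 0 by rewrite E2 a0 mulr0.
  have [u' u'01 xE'] := inK_height0 hP kx h0.
  have hx2 := srel_pt (P := P) j u'01; rewrite -xE' in hx2.
  have xE := srel_inj hP hx hx2.
  have := height_chord2; have := hp j.
  have -> : det2 (e j) (pt i s - p) = - ht j p by rewrite xE /height /side_pt /det2 !mxE; ring.
  lra.
- by have := kx (j + n%:R); rewrite E2 mulNr oppr_ge0 pmulr_rle0.
Qed.

Lemma weights_gt0 : 0 < weight1 i j t (pt j u) /\ 0 < weight2 i j t (pt i s).
Proof.
have [a1 a2] := acoef_signs; split; apply: mulr_gt0 => //.
- by rewrite oppr_gt0.
- exact: height_chord1.
- exact: height_chord2.
Qed.

End OneChord.

Lemma level_point t x x' y y' z z' : pchord P p t x x' y y' -> srel P z z' ->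
  dot (nvec t) z' = h t -> z = x \/ z = y.
Proof.
move=> hc hz hzl; have [hx hy [k k01 pE] hn ht0] := hc.
have [bx _] := srel_boundary hP hx; have [by_ _] := srel_boundary hP hy.
have [bz _] := srel_boundary hP hz.
apply: (line_boundary hP hp bx by_ k01 pE bz).
have d0 : det3 x' y' z' = 0.
  by rewrite (det3_nt _ hn) hzl (levelE hP hp hc) subrr mulr0.
have [hh|hh|//] := ltrgtP (det3 x y z) 0.
  by have := sigma_orient_neg hP hx hy hz hh; rewrite d0 ltxx.
by have := sigma_orient hP hx hy hz hh; rewrite d0 ltxx.
Qed.

Lemma nvec_diff t t0 (w : 'rV[R]_2) : dot (nvec t0) w = 0 ->
  dot (nvec t) w = dot (tvec t0) w * sin (t - t0).
Proof.
move=> hw; rewrite {1}(dot_nt_eq0 hw) sinB {1}/dot !mxE /=; ring.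
Qed.

(** Sharing an end means lying on the same line through p, hence sharing both ends and the image
    chord; its direction would then be orthogonal to both [nvec t0] and [nvec t]. *)
Lemma chord_distinct t t0 x x' y y' a a' b b' : pchord P p t0 x x' y y' ->
  pchord P p t a a' b b' -> sin (t - t0) != 0 -> a <> x /\ b <> y.
Proof.
move=> h0 h1 st; have [hx hy [k k01 pE] hn ht0] := h0.
have [ha hb [m m01 pE'] hn' ht1] := h1.
have [bx _] := srel_boundary hP hx; have [by_ _] := srel_boundary hP hy.
have [ba _] := srel_boundary hP ha; have [bb _] := srel_boundary hP hb.
have both : a = x -> b = y -> False.
  move=> ax b_y; rewrite ax in ha; rewrite b_y in hb.
  have Ea := srel_fun hP ha hx; have Eb := srel_fun hP hb hy.
  have hw : dot (nvec t0) (y' - x') = 0 by rewrite dotBr hn subrr.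
  have := nvec_diff t hw; rewrite dotBr -Ea -Eb hn' subrr Ea Eb => /esym/eqP.
  by rewrite mulf_eq0 (negbTE st) orbF gt_eqF.
have dd : (k - 1) * m * (det2 (y - x) (b - x)) = (k - 1) * (1 - m) * - det2 (y - x) (a - x).
  have : det2 (y - x) ((1 - m) *: a + m *: b - x) = 0.
    by rewrite -pE' pE /det2 !mxE; ring.
  move=> E; transitivity ((k - 1) * det2 (y - x) ((1 - m) *: a + m *: b - x)
     - (k - 1) * (1 - m) * det2 (y - x) (a - x)); last by rewrite E; ring.
  by rewrite /det2 !mxE; ring.
split=> E; apply: both => //.
  have d0 : det3 x y b = 0.
    have /eqP : (k - 1) * m * det3 x y b = 0.
      by rewrite /det3 dd E /det2 !mxE; ring.
    rewrite !mulf_eq0 => /orP[/orP[/eqP h2|/eqP h2]|/eqP//]; lra.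
  have [E2|//] := line_boundary hP hp bx by_ k01 pE bb d0.
  by have := pchord_neq hP h1; rewrite E E2.
have d0 : det3 x y a = 0.
  have /eqP : (k - 1) * (1 - m) * det3 x y a = 0.
    have : (k - 1) * (1 - m) * - det2 (y - x) (a - x) = 0.
      by rewrite -dd E /det2 !mxE; ring.
    by rewrite /det3; lra.
  rewrite !mulf_eq0 => /orP[/orP[/eqP h2|/eqP h2]|/eqP//]; lra.
have [//|E2] := line_boundary hP hp bx by_ k01 pE ba d0.
by have := pchord_neq hP h1; rewrite E E2.
Qed.

(** The parameter at which the line of side i + n meets the image line of angle t. *)
Definition spar i t := (h t - offs i t) / acoef i t.

Section Follow.
Variables (t0 : R) (i j : 'Z_(n.*2)) (s0 u0 : R).
Hypotheses (s01 : 0 <= s0 <= 1) (u01 : 0 <= u0 <= 1).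
Hypothesis hc : pchord P p t0 (pt i s0) (pt (i + n%:R) s0) (pt j u0) (pt (j + n%:R) u0).

Lemma acoef_continuous k : continuous (acoef k).
Proof. exact: dot_nvec_continuous. Qed.

Lemma spar_level k t : acoef k t != 0 ->
  dot (nvec t) (pt (k + n%:R) (spar k t)) = h t.
Proof.
by move=> a0; rewrite /side_pt dotDr dotZr -/(acoef k t) /spar divfK // -/(offs k t) addrC subrK.
Qed.

Lemma spar_diff k s t : acoef k t != 0 ->
  spar k t - s = (h t - dot (nvec t) (pt (k + n%:R) s)) / acoef k t.
Proof.
by move=> a0; rewrite /side_pt dotDr dotZr -/(acoef k t) -/(offs k t) /spar; field.
Qed.

Lemma spar0 : spar i t0 = s0 /\ spar j t0 = u0.
Proof.
have [a1 a2] := acoef_signs hc.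
split; apply/eqP; rewrite -subr_eq0 spar_diff.
- by rewrite (levelE hP hp hc) subrr mul0r.
- by rewrite gt_eqF.
- by rewrite (levelE2 hP hp hc) subrr mul0r.
- by rewrite lt_eqF.
Qed.

Lemma spar_continuous k t : acoef k t != 0 -> {for t, continuous (spar k)}.
Proof.
move=> a0; apply: continuousM.
  by apply: continuousB; [exact: level_continuous|exact: dot_nvec_continuous].
by apply: continuousV => //; exact: acoef_continuous.
Qed.

Lemma near_acoef : \forall t \near t0, 0 < acoef i t /\ acoef j t < 0.
Proof.
have [a1 a2] := acoef_signs hc.
have N1 := continuous_near_gt (@acoef_continuous i t0) a1.
have N2 := continuous_near_lt (@acoef_continuous j t0) a2.
by apply: filterS2 N1 N2 => t.
Qed.

(** As long as both parameters stay in [0, 1], the points they define have images on the image line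
    of angle t, so they are the two ends of the chord of angle t; continuity of the direction of the
    image chord fixes their order. *)
Lemma chord_follow : \forall t \near t0, 0 <= spar i t <= 1 -> 0 <= spar j t <= 1 ->
  pchord P p t (pt i (spar i t)) (pt (i + n%:R) (spar i t))
               (pt j (spar j t)) (pt (j + n%:R) (spar j t)).
Proof.
have [a1 a2] := acoef_signs hc; have [S0 U0] := spar0.
have ci : {for t0, continuous (spar i)} by apply: spar_continuous; rewrite gt_eqF.
have cj : {for t0, continuous (spar j)} by apply: spar_continuous; rewrite lt_eqF.
pose F t := (dot (tvec t) (P (j + n%:R)) + spar j t * dot (tvec t) (e (j + n%:R))) -
  (dot (tvec t) (P (i + n%:R)) + spar i t * dot (tvec t) (e (i + n%:R))).
have FE t : F t = dot (tvec t) (pt (j + n%:R) (spar j t) - pt (i + n%:R) (spar i t)).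
  by rewrite /F /side_pt /dot !mxE; ring.
have cF : {for t0, continuous F}.
  apply: continuousB; apply: continuousD; try exact: dot_tvec_continuous;
    apply: continuousM => //; exact: dot_tvec_continuous.
have F0 : 0 < F t0 by rewrite FE S0 U0; exact: (pc_t hc).
have NF := continuous_near_gt cF F0.
apply: filterS2 near_acoef NF => t [b1 b2]; rewrite FE => Ft si uj.
have hx := srel_pt (P := P) i si; have hy := srel_pt (P := P) j uj.
have Lx : dot (nvec t) (pt (i + n%:R) (spar i t)) = h t by apply: spar_level; rewrite gt_eqF.
have Ly : dot (nvec t) (pt (j + n%:R) (spar j t)) = h t by apply: spar_level; rewrite lt_eqF.
have [a [a' [b [b' hab]]]] := pchord_exists hP hp t.
have [ha hb _ _ hab_t] := hab.
have [Ex|Ex] := level_point hab hx Lx; have [Ey|Ey] := level_point hab hy Ly.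
- exfalso; rewrite Ex in hx; rewrite Ey in hy.
  by move: Ft; rewrite (srel_fun hP hx hy) subrr /dot !mxE !mulr0 addr0 ltxx.
- rewrite Ex in hx; rewrite Ey in hy.
  by rewrite Ex Ey (srel_fun hP hx ha) (srel_fun hP hy hb).
- exfalso; rewrite Ex in hx; rewrite Ey in hy.
  by move: Ft hab_t; rewrite (srel_fun hP hx hb) (srel_fun hP hy ha) !dotBr; lra.
- exfalso; rewrite Ex in hx; rewrite Ey in hy.
  by move: Ft; rewrite (srel_fun hP hx hy) subrr /dot !mxE !mulr0 addr0 ltxx.
Qed.

Lemma near_sin_gt0 : \forall t \near t0^'+, 0 < sin (t - t0).
Proof.
by apply/near_rightP; exists pi; [exact: pi_gt0|move=> t tt; apply: sin_gt0_pi; lra].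
Qed.

Lemma near_sin_lt0 : \forall t \near t0^'-, sin (t - t0) < 0.
Proof.
apply/near_leftP; exists pi; first exact: pi_gt0.
by move=> t tt; rewrite -opprB sinN oppr_lt0; apply: sin_gt0_pi; lra.
Qed.

(** The image line of angle t cuts the image chord of angle t0 with barycentric weight m. The
    offsets of its level from the two ends are proportional to m and 1 - m with opposite signs, and
    so are the signs of [acoef]: both ends advance when t increases. *)
Lemma spar_monotone t : 0 < acoef i t -> acoef j t < 0 ->
  exists m1 m2 : R, [/\ 0 <= m1, 0 <= m2, spar i t - s0 = m1 * sin (t - t0) &
    spar j t - u0 = m2 * sin (t - t0)].
Proof.
move=> b1 b2; have [a [a' [b [b' hab]]]] := pchord_exists hP hp t.
have [m m01 E] := pchord_cross_pt hP hp hab hc.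
have [_ _ _ hn ht0] := hc.
set x' := pt (i + n%:R) s0 in E hn ht0 *; set y' := pt (j + n%:R) u0 in E hn ht0 *.
have hw : dot (nvec t0) (y' - x') = 0 by rewrite dotBr hn subrr.
have D := nvec_diff t hw; rewrite dotBr in D.
exists (m * dot (tvec t0) (y' - x') / acoef i t).
exists ((1 - m) * dot (tvec t0) (y' - x') / - acoef j t); split.
- by rewrite divr_ge0 ?mulr_ge0 //; lra.
- by rewrite divr_ge0 ?mulr_ge0 //; lra.
- rewrite spar_diff ?gt_eqF // -E dot_conv -/x'.
  have a0 : acoef i t != 0 by rewrite gt_eqF.
  have -> : m * dot (tvec t0) (y' - x') / acoef i t * sin (t - t0) =
    m * (dot (tvec t0) (y' - x') * sin (t - t0)) / acoef i t by field.
  by rewrite -D; congr (_ / _); ring.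
- rewrite spar_diff ?lt_eqF // -E dot_conv -/y'.
  have a0 : acoef j t != 0 by rewrite lt_eqF.
  have -> : (1 - m) * dot (tvec t0) (y' - x') / - acoef j t * sin (t - t0) =
    - ((1 - m) * (dot (tvec t0) (y' - x') * sin (t - t0))) / acoef j t by field.
  by rewrite -D; congr (_ / _); ring.
Qed.

(** Both ends move forward by [spar_monotone], strictly by [chord_distinct], and stay before the end
    of their sides by continuity. At a vertex this requires the side that starts there, whereas
    [chord_left] requires the side that ends there. *)
Lemma chord_right : s0 < 1 -> u0 < 1 -> \forall t \near t0^'+,
  [/\ 0 < spar i t < 1, 0 < spar j t < 1 &
   pchord P p t (pt i (spar i t)) (pt (i + n%:R) (spar i t))
               (pt j (spar j t)) (pt (j + n%:R) (spar j t))].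
Proof.
move=> s1 u1; have [a1 a2] := acoef_signs hc; have [S0 U0] := spar0.
have ci : {for t0, continuous (spar i)} by apply: spar_continuous; rewrite gt_eqF.
have cj : {for t0, continuous (spar j)} by apply: spar_continuous; rewrite lt_eqF.
have N1 : \forall t \near t0^'+, spar i t < 1.
  by apply: near_to_right; apply: (continuous_near_lt ci); rewrite S0.
have N2 : \forall t \near t0^'+, spar j t < 1.
  by apply: near_to_right; apply: (continuous_near_lt cj); rewrite U0.
have N3 := near_to_right near_acoef; have N4 := near_to_right chord_follow.
have N5 := near_sin_gt0.
near=> t.
have l1 : spar i t < 1 by near: t.
have l2 : spar j t < 1 by near: t.
have [b1 b2] : 0 < acoef i t /\ acoef j t < 0 by near: t.
have st : 0 < sin (t - t0) by near: t.
have [m1 [m2 [m10 m20 E1 E2]]] := spar_monotone b1 b2.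
have g1 : s0 <= spar i t by have : 0 <= m1 * sin (t - t0); [rewrite mulr_ge0 // ltW|lra].
have g2 : u0 <= spar j t by have : 0 <= m2 * sin (t - t0); [rewrite mulr_ge0 // ltW|lra].
have ch : 0 <= spar i t <= 1 -> 0 <= spar j t <= 1 ->
  pchord P p t (pt i (spar i t)) (pt (i + n%:R) (spar i t))
               (pt j (spar j t)) (pt (j + n%:R) (spar j t)) by near: t.
have si : 0 <= spar i t <= 1 by have := s01; lra.
have sj : 0 <= spar j t <= 1 by have := u01; lra.
have {}ch := ch si sj.
have [d1 d2] := chord_distinct hc ch ltac:(by rewrite gt_eqF).
have n1' : spar i t != s0 by apply/eqP => E; apply: d1; rewrite E.
have n2' : spar j t != u0 by apply/eqP => E; apply: d2; rewrite E.
have {}g1 : s0 < spar i t by rewrite lt_neqAle eq_sym n1'.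
have {}g2 : u0 < spar j t by rewrite lt_neqAle eq_sym n2'.
by split=> //; have := s01; have := u01; lra.
Unshelve. all: by end_near. Qed.

Lemma chord_left : 0 < s0 -> 0 < u0 -> \forall t \near t0^'-,
  [/\ 0 < spar i t < 1, 0 < spar j t < 1 &
   pchord P p t (pt i (spar i t)) (pt (i + n%:R) (spar i t))
               (pt j (spar j t)) (pt (j + n%:R) (spar j t))].
Proof.
move=> s1 u1; have [a1 a2] := acoef_signs hc; have [S0 U0] := spar0.
have ci : {for t0, continuous (spar i)} by apply: spar_continuous; rewrite gt_eqF.
have cj : {for t0, continuous (spar j)} by apply: spar_continuous; rewrite lt_eqF.
have N1 : \forall t \near t0^'-, 0 < spar i t.
  by apply: near_to_left; apply: (continuous_near_gt ci); rewrite S0.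
have N2 : \forall t \near t0^'-, 0 < spar j t.
  by apply: near_to_left; apply: (continuous_near_gt cj); rewrite U0.
have N3 := near_to_left near_acoef; have N4 := near_to_left chord_follow.
have N5 := near_sin_lt0.
near=> t.
have l1 : 0 < spar i t by near: t.
have l2 : 0 < spar j t by near: t.
have [b1 b2] : 0 < acoef i t /\ acoef j t < 0 by near: t.
have st : sin (t - t0) < 0 by near: t.
have [m1 [m2 [m10 m20 E1 E2]]] := spar_monotone b1 b2.
have g1 : spar i t <= s0 by have : m1 * sin (t - t0) <= 0; [rewrite mulr_ge0_le0 // ltW|lra].
have g2 : spar j t <= u0 by have : m2 * sin (t - t0) <= 0; [rewrite mulr_ge0_le0 // ltW|lra].
have ch : 0 <= spar i t <= 1 -> 0 <= spar j t <= 1 ->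
  pchord P p t (pt i (spar i t)) (pt (i + n%:R) (spar i t))
               (pt j (spar j t)) (pt (j + n%:R) (spar j t)) by near: t.
have si : 0 <= spar i t <= 1 by have := s01; lra.
have sj : 0 <= spar j t <= 1 by have := u01; lra.
have {}ch := ch si sj.
have [d1 d2] := chord_distinct hc ch ltac:(by rewrite lt_eqF).
have n1' : spar i t != s0 by apply/eqP => E; apply: d1; rewrite E.
have n2' : spar j t != u0 by apply/eqP => E; apply: d2; rewrite E.
have {}g1 : spar i t < s0 by rewrite lt_neqAle n1'.
have {}g2 : spar j t < u0 by rewrite lt_neqAle n2'.
by split=> //; have := s01; have := u01; lra.
Unshelve. all: by end_near. Qed.

Lemma chord_both : 0 < s0 < 1 -> 0 < u0 < 1 -> \forall t \near t0,
  [/\ 0 < spar i t < 1, 0 < spar j t < 1 &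
   pchord P p t (pt i (spar i t)) (pt (i + n%:R) (spar i t))
               (pt j (spar j t)) (pt (j + n%:R) (spar j t))].
Proof.
move=> /andP[s0' s1] /andP[u0' u1]; have [a1 a2] := acoef_signs hc; have [S0 U0] := spar0.
have ci : {for t0, continuous (spar i)} by apply: spar_continuous; rewrite gt_eqF.
have cj : {for t0, continuous (spar j)} by apply: spar_continuous; rewrite lt_eqF.
have N1 : \forall t \near t0, 0 < spar i t by apply: (continuous_near_gt ci); rewrite S0.
have N2 : \forall t \near t0, 0 < spar j t by apply: (continuous_near_gt cj); rewrite U0.
have N3 : \forall t \near t0, spar i t < 1 by apply: (continuous_near_lt ci); rewrite S0.
have N4 : \forall t \near t0, spar j t < 1 by apply: (continuous_near_lt cj); rewrite U0.
have N5 := chord_follow.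
near=> t.
have l1 : 0 < spar i t by near: t.
have l2 : 0 < spar j t by near: t.
have l3 : spar i t < 1 by near: t.
have l4 : spar j t < 1 by near: t.
have ch : 0 <= spar i t <= 1 -> 0 <= spar j t <= 1 ->
  pchord P p t (pt i (spar i t)) (pt (i + n%:R) (spar i t))
               (pt j (spar j t)) (pt (j + n%:R) (spar j t)) by near: t.
by split; [rewrite l1|rewrite l2|apply: ch; lra].
Unshelve. all: by end_near. Qed.

(** For every chord between sides i and j, h is the root at which the derivative of the quadratic is
    negative, and so is the branch f. Half the sum of the two derivatives is the cofactor of h - f
    in the difference of the equations, hence h = f. *)
Lemma chord_branch : exists f f1 f2, [/\ C2near f f1 f2 t0, h t0 = f t0,
  f1 t0 = (weight1 i j t0 (pt j u0) * dot (tvec t0) (pt (i + n%:R) s0) +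
           weight2 i j t0 (pt i s0) * dot (tvec t0) (pt (j + n%:R) u0)) /
          (weight1 i j t0 (pt j u0) + weight2 i j t0 (pt i s0)) &
  \forall t \near t0, forall s u,
    pchord P p t (pt i s) (pt (i + n%:R) s) (pt j u) (pt (j + n%:R) u) -> h t = f t].
Proof.
have [w1 w2] := weights_gt0 hc.
have D0 := chord_quad_deriv hc; have T0 := chord_quad_deriv_t hc.
have [|f [f1 [f2 [C E N F1]]]] := quadratic_branch (is_derive_qB i j) (is_derive_qB1 i j)
  (is_derive_qC i j) (is_derive_qC1 i j) (@qB2_continuous i j) (@qC2_continuous i j)
  (chord_quad hc).
  rewrite D0; lra.
exists f, f1, f2; split=> //.
  by rewrite F1 E D0 T0 invrN mulrN mulNr opprK.
apply: filterS N => t [Q N] s u hc'.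
have [v1 v2] := weights_gt0 hc'; have Q' := chord_quad hc'; have D' := chord_quad_deriv hc'.
have N' : 2 * det2 (e i) (e j) * h t + qB i j t < 0 by rewrite D'; lra.
have /eqP : (h t - f t) * (det2 (e i) (e j) * (h t + f t) + qB i j t) = 0.
  transitivity ((det2 (e i) (e j) * h t ^+ 2 + qB i j t * h t + qC i j t) -
    (det2 (e i) (e j) * f t ^+ 2 + qB i j t * f t + qC i j t)); first by ring.
  by rewrite Q Q' subrr.
rewrite mulf_eq0 => /orP[/eqP|/eqP] E0; lra.
Qed.

End Follow.

Lemma open_not_transition t i j s u : 0 < s < 1 -> 0 < u < 1 ->
  pchord P p t (pt i s) (pt (i + n%:R) s) (pt j u) (pt (j + n%:R) u) ->
  ~ transitions P p t.
Proof.
move=> s01 u01 hc /(transitionsP hP hp hc)[k].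
have I0 : 0 <= (0 : R) < 1 by apply/andP; split; [exact: lexx|exact: ltr01].
have [s01' u01'] : 0 <= s < 1 /\ 0 <= u < 1 by lra.
rewrite -(side_pt0 k); case=> E.
  by have [_ E0] := side_pt_inj hP s01' I0 E; lra.
by have [_ E0] := side_pt_inj hP u01' I0 E; lra.
Qed.

Lemma srel_right x x' : srel P x x' -> exists i s,
  [/\ 0 <= s < 1, x = pt i s & x' = pt (i + n%:R) s].
Proof. by []. Qed.

Lemma srel_left x x' : srel P x x' -> exists i s,
  [/\ 0 < s <= 1, x = pt i s & x' = pt (i + n%:R) s].
Proof.
move=> [i [s [s01 -> ->]]]; have [s0|s0] := eqVneq s 0.
  exists (i - 1), 1; rewrite !side_pt1 subrK addrAC subrK s0; split=> //; lra.
exists i, s; split=> //; have : 0 < s by rewrite lt_neqAle eq_sym s0; lra.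
lra.
Qed.

(** To the right of c the chord is followed on the sides with s < 1, to the left on the sides with s
    > 0; off the transitions both descriptions agree. *)
Theorem level_pwC2 : pwC2 (transitions P p) h.
Proof.
split=> c; have [x [x' [y [y' hc]]]] := pchord_exists hP hp c.
- have [i [s [s01 xE xE']]] := srel_right (pc_x hc).
  have [j [u [u01 yE yE']]] := srel_right (pc_y hc).
  rewrite xE xE' yE yE' in hc.
  have [f [f1 [f2 [C E _ N]]]] := chord_branch hc; exists f, f1, f2; split=> //.
  have N1 : \forall t \near c^'+, forall s u,
    pchord P p t (pt i s) (pt (i + n%:R) s) (pt j u) (pt (j + n%:R) u) -> h t = f t.
    exact: cvg_within.
  have [s01' u01'] : 0 <= s <= 1 /\ 0 <= u <= 1 by lra.
  have [s1 u1] : s < 1 /\ u < 1 by lra.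
  have N2 := chord_right s01' u01' hc s1 u1.
  apply: filterS2 N1 N2 => t Ht [si uj hct]; split; first exact: Ht hct.
  exact: open_not_transition si uj hct.
- have [i [s [s01 xE xE']]] := srel_left (pc_x hc).
  have [j [u [u01 yE yE']]] := srel_left (pc_y hc).
  rewrite xE xE' yE yE' in hc.
  have [f [f1 [f2 [C E _ N]]]] := chord_branch hc; exists f, f1, f2; split=> //.
  have N1 : \forall t \near c^'-, forall s u,
    pchord P p t (pt i s) (pt (i + n%:R) s) (pt j u) (pt (j + n%:R) u) -> h t = f t.
    exact: cvg_within.
  have [s01' u01'] : 0 <= s <= 1 /\ 0 <= u <= 1 by lra.
  have [s1 u1] : 0 < s /\ 0 < u by lra.
  have N2 := chord_left s01' u01' hc s1 u1.
  apply: filterS2 N1 N2 => t Ht [si uj hct]; split; first exact: Ht hct.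
  exact: open_not_transition si uj hct.
move=> Tc.
have [i [s [s01 xE xE']]] := srel_right (pc_x hc).
have [j [u [u01 yE yE']]] := srel_right (pc_y hc).
have s0 : s != 0.
  apply/eqP => s0; apply: Tc; apply/(transitionsP hP hp hc); exists i.
  by left; rewrite xE s0 side_pt0.
have u0 : u != 0.
  apply/eqP => u0; apply: Tc; apply/(transitionsP hP hp hc); exists j.
  by right; rewrite yE u0 side_pt0.
have s0' : 0 < s < 1 by have : 0 < s by [rewrite lt_neqAle eq_sym s0; lra]; lra.
have u0' : 0 < u < 1 by have : 0 < u by [rewrite lt_neqAle eq_sym u0; lra]; lra.
rewrite xE xE' yE yE' in hc.
have [f [f1 [f2 [C E _ N]]]] := chord_branch hc; exists f, f1, f2; split=> //.
have N2 := chord_both hc s0' u0'.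
by apply: filterS2 N N2 => t Ht [_ _ hct]; exact: Ht hct.
Qed.

(** The contact point with the envelope divides the image chord in the ratio of the weights, so h'
    is a weighted mean of the tangential coordinates of its ends. *)
Theorem level_derive t i j s u : 0 < s < 1 -> 0 < u < 1 ->
  pchord P p t (pt i s) (pt (i + n%:R) s) (pt j u) (pt (j + n%:R) u) ->
  is_derive t 1 h
    ((weight1 i j t (pt j u) * dot (tvec t) (pt (i + n%:R) s) +
      weight2 i j t (pt i s) * dot (tvec t) (pt (j + n%:R) u)) /
     (weight1 i j t (pt j u) + weight2 i j t (pt i s))).
Proof.
move=> s01 u01 hc; have [f [f1 [f2 [C E <- N]]]] := chord_branch hc.
have N2 := chord_both hc s01 u01.
have [d _ _] := nbhs_singleton C.
apply: near_eq_is_derive d.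
by apply: filterS2 N N2 => r Hr [_ _ hct]; rewrite (Hr _ _ hct).
Qed.

End LocalStructure.

(** * The Wirtinger inequality *)

Section Antiderivative.
Context {R : realType}.
Implicit Types (a b c t x y : R) (f g k : R -> R).
Local Notation mu := (@lebesgue_measure R).
Local Notation itg a b f := (mu.-integrable `[a, b] (EFin \o f)).
Local Notation int a b f := (\int[mu]_(t in `[a, b]) f t).

Lemma itv_integral_ge0 a b f : (forall t, a <= t <= b -> 0 <= f t) -> 0 <= int a b f.
Proof. by move=> f0; apply: Rintegral_ge0 => t; rewrite /= in_itv /=; apply: f0. Qed.

Lemma itv_integral_le a b f g : itg a b f -> itg a b g ->
  (forall t, a <= t <= b -> f t <= g t) -> int a b f <= int a b g.
Proof. by move=> ? ? fg; apply: le_Rintegral => // t; rewrite /= in_itv /=; apply: fg. Qed.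

Lemma itv_integral_cst a b r : a <= b -> int a b (fun=> r) = r * (b - a).
Proof.
move=> ab; rewrite Rintegral_cst //= lebesgue_measure_itv /= lte_fin.
by have [h|h] := ltP a b => //=; rewrite (_ : b = a) ?subrr //; apply/le_anti/andP.
Qed.

Lemma pwc_antiderivative k a : (forall c, pwc_at k c) -> exists W,
  forall c, a < c -> {for c, continuous W} /\ \forall t \near c^', is_derive (t : R) 1 W (k t).
Proof.
move=> pk; have ik x y : itg x y k.
  have [xy|xy] := leP x y; first by apply: pwc_integrable.
  by rewrite set_itv_ge ?bnd_simp -?ltNge //; exact: integrable_set0.
exists (fun x => int a x k) => c ac; split.
  have := @parameterized_integral_continuous R a (c + 1) k ltac:(lra) (ik _ _).
  by move/within_continuous_continuous; apply; [lra|rewrite in_itv /=; lra].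
have [gl [gr [cl cr el er]]] := pk c.
have good t : a < t -> {for t, continuous k} -> is_derive (t : R) 1 (fun x => int a x k) (k t).
  move=> at_ ct.
  have t1 : t < t + 1 by lra.
  have at' : (BLeft a < BRight t)%E by rewrite /= lte_fin.
  have [d <-] := @continuous_FTC1 R k (BLeft a) t (t + 1) t1 (ik _ _) at' ct.
  by rewrite derive1E; exact: derivableP.
have near_cont (g : R -> R) t : (\forall s \near t, k s = g s) -> {for t, continuous g} ->
    {for t, continuous k}.
  move=> E cg; suff : k x @[x --> t] --> k t by [].
  rewrite [X in _ --> X](nbhs_singleton E).
  by apply: cvg_trans cg; apply: near_eq_cvg; near do apply/esym.
have ac' : \forall t \near c, a < t by exact: lt_nbhsr.
apply: punctured.
  have N1 := near_right_near er; have N2 := near_to_right cr; have N3 := near_to_right ac'.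
  near=> t; apply: good; first by near: t.
  apply: (near_cont gr); first by near: t.
  by near: t.
have N1 := near_left_near el; have N2 := near_to_left cl; have N3 := near_to_left ac'.
near=> t; apply: good; first by near: t.
apply: (near_cont gl); first by near: t.
by near: t.
Unshelve. all: by end_near. Qed.

Lemma near_dnbhs_shift (Q : R -> Prop) c (r : R) : (\forall t \near (c + r)^', Q t) ->
  \forall t \near c^', Q (t + r).
Proof.
rewrite !near_withinE => /near_ballP[eps eps0 H]; apply/near_ballP; exists eps => //.
move=> t tc tn; apply: H; first by rewrite opprD addrACA subrr addr0.
by apply: contra_neq tn => /addIr.
Qed.

Lemma pw_constant f a b : a <= b ->
  (forall c, a <= c <= b -> {for c, continuous f}) ->
  (forall c, a <= c <= b -> \forall t \near c^', is_derive (t : R) 1 f (0 : R)) -> f b = f a.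
Proof.
move=> ab cf df.
have [] := @pw_ftc R f (fun=> 0) a b ab.
  move=> c cab; split; [exact: cf|by apply: pwc_cont; near=> t; apply: cst_continuous|exact: df].
by move=> _; rewrite itv_integral_cst // mul0r => /esym/subr0_eq.
Unshelve. all: by end_near. Qed.

End Antiderivative.

Section Wirtinger.
Context {R : realType}.
Implicit Types (a b c t x y : R).
Local Notation mu := (@lebesgue_measure R).
Local Notation itg a b f := (mu.-integrable `[a, b] (EFin \o f)).
Local Notation int a b f := (\int[mu]_(t in `[a, b]) f t).

Variables (h h1 : R -> R) (L : R).
Hypothesis ch : forall t, {for t, continuous h}.
Hypothesis ph : forall c, pwc_at h1 c.
Hypothesis dh : forall c, \forall t \near c^', is_derive (t : R) 1 h (h1 t).
Hypothesis ah : forall t, h (t + pi) = - h t.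
Hypothesis Lh : forall s t, `|h s - h t| <= L * `|s - t|.

Let k t := h1 t * h1 t - h t * h t.

Lemma h_pwc c : pwc_at h c.
Proof. by apply: pwc_cont; near=> t. Unshelve. all: by end_near. Qed.

Lemma k_pwc c : pwc_at k c.
Proof. by apply: pwcB; apply: pwcM => //; apply: h_pwc. Qed.

(** Off a discrete set h1 is antiperiodic, so k is pi-periodic there; for an antiderivative W, the
    function W (t + pi) - W t has zero derivative and is constant. *)
Lemma energy_shift a : int a (a + pi) k = int 0 pi k.
Proof.
have [W HW] := @pwc_antiderivative R k (Num.min a 0 - 1) k_pwc.
have p0 := pi_gt0 R.
have good c : Num.min a 0 <= c -> Num.min a 0 - 1 < c by lra.
have ma : Num.min a 0 <= a by rewrite ge_min lexx.
have m0 : Num.min a 0 <= 0 by rewrite ge_min lexx orbT.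
have E x y : Num.min a 0 <= x -> x <= y -> int x y k = W y - W x.
  move=> ax xy; have [] := @pw_ftc R W k x y xy => //.
  move=> c cxy; have [|cW dW] := HW c; first by apply: good; lra.
  by split=> //; apply: k_pwc.
have shift x y : Num.min a 0 <= x -> x <= y -> W (y + pi) - W y = W (x + pi) - W x.
  move=> ax xy; apply: (@pw_constant R (fun t => W (t + pi) - W t) x y xy).
    move=> c hc; have [|cW _] := HW c; first by apply: good; lra.
    have [|cW2 _] := HW (c + pi); first by apply: good; lra.
    apply: continuousB; last exact: cW.
    apply: (@continuous_comp _ _ _ (fun t => t + pi) W) => //.
    by apply: cvgD; [exact: cvg_id|exact: cvg_cst].
  move=> c hc; have [|_ d1] := HW c; first by apply: good; lra.
  have [|_ /near_dnbhs_shift d2] := HW (c + pi); first by apply: good; lra.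
  have d3 := dh c; have d4 := near_dnbhs_shift (dh (c + pi)).
  near=> t.
  have e1 : is_derive (t : R) 1 W (k t) by near: t.
  have e2 : is_derive (t + pi : R) 1 W (k (t + pi)) by near: t.
  have e3 : is_derive (t : R) 1 h (h1 t) by near: t.
  have e4 : is_derive (t + pi : R) 1 h (h1 (t + pi)) by near: t.
  have sh (f : R -> R) l : is_derive (t + pi : R) 1 f l -> is_derive (t : R) 1 (fun s => f (s + pi)) l.
    move=> d; have d0 : is_derive t 1 (fun s : R => s + pi) (1 : R).
      by apply: is_derive_eq; rewrite addr0.
    by rewrite -[l]mulr1; exact: (@is_derive1_comp R f (fun s => s + pi)).
  have e5 : h1 (t + pi) = - h1 t.
    have [_ <-] := sh _ _ e4; have -> : (fun s => h (s + pi)) = (fun s => - h s) by apply/funext.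
    by have [_ <-] := is_deriveN e3.
  have e6 := sh _ _ e2.
  apply: is_derive_eq.
  by rewrite /k ah e5; ring.
rewrite !E ?lexx ?lerDl ?pi_ge0 // -[in RHS](add0r pi) [RHS](shift (Num.min a 0)) //.
by rewrite (shift (Num.min a 0)).
Unshelve. all: by end_near. Qed.

(** Used to bound eps cot eps by 1 near the ends of the period. *)
Lemma sin_ge_cos x : 0 <= x <= pi -> x * cos x <= sin x.
Proof.
move=> /andP[x0 xp]; have [->|xn] := eqVneq x 0; first by rewrite mul0r sin0.
have {}x0 : 0 < x by rewrite lt_neqAle eq_sym xn.
have d t : is_derive t 1 (fun s : R => sin s - s * cos s) (t * sin t).
  by apply: is_derive_eq; rewrite /GRing.scale /=; ring.
have [|c cx E] := @MVT R (fun s => sin s - s * cos s) (fun t => t * sin t) 0 x x0 _.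
  by apply: continuous_subspaceT => t; apply: is_derive_continuous (d t).
rewrite sin0 mul0r !subr0 in E.
have c0 : 0 <= c * sin c * x.
  move: cx; rewrite in_itv /= => cx; rewrite !mulr_ge0 ?sin_ge0_pi //; lra.
lra.
Qed.

Variables (a : R).
Hypothesis ha : h a = 0.

(* [r] is the product of the derivative of [g] by [sin (t - a)]. *)
Let g t := h t / sin (t - a).
Let r t := h1 t - h t * (cos (t - a) / sin (t - a)).
Let E0 := int 0 pi k.

Lemma sin_shift_gt0 t : a < t < a + pi -> 0 < sin (t - a).
Proof. by move=> ht; apply: sin_gt0_pi; lra. Qed.

Lemma is_derive_sin_shift t : is_derive t 1 (fun t => sin (t - a)) (cos (t - a)).
Proof. by apply: is_derive_eq; rewrite /GRing.scale /=; ring. Qed.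

Lemma is_derive_cos_shift t : is_derive t 1 (fun t => cos (t - a)) (- sin (t - a)).
Proof. by apply: is_derive_eq; rewrite /GRing.scale /=; ring. Qed.

Lemma is_derive_sinV t : a < t < a + pi ->
  is_derive t 1 (fun t => (sin (t - a))^-1) (- cos (t - a) / sin (t - a) ^+ 2).
Proof.
move=> /sin_shift_gt0 s0; have ds := is_derive_sin_shift t.
have sn : sin (t - a) != 0 by rewrite gt_eqF.
have := @is_deriveV R (fun t => sin (t - a)) t _ 1 sn ds.
by move=> d; apply: is_derive_eq; rewrite /GRing.scale /= mulrC mulrN mulNr.
Qed.

Lemma sinV_continuous t : a < t < a + pi -> {for t, continuous (fun t => (sin (t - a))^-1)}.
Proof. by move=> /is_derive_sinV/is_derive_continuous. Qed.

Lemma cot_continuous t : a < t < a + pi ->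
  {for t, continuous (fun t => cos (t - a) / sin (t - a))}.
Proof.
move=> ht; apply: continuousM; last exact: sinV_continuous.
exact: is_derive_continuous (is_derive_cos_shift t).
Qed.

Lemma near_inside c : a < c < a + pi -> \forall t \near c, a < t < a + pi.
Proof.
move=> /andP[c1 c2]; have N1 := lt_nbhsr c1; have N2 := lt_nbhsl c2.
by near=> t; apply/andP; split; near: t.
Unshelve. all: by end_near. Qed.

Lemma r_pwc c : a < c < a + pi -> pwc_at r c.
Proof.
move=> hc; apply: pwcB => //; apply: pwcM; first exact: h_pwc.
by apply: pwc_cont; apply: filterS (near_inside hc) => t; apply: cot_continuous.
Qed.

Lemma r2_pwc c : a < c < a + pi -> pwc_at (fun t => r t * r t) c.
Proof. by move=> hc; apply: pwcM; apply: r_pwc. Qed.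

(** Pointwise, h'^2 - h^2 = r^2 + (h^2 cot (t - a))': the square is completed with the solution sin
    (t - a) of the Euler equation. *)
Lemma r2_integral x y : a < x -> x <= y -> y < a + pi ->
  int x y (fun t => r t * r t) = int x y k -
   (h y ^+ 2 * (cos (y - a) / sin (y - a)) - h x ^+ 2 * (cos (x - a) / sin (x - a))).
Proof.
move=> ax xy ya.
pose F t := h t ^+ 2 * (cos (t - a) / sin (t - a)).
have ik : itg x y k by apply: pwc_integrable => // c _; apply: k_pwc.
have ir : itg x y (fun t => r t * r t).
  by apply: pwc_integrable => // c hc; apply: r2_pwc; lra.
have [] := @pw_ftc R F (fun t => k t - r t * r t) x y xy.
  move=> c cxy; have hc : a < c < a + pi by lra.
  split; last 2 first.
  - by apply: pwcB; [exact: k_pwc|exact: r2_pwc].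
  - have N := dh c; have N2 : \forall t \near c^', a < t < a + pi.
      by apply: cvg_within; exact: near_inside.
    apply: filterS2 N N2 => t dht ht.
    have s0 : sin (t - a) != 0 by rewrite gt_eqF // sin_shift_gt0.
    have ds := is_derive_sinV ht; have dc := is_derive_cos_shift t.
    by apply: is_derive_eq; rewrite /k /r /GRing.scale /=; field.
  rewrite /F; apply: continuousM; last exact: cot_continuous.
  by rewrite (_ : (fun t => h t ^+ 2) = (fun t => h t * h t)); [apply: continuousM|apply/funext => t; rewrite expr2].
rewrite RintegralB //; move=> _ E; rewrite -/(F x) -/(F y); lra.
Qed.

Lemma h_near_a t : `|h t| <= L * `|t - a|.
Proof. by have := Lh t a; rewrite ha subr0. Qed.

Lemma h_near_api t : `|h t| <= L * `|t - (a + pi)|.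
Proof. by have := Lh t (a + pi); rewrite ah ha oppr0 subr0. Qed.

(** As h vanishes at a and at a + pi and is L-Lipschitz, it is at most L eps on the two end
    intervals. Each of the two boundary terms h^2 cot and of the two missing integrals of k then
    costs at most L^2 eps. *)
Lemma r2_bound (eps : R) : 0 < eps < 1 ->
  int (a + eps) (a + pi - eps) (fun t => r t * r t) <= E0 + 4 * L ^+ 2 * eps.
Proof.
move=> /andP[e0 e1]; have p1 := pihalf_ge1 R.
have pi2 : 2 <= pi :> R by lra.
have L0 : 0 <= L by have := h_near_a (a + 1); have := normr_ge0 (h (a + 1)); rewrite addrAC subrr add0r normr1 mulr1; lra.
rewrite r2_integral; try lra.
have iK x y : x <= y -> itg x y k by move=> xy; apply: pwc_integrable => // c _; apply: k_pwc.
have [le1 le2 le3 le4] : [/\ a <= a + eps, a + eps <= a + pi, a + eps <= a + pi - eps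
  & a + pi - eps <= a + pi] by split; lra.
have [_ S1] := itv_integral_add (introT andP (conj le1 le2)) (iK _ _ le1) (iK _ _ le2).
have [_ S2] := itv_integral_add (introT andP (conj le3 le4)) (iK _ _ le3) (iK _ _ le4).
have E0E : E0 = int a (a + pi) k by rewrite energy_shift.
have low x y : x <= y -> y - x <= eps -> (forall t, x <= t <= y -> `|h t| <= L * eps) ->
    - (L ^+ 2 * eps) <= int x y k.
  move=> xy yx hb; apply: (@le_trans _ _ (- (L ^+ 2 * eps ^+ 2) * (y - x))).
    rewrite mulNr lerN2 -mulrA ler_wpM2l ?sqr_ge0 //.
    apply: (@le_trans _ _ (eps ^+ 2 * eps)); first by rewrite ler_wpM2l ?sqr_ge0.
    rewrite -[leRHS]mul1r ler_wpM2r ?ltW // expr2; nra.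
  rewrite -itv_integral_cst //; apply: itv_integral_le; [|exact: iK|].
    by apply: pwc_integrable => // c _; apply: pwc_cont; near=> t; apply: cst_continuous.
  move=> t txy; rewrite /k; have := hb t txy => ht.
  have : h t ^+ 2 <= (L * eps) ^+ 2.
    by rewrite -real_normK ?num_real // lerXn2r ?nnegrE ?mulr_ge0 // ltW.
  have := sqr_ge0 (h1 t); rewrite exprMn !expr2; lra.
have B1 : - (L ^+ 2 * eps) <= int a (a + eps) k.
  apply: low; [by []|by clear S1 S2 E0E; lra|move=> t ta; apply: le_trans (h_near_a t) _].
  by rewrite ler_wpM2l // ger0_norm; clear S1 S2 E0E; lra.
have B2 : - (L ^+ 2 * eps) <= int (a + pi - eps) (a + pi) k.
  apply: low; [by []|by clear S1 S2 E0E B1; lra|move=> t ta; apply: le_trans (h_near_api t) _].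
  by rewrite ler_wpM2l // ler0_norm; clear S1 S2 E0E B1; lra.
have s0 : 0 < sin eps by apply: sin_gt0_pi; clear S1 S2 E0E B1 B2; lra.
have cs : eps * (cos eps / sin eps) <= 1.
  by rewrite mulrA ler_pdivrMr // mul1r; apply: sin_ge_cos; clear S1 S2 E0E B1 B2; lra.
have c0 : 0 <= cos eps / sin eps.
  have c1 : 0 < cos eps by apply: cos_gt0_pihalf; clear S1 S2 E0E B1 B2; lra.
  by rewrite divr_ge0 ?ltW.
have sq t : `|h t| <= L * eps -> h t ^+ 2 * (cos eps / sin eps) <= L ^+ 2 * eps.
  move=> ht; have : h t ^+ 2 <= (L * eps) ^+ 2.
    by rewrite -real_normK ?num_real // lerXn2r ?nnegrE ?mulr_ge0 // ltW.
  move=> h2; apply: le_trans (ler_wpM2r c0 h2) _.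
  have -> : (L * eps) ^+ 2 * (cos eps / sin eps) = L ^+ 2 * eps * (eps * (cos eps / sin eps)) by ring.
  by rewrite ler_piMr // mulr_ge0 ?sqr_ge0 // ltW.
have C1 : h (a + eps) ^+ 2 * (cos eps / sin eps) <= L ^+ 2 * eps.
  apply: sq; have := h_near_a (a + eps).
  have -> : a + eps - a = eps by ring.
  by rewrite (ger0_norm (ltW e0)).
have C2 : h (a + pi - eps) ^+ 2 * (cos eps / sin eps) <= L ^+ 2 * eps.
  apply: sq; have := h_near_api (a + pi - eps).
  have -> : a + pi - eps - (a + pi) = - eps by ring.
  by rewrite normrN (ger0_norm (ltW e0)).
have -> : a + eps - a = eps by ring.
have -> : a + pi - eps - a = - eps + pi by ring.
rewrite cosDpi sinDpi cosN sinN opprK mulNr mulrN.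
move: S1 S2 B1 B2 C1 C2; rewrite -E0E; clear E0E le1 le2 le3 le4 low sq; lra.
Unshelve. all: by end_near. Qed.

Lemma dirichlet_ge0 : 0 <= E0.
Proof.
rewrite leNgt; apply/negP => En.
(* Small enough that E0 + 4 L^2 eps is still negative, whereas it bounds the integral of a
   square. *)
pose eps := Num.min (2^-1) (- E0 / (4 * L ^+ 2 + 1) / 2).
have L2 := sqr_ge0 L.
have q0 : 0 < - E0 / (4 * L ^+ 2 + 1) / 2 by rewrite !divr_gt0 //; lra.
have e0 : 0 < eps by rewrite lt_min q0 invr_gt0 ltr0n.
have e1 : eps <= 2^-1 by rewrite ge_min lexx.
have e2 : eps <= - E0 / (4 * L ^+ 2 + 1) / 2 by rewrite ge_min lexx orbT.
have eb : 0 < eps < 1 by lra.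
have B := r2_bound eb.
have : 0 <= int (a + eps) (a + pi - eps) (fun t => r t * r t).
  by apply: itv_integral_ge0 => t _; rewrite -expr2 sqr_ge0.
have : (4 * L ^+ 2 + 1) * eps <= - E0 / 2.
  rewrite mulrC -ler_pdivlMr; last lra.
  by apply: le_trans e2 _; rewrite mulrAC.
move: B; lra.
Qed.

(** The integral of r^2 vanishes on every compact part of the open period. As g' = r / sin (t - a),
    the increments of g vanish as well. *)
Lemma dirichlet_eq0 : E0 = 0 -> forall x y, a < x -> x <= y -> y < a + pi -> g x = g y.
Proof.
move=> E00 x y ax xy ya.
have p1 := pihalf_ge1 R.
have ir x' y' : a < x' -> x' <= y' -> y' < a + pi -> itg x' y' (fun t => r t * r t).
  by move=> *; apply: pwc_integrable => // c hc; apply: r2_pwc; lra.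
have L2 := sqr_ge0 L.
have I0 : int x y (fun t => r t * r t) = 0.
  apply/le_anti/andP; split; last by apply: itv_integral_ge0 => t _; rewrite -expr2 sqr_ge0.
  rewrite leNgt; apply/negP => I1.
  set I := int x y (fun t => r t * r t) in I1 *.
  (* Small enough that [x, y] lies inside the interval of [r2_bound] and that the bound is below
     I. *)
  pose eps := Num.min (Num.min (2^-1) (I / (4 * L ^+ 2 + 1) / 2)) (Num.min (x - a) (a + pi - y)).
  have q0 : 0 < I / (4 * L ^+ 2 + 1) / 2 by rewrite !divr_gt0 //; lra.
  have e0 : 0 < eps by rewrite !lt_min q0 invr_gt0 ltr0n /=; lra.
  have [e1 e2 e3 e4] : [/\ eps <= 2^-1, eps <= I / (4 * L ^+ 2 + 1) / 2, eps <= x - a &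
     eps <= a + pi - y] by rewrite /eps !ge_min !lexx !orbT.
  have eb : 0 < eps < 1 by lra.
  have B := r2_bound eb.
  have M : (4 * L ^+ 2 + 1) * eps <= I / 2.
    rewrite mulrC -ler_pdivlMr; last lra.
    by apply: le_trans e2 _; rewrite mulrAC.
  have A1 : a + eps <= x <= a + pi - eps by lra.
  have A2 : x <= y <= a + pi - eps by lra.
  have ay : a < y by apply: lt_le_trans xy.
  have xp : x < a + pi by apply: le_lt_trans ya.
  have [lt1 lt2] : a < a + eps /\ a + pi - eps < a + pi by split; lra.
  have i1 := ir _ _ lt1 (proj1 (andP A1)) xp.
  have i2 := ir _ _ ax (proj2 (andP A1)) lt2.
  have i3 := ir _ _ ax xy ya.
  have i4 := ir _ _ ay (proj2 (andP A2)) lt2.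
  have [_ S1] := itv_integral_add A1 i1 i2; have [_ S2] := itv_integral_add A2 i3 i4.
  have N1 : 0 <= int (a + eps) x (fun t => r t * r t).
    by apply: itv_integral_ge0 => t _; rewrite -expr2 sqr_ge0.
  have N2 : 0 <= int y (a + pi - eps) (fun t => r t * r t).
    by apply: itv_integral_ge0 => t _; rewrite -expr2 sqr_ge0.
  move: B S1 S2 M N1 N2 I1; rewrite E00 -/I; lra.
pose w t := (sin (t - a))^-1.
have cw t : a < t < a + pi -> {for t, continuous w} := @sinV_continuous t.
have pw c : a < c < a + pi -> pwc_at w c.
  by move=> hc; apply: pwc_cont; apply: filterS (near_inside hc) => t; apply: cw.
have [irw G] : itg x y (fun t => r t * w t) /\ int x y (fun t => r t * w t) = g y - g x.
  apply: (@pw_ftc R g) => // c cxy; have hc : a < c < a + pi by lra.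
  split; last 2 first.
  - by apply: pwcM; [exact: r_pwc|exact: pw].
  - have N := dh c; have N2 : \forall t \near c^', a < t < a + pi.
      by apply: cvg_within; exact: near_inside.
    apply: filterS2 N N2 => t dht ht.
    have s0 : sin (t - a) != 0 by rewrite gt_eqF // sin_shift_gt0.
    have ds := is_derive_sinV ht.
    by apply: is_derive_eq; rewrite /r /w /GRing.scale /=; field.
  by apply: continuousM => //; exact: cw.
have iw : itg x y (fun t => w t * w t).
  by apply: pwc_integrable => // c hc; apply: pwcM; apply: pw; lra.
have irr := ir x y ax xy ya.
set K := int x y (fun t => w t * w t).
have K0 : 0 <= K by apply: itv_integral_ge0 => t _; rewrite -expr2 sqr_ge0.
have iz (c : R) f : itg x y f -> itg x y (fun t => c * f t).
  by move=> fi; exact: (integrableZl _ c fi).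
(* AM-GM: [2 |r w| <= delta w^2 + r^2 / delta], and [r^2] integrates to 0. *)
have key (s delta : R) : s ^+ 2 = 1 -> 0 < delta -> 2 * (s * (g y - g x)) <= delta * K.
  move=> s2 d0.
  have -> : 2 * (s * (g y - g x)) = int x y (fun t => 2 * s * (r t * w t)).
    by rewrite RintegralZl // G mulrA.
  have -> : delta * K = int x y (fun t => delta^-1 * (r t * r t) + delta * (w t * w t)).
    rewrite RintegralD //; [|exact: iz|exact: iz].
    by rewrite !RintegralZl // I0 mulr0 add0r.
  apply: itv_integral_le; first exact: iz.
    exact: (integrableD _ (iz delta^-1 _ irr) (iz delta _ iw)).
  move=> t _; rewrite -subr_ge0.
  have -> : delta^-1 * (r t * r t) + delta * (w t * w t) - 2 * s * (r t * w t) =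
    delta^-1 * (r t - s * delta * w t) ^+ 2 + delta * (1 - s ^+ 2) * (w t) ^+ 2.
    by field; rewrite gt_eqF.
  by rewrite s2 subrr mulr0 mul0r addr0 mulr_ge0 ?sqr_ge0 // invr_ge0 ltW.
have [//|gn] := eqVneq (g x) (g y).
have d0 : 0 < `|g y - g x| by rewrite normr_gt0 subr_eq0 eq_sym.
have [s s2 sE] : exists2 s : R, s ^+ 2 = 1 & s * (g y - g x) = `|g y - g x|.
  have [h0|h0] := leP 0 (g y - g x); [exists 1|exists (- 1)]; rewrite ?expr1n ?sqrrN ?expr1n //.
    by rewrite mul1r ger0_norm.
  by rewrite mulN1r ltr0_norm.
(* With this delta, the inequality gives 2 |g y - g x| at most |g y - g x|, so the difference is
   0. *)
have := key s (`|g y - g x| / (K + 1)) s2.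
rewrite sE divr_gt0 ?ltr_wpDl // => /(_ isT).
have : `|g y - g x| / (K + 1) * K <= `|g y - g x|.
  by rewrite mulrAC ler_pdivrMr ?ltr_wpDl // ler_wpM2l // lerDl.
lra.
Qed.

End Wirtinger.

(** * The energy as a Dirichlet form *)

Section Energy.
Context {R : realType} {n : nat} {P : 'Z_(n.*2) -> 'rV[R]_2}.
Hypothesis hP : CPPOS P.
Implicit Types (s t : R) (p v x y z : 'rV[R]_2).
Local Notation mu := (@lebesgue_measure R).
Local Notation int a b f := (\int[mu]_(t in `[a, b]) f t).

Definition dirichlet (f : R -> R) : R :=
  2^-1 * int 0 pi (fun t => f^`()%classic t * f^`()%classic t - f t * f t).

Lemma energyE p : inI P p -> energy P p = dirichlet (level P p).
Proof.
move=> hp; rewrite /energy interior_regionE // ifT; last exact/asboolP.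
rewrite (ART_area_dirichlet (level_pwC2 hP hp)); last by move=> t; apply: level_antiperiodic.
rewrite /dirichlet -mulrN; congr (_ * _).
have H := level_pwC2 hP hp.
have i f : (forall c, pwc_at f c) -> mu.-integrable `[0, pi] (EFin \o f).
  by move=> hf; apply: pwc_integrable => //; apply: pi_ge0.
have ph c : pwc_at (fun t => level P p t * level P p t) c.
  by apply: pwcM; apply: (pw_pwc H).
have pd c : pwc_at (fun t => (level P p)^`()%classic t * (level P p)^`()%classic t) c.
  by apply: pwcM; apply: (pw_derive_pwc H).
by rewrite !RintegralB ?opprB //; apply: i.
Qed.

Lemma energy_boundary p : ~ inI P p -> energy P p = 0.
Proof. by move=> hp; rewrite /energy interior_regionE // ifF //; apply/asboolP. Qed.

Lemma level_zero p : inI P p -> exists2 a, 0 <= a <= pi & level P p a = 0.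
Proof.
move=> hp; have [||a] := @IVT R (level P p) 0 pi 0 (pi_ge0 R).
- by apply: continuous_subspaceT => t; apply: level_continuous.
- rewrite -[pi]add0r level_antiperiodic // ge_min le_max !oppr_le0 !oppr_ge0 orbC.
  by case: (leP 0 (level P p 0)) => //= h; rewrite ltW.
by rewrite in_itv /= => a0 E; exists a.
Qed.

Lemma energy_ge0 p : 0 <= energy P p.
Proof.
have [hp|hp] := pselect (inI P p); last by rewrite energy_boundary.
have [a /andP[a0 _] ha] := level_zero hp; rewrite energyE // mulr_ge0 //.
have H := level_pwC2 hP hp.
apply: (dirichlet_ge0 (L := 2 * bound P) _ _ _ _ _ ha).
- exact: (pw_continuous H).
- exact: (pw_derive_pwc H).
- exact: (pw_derive H).
- by move=> t; apply: level_antiperiodic.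
- by move=> s t; apply: level_lipschitz.
Qed.

Lemma antiperiodic_extend (P0 : R -> Prop) a :
  (forall t, P0 t <-> P0 (t + pi)) -> (forall t, a <= t < a + pi -> P0 t) ->
  forall t, P0 t.
Proof.
move=> hp h0; have p0 := pi_gt0 R.
have shift m t : P0 t <-> P0 (t + m%:R * pi).
  elim: m => [|m IH]; first by rewrite mul0r addr0.
  by rewrite IH -natr1 mulrDl mul1r addrA -hp.
have pos t : a <= t -> P0 t.
  move=> at_; pose m := Num.trunc ((t - a) / pi).
  have /trunc_itv/andP[m1 m2] : 0 <= (t - a) / pi by rewrite divr_ge0 //; lra.
  rewrite -/m in m1 m2; rewrite -(subrK (m%:R * pi) t) -shift; apply: h0.
  move: m1 m2; rewrite ler_pdivlMr // ltr_pdivrMr // -natr1; lra.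
move=> t; pose m := (Num.trunc `|(a - t) / pi|).+1.
have /trunc_itv/andP[_ m2] := normr_ge0 ((a - t) / pi).
rewrite (shift m); apply: pos.
have : (a - t) / pi < m%:R by apply: le_lt_trans (ler_norm _) m2.
rewrite ltr_pdivrMr //; lra.
Qed.

(** If a is a zero of h, the equality case gives h = c sin (t - a), which is [dot (nvec t) v] for v
    = c tau(a): all image lines pass through v. *)
Lemma energy_eq0 p : inI P p -> energy P p = 0 ->
  exists v, forall t, level P p t = dot (nvec t) v.
Proof.
move=> hp; have [a /andP[a0 _] ha] := level_zero hp; rewrite energyE // => /eqP.
rewrite mulf_eq0 invr_eq0 pnatr_eq0 /= => /eqP E.
have H := level_pwC2 hP hp; have p0 := pi_gt0 R.
have G := @dirichlet_eq0 R (level P p) _ (2 * bound P) (pw_continuous H)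
  (pw_derive_pwc H) (pw_derive H) (fun t => level_antiperiodic hP t hp)
  (fun s t => level_lipschitz hP s t hp) a ha E.
pose c := level P p (a + pi / 2) / sin (a + pi / 2 - a).
have Gc t : a < t < a + pi -> level P p t / sin (t - a) = c.
  move=> ht; have [h|h] := leP t (a + pi / 2).
    by apply: (G t (a + pi / 2)); lra.
  by apply/esym; apply: (G (a + pi / 2) t); lra.
exists (c *: tvec a).
apply: (@antiperiodic_extend _ a) => t.
  rewrite level_antiperiodic // nvecDpi.
  have -> : dot (- nvec t) (c *: tvec a) = - dot (nvec t) (c *: tvec a).
    by rewrite /dot !mxE; ring.
  by split=> [->//|/oppr_inj].
move=> ht; have sE : dot (nvec t) (c *: tvec a) = c * sin (t - a).
  by rewrite sinB /dot !mxE /=; ring.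
rewrite sE; have [->|ta] := eqVneq t a; first by rewrite ha subrr sin0 mulr0.
have hta : a < t < a + pi by have : a < t by [rewrite lt_neqAle eq_sym ta; lra]; lra.
rewrite -(Gc t hta) divfK // gt_eqF //; apply: sin_gt0_pi; lra.
Qed.

End Energy.

(** * Central symmetry *)

Section Symmetry.
Context {R : realType} {n : nat} {P : 'Z_(n.*2) -> 'rV[R]_2}.
Hypothesis hP : CPPOS P.
Let n1 := cppos_size hP.
Implicit Types (i j m : 'Z_(n.*2)) (s t u : R) (p v w x y z c : 'rV[R]_2).
Local Notation mu := (@lebesgue_measure R).
Local Notation int a b f := (\int[mu]_(t in `[a, b]) f t).
Local Notation e := (edge P).
Local Notation pt := (side_pt P).
Local Notation ht := (height P).

Definition ratio i : R := dot (e i) (e (i + n%:R)) / dot (e i) (e i).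

Lemma ratioE i : e (i + n%:R) = ratio i *: e i.
Proof.
have [a _ E] := edge_opp hP i.
rewrite {1}E /ratio E dotZr mulfK // gt_eqF // dot_self_gt0 //.
exact: edge_neq0.
Qed.

Lemma ratio_lt0 i : ratio i < 0.
Proof.
have [a a0 E] := edge_opp hP i.
suff -> : ratio i = a by [].
by apply: (scale_inj (edge_neq0 hP i)); rewrite -ratioE.
Qed.

Lemma ratio_mul i : ratio (i + n%:R) * ratio i = 1.
Proof.
apply: (scale_inj (edge_neq0 hP i)).
by rewrite -scalerA -ratioE -ratioE (Zp_half n1) scale1r.
Qed.

Definition vertex_symmetric c := forall i, P (i + n%:R) = c *+ 2 - P i.

Lemma region_reflect c : vertex_symmetric c -> forall z, region P z -> region P (c *+ 2 - z).
Proof.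
move=> hc z [w [w0 w1 ->]]; exists (fun i => w (i + n%:R)); split=> //.
  rewrite -w1 [RHS](reindex_inj (addIr n%:R)) //.
rewrite (reindex_inj (addIr n%:R)) /=.
under [RHS]eq_bigr do rewrite -[X in P X](Zp_half n1) hc scalerBr.
rewrite sumrB -scaler_suml; congr (_ - _).
have -> : \sum_i w (i + n%:R) = 1 by rewrite -w1 [RHS](reindex_inj (addIr n%:R)).
by rewrite scale1r.
Qed.

Lemma vertex_centrally_symmetric c : vertex_symmetric c -> centrally_symmetric P.
Proof.
move=> hc; exists c; apply/seteqP; split=> z.
  by move=> [y hy <-]; apply: region_reflect.
by move=> hz; exists (c *+ 2 - z); [apply: region_reflect|rewrite subKr].
Qed.

(** The reflection exchanges the supporting lines of opposite sides, so it maps side i into side i +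
    n. Hence every ratio is at most -1; as the ratios at i and i + n are inverse to each other, both
    are -1, and the ends of the sides correspond. *)
Lemma centrally_symmetric_vertex : centrally_symmetric P -> exists c, vertex_symmetric c.
Proof.
move=> [c hc]; exists c.
have refl z : inK P z -> inK P (c *+ 2 - z).
  by rewrite -(regionE hP) => hz; rewrite -hc; exists z.
have vK j : inK P (P j) by rewrite -(regionE hP); apply: region_vertex.
pose H i := ht i (P (i + n%:R)); pose K i := det2 (e i) (c *+ 2 - P i *+ 2).
have htn i z : ht (i + n%:R) z = ratio i * (ht i z - H i).
  by rewrite /H /height ratioE /det2 !mxE; ring.
have htr i z : ht i (c *+ 2 - z) = K i - ht i z.
  by rewrite /K /height /det2 !mxE; ring.
have le_H i z : inK P z -> ht i z <= H i.
  move=> /(_ (i + n%:R)); rewrite htn => h; have := ratio_lt0 i; nra.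
have ht_P i : ht i (P i) = 0 by rewrite -(side_pt0 i) height_self.
have ht_P1 i : ht i (P (i + 1)) = 0 by rewrite -side_pt0 -side_pt1 height_self.
have KH i : K i = H i.
  have h1 := le_H i _ (refl _ (vK i)); rewrite htr ht_P subr0 in h1.
  have h2 := refl _ (vK (i + n%:R)) i; rewrite htr -/(H i) in h2.
  lra.
have on_side i z : inK P z -> ht i z = 0 -> exists2 s, 0 <= s <= 1 & c *+ 2 - z = pt (i + n%:R) s.
  move=> hz h0; apply: (inK_height0 hP (refl _ hz)).
  by rewrite htn htr h0 KH subr0 subrr mulr0.
have ends i : exists2 s, 0 <= s <= 1 & c *+ 2 - P i = pt (i + n%:R) s /\
    exists2 s', 0 <= s' <= 1 & (s' - s) * ratio i = - 1.
  have [s s01 E] := on_side i _ (vK i) (ht_P i).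
  have [s' s'01 E'] := on_side i _ (vK (i + 1)) (ht_P1 i).
  exists s => //; split=> //; exists s' => //.
  apply: (scale_inj (edge_neq0 hP i)).
  have -> : ((s' - s) * ratio i) *: e i = pt (i + n%:R) s' - pt (i + n%:R) s.
    by rewrite -scalerA -ratioE; apply: eq_rV2; rewrite /side_pt !mxE; ring.
  by rewrite -E -E' /edge scaleN1r; apply: eq_rV2; rewrite !mxE; ring.
have ge1 i : ratio i <= - 1.
  by have [s s01 [_ [s' s'01 E]]] := ends i; have := ratio_lt0 i; nra.
have rm1 i : ratio i = - 1.
  by have := ge1 i; have := ge1 (i + n%:R); have := ratio_mul i; nra.
move=> i; have [s s01 [-> [s' s'01]]] := ends i; rewrite rm1 => E.
have -> : s = 0 by lra.
by rewrite side_pt0.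
Qed.

(** Here sigma is the point reflection in c, so every image line passes through the reflection of
    p. *)
Lemma level_symmetric c p t : vertex_symmetric c -> inI P p ->
  level P p t = dot (nvec t) (c *+ 2 - p).
Proof.
move=> hc hp; have [x [x' [y [y' h]]]] := pchord_exists hP hp t.
have img z z' : srel P z z' -> z' = c *+ 2 - z.
  move=> [i [s [_ -> ->]]]; rewrite /side_pt /edge (addrAC i) !hc.
  by apply: eq_rV2; rewrite !mxE; ring.
rewrite (levelE hP hp h); have [/img xE /img yE [k _ pE] hn _] := h.
rewrite pE -[LHS]mul1r -{1}[1](subrK k) mulrDl {2}hn xE yE.
by rewrite /dot !mxE; ring.
Qed.

(** For a sinusoid h the integrand is the derivative of h h', which is pi-periodic. *)
Lemma dirichlet_sinusoid v : dirichlet (fun t => dot (nvec t) v) = 0.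
Proof.
rewrite /dirichlet.
have -> : (fun t => dot (nvec t) v)^`()%classic = (fun t => dot (tvec t) v).
  apply/funext => t; rewrite derive1E.
  by have [_ <-] := is_derive_dot_nvec v t.
pose F t := dot (nvec t) v * dot (tvec t) v.
have cn : continuous (fun t => dot (nvec t) v) by exact: dot_nvec_continuous.
have ct : continuous (fun t => dot (tvec t) v) by exact: dot_tvec_continuous.
have -> : int 0 pi (fun t => dot (tvec t) v * dot (tvec t) v - dot (nvec t) v * dot (nvec t) v)
  = F pi - F 0.
  apply: C1_ftc; first exact: pi_ge0.
  - by apply: continuousM; [exact: cn|exact: ct].
  - by apply: continuousM; [exact: cn|exact: ct].
  - move=> t _; apply: continuousB; first by apply: continuousM; exact: ct.
    by apply: continuousM; exact: cn.
  move=> t _; have d1 := is_derive_dot_nvec v t; have d2 := is_derive_dot_tvec v t.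
  by apply: is_derive_eq; rewrite /GRing.scale /=; ring.
by rewrite /F -[pi]add0r nvecDpi tvecDpi /dot !mxE; ring.
Qed.

Lemma energy_symmetric c p : vertex_symmetric c -> energy P p = 0.
Proof.
move=> hc; have [hp|hp] := pselect (inI P p); last exact: energy_boundary.
rewrite energyE //.
have -> : level P p = (fun t => dot (nvec t) (c *+ 2 - p)).
  by apply/funext => t; apply: level_symmetric.
exact: dirichlet_sinusoid.
Qed.

Lemma concurrent_chord p v x x' y y' k : inI P p ->
  (forall t, level P p t = dot (nvec t) v) -> srel P x x' -> srel P y y' ->
  0 < k < 1 -> p = (1 - k) *: x + k *: y -> det2 (y' - x') (v - x') = 0.
Proof.
move=> hp hv hx hy k01 pE; have [_ [t h]] := pchord_of_line hP hp hx hy k01 pE.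
have := det3_nt v (pc_n h); rewrite /det3 => ->.
by rewrite -hv (levelE hP hp h) subrr mulr0.
Qed.

Lemma det2_kernel (d1 d2 w : 'rV[R]_2) : det2 d1 w = 0 -> det2 d2 w = 0 ->
  det2 d1 d2 != 0 -> w = 0.
Proof.
move=> h1 h2 h; have P1 := plucker d1 d2 w.
apply: eq_rV2; rewrite mxE; apply: (mulIf h); rewrite mul0r.
  transitivity (d1 0 0 * det2 w d2 - d2 0 0 * det2 w d1); first by rewrite /det2; ring.
  by rewrite !(det2C w) h1 h2; ring.
transitivity (d1 0 1 * det2 w d2 - d2 0 1 * det2 w d1); first by rewrite /det2; ring.
by rewrite !(det2C w) h1 h2; ring.
Qed.

(** The point is a combination with positive coefficients of three consecutive vertices, and no line
    of a side contains all three. *)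
Lemma corner_interior m (a b : R) : 0 < a -> 0 < b -> a + b < 1 ->
  inI P (P (m + 1) - a *: e m + b *: e (m + 1)).
Proof.
move=> a0 b0 ab i.
have -> : ht i (P (m + 1) - a *: e m + b *: e (m + 1)) =
  a * ht i (P m) + (1 - a - b) * ht i (P (m + 1)) + b * ht i (P (m + 1 + 1)).
  by rewrite /height /edge /det2 !mxE; ring.
have h0 := height_vertex_ge0 hP i m; have h1 := height_vertex_ge0 hP i (m + 1).
have h2 := height_vertex_ge0 hP i (m + 1 + 1).
have c0 : 0 < 1 - a - b by lra.
have [z0|z0] := eqVneq (ht i (P m)) 0; last first.
  have : 0 < ht i (P m) by rewrite lt_neqAle eq_sym z0.
  nra.
have [z2|z2] := eqVneq (ht i (P (m + 1 + 1))) 0; last first.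
  have : 0 < ht i (P (m + 1 + 1)) by rewrite lt_neqAle eq_sym z2.
  nra.
have [z1|z1] := eqVneq (ht i (P (m + 1))) 0; last first.
  have : 0 < ht i (P (m + 1)) by rewrite lt_neqAle eq_sym z1.
  nra.
exfalso.
have n01 := succ_neq hP m; have n12 := succ_neq hP (m + 1).
have n02 : m + 1 + 1 != m by rewrite -addrA; apply: (@Zp_addS_neq _ n1 m 2); lia.
case: (height_vertex_eq0 hP z0) => E0; case: (height_vertex_eq0 hP z1) => E1;
  case: (height_vertex_eq0 hP z2) => E2;
  move: n01 n12 n02; rewrite ?E2 ?E1 ?E0 ?eqxx //.
Qed.

(* The chords through the point that end at P m and at P (m + 2) are known, and *)
(* v is the intersection of their image lines.                                  *)
Lemma corner_image m (a b : R) v : 0 < a -> 0 < b -> a + b < 1 ->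
  (forall t, level P (P (m + 1) - a *: e m + b *: e (m + 1)) t = dot (nvec t) v) ->
  v = P (m + 1 + n%:R) - a *: e (m + n%:R) + b *: e (m + 1 + n%:R).
Proof.
move=> a0 b0 ab; have hp := corner_interior m a0 b0 ab.
set p := _ + _ in hp *; move=> hv.
have E1 k : pt m k = P (m + 1) - (1 - k) *: e m.
  by apply: eq_rV2; rewrite /side_pt /edge !mxE; ring.
have E2 k : pt (m + n%:R) k = P (m + 1 + n%:R) - (1 - k) *: e (m + n%:R).
  by apply: eq_rV2; rewrite /side_pt /edge (addrAC m) !mxE; ring.
have b1 : 1 - b != 0 by rewrite gt_eqF //; lra.
have a1 : 1 - a != 0 by rewrite gt_eqF //; lra.
pose al := a / (1 - b); pose be := b / (1 - a).
have al01 : 0 < al < 1 by rewrite /al divr_gt0 //=; [rewrite ltr_pdivrMr ?mul1r; lra|lra].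
have be01 : 0 < be < 1 by rewrite /be divr_gt0 //=; [rewrite ltr_pdivrMr ?mul1r; lra|lra].
have D1 : det2 (e (m + 1 + n%:R) + al *: e (m + n%:R)) (v - pt (m + n%:R) (1 - al)) = 0.
  have := @concurrent_chord p v (pt m (1 - al)) (pt (m + n%:R) (1 - al))
    (pt (m + 1) 1) (pt (m + 1 + n%:R) 1) b hp hv.
  have -> : pt (m + 1 + n%:R) 1 - pt (m + n%:R) (1 - al) =
     e (m + 1 + n%:R) + al *: e (m + n%:R).
    by rewrite E2 /side_pt; apply: eq_rV2; rewrite !mxE; ring.
  apply; try (apply: srel_pt; lra); first lra.
  by rewrite E1 /side_pt /p /al; apply: eq_rV2; rewrite !mxE; field.
have D2 : det2 (be *: e (m + 1 + n%:R) + e (m + n%:R)) (v - pt (m + n%:R) 0) = 0.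
  have := @concurrent_chord p v (pt m 0) (pt (m + n%:R) 0)
    (pt (m + 1) be) (pt (m + 1 + n%:R) be) (1 - a) hp hv.
  have -> : pt (m + 1 + n%:R) be - pt (m + n%:R) 0 =
     be *: e (m + 1 + n%:R) + e (m + n%:R).
    by rewrite E2 /side_pt; apply: eq_rV2; rewrite !mxE; ring.
  apply; try (apply: srel_pt; lra); first lra.
  by rewrite E1 /side_pt /p /be; apply: eq_rV2; rewrite !mxE; field.
apply/eqP; rewrite -subr_eq0; apply/eqP; set w := v - _.
apply: (@det2_kernel (e (m + 1 + n%:R) + al *: e (m + n%:R))
  (be *: e (m + 1 + n%:R) + e (m + n%:R))).
- have <- : det2 (e (m + 1 + n%:R) + al *: e (m + n%:R))
      (w + b *: (e (m + 1 + n%:R) + al *: e (m + n%:R))) =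
    det2 (e (m + 1 + n%:R) + al *: e (m + n%:R)) w.
    by rewrite /det2 !mxE; ring.
  rewrite -[RHS]D1 E2; congr det2.
  by apply: eq_rV2; rewrite /w /al !mxE; field.
- have <- : det2 (be *: e (m + 1 + n%:R) + e (m + n%:R))
      (w + (1 - a) *: (be *: e (m + 1 + n%:R) + e (m + n%:R))) =
    det2 (be *: e (m + 1 + n%:R) + e (m + n%:R)) w.
    by rewrite /det2 !mxE; ring.
  rewrite -[RHS]D2 E2; congr det2.
  by apply: eq_rV2; rewrite /w /be !mxE; field.
have -> : det2 (e (m + 1 + n%:R) + al *: e (m + n%:R))
    (be *: e (m + 1 + n%:R) + e (m + n%:R)) =
  - (1 - al * be) * det2 (e (m + n%:R)) (e (m + 1 + n%:R)).
  by rewrite /det2 !mxE; ring.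
have := edge_turn hP (m + n%:R); rewrite (addrAC m) => tn.
by rewrite mulf_neq0 ?oppr_eq0 ?gt_eqF //; nra.
Qed.

(* A point near the midpoint of side i lies in the corners at both ends of this *)
(* side, so that [corner_image] gives two expressions of the same v.            *)
Lemma ratio_relation i (l q : R) :
  (forall p, inI P p -> energy P p = 0) -> e (i - 1) = l *: e i + q *: e (i + 1) ->
  (ratio (i - 1) - ratio i) * l = 0 /\ (ratio (i - 1) - ratio (i + 1)) * q = 0.
Proof.
move=> hE E.
have q0 : q < 0.
  have h1 := edge_turn1 hP i; have h2 := edge_turn hP i.
  have : det2 (e (i - 1)) (e i) = - q * det2 (e i) (e (i + 1)).
    by rewrite E /det2 !mxE; ring.
  nra.
(* This makes [eps * l] and [eps * q] smaller than 1/4 in absolute value, so that the same point has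
   admissible coordinates in the next corner as well. *)
pose eps := (4 * (1 + `|l| + `|q|))^-1.
have l0 := normr_ge0 l; have qn := normr_ge0 q.
have eps0 : 0 < eps by rewrite invr_gt0; lra.
have eps1 : eps * (4 * (1 + `|l| + `|q|)) = 1 by rewrite mulVf // gt_eqF //; lra.
have el : eps * `|l| < 1 / 4 by nra.
have eq_ : eps * `|q| < 1 / 4 by nra.
have e4 : eps <= 1 / 4 by nra.
have le1 : `|eps * l| < 1 / 4 by rewrite normrM gtr0_norm.
have le2 : - eps * q < 1 / 4 by move: eq_; rewrite ltr0_norm //; lra.
move: le1; rewrite ltr_norml => /andP[le1 le1'].
have q1 : 0 < - eps * q by nra.
have h12 : 0 < 1 / 2 :> R by lra.
have hsum : eps + 1 / 2 < 1 by lra.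
have hp := corner_interior (i - 1) eps0 h12 hsum.
have [v hv] := energy_eq0 hP hp (hE _ hp).
have V1 := corner_image eps0 h12 hsum hv.
have pE : P (i - 1 + 1) - eps *: e (i - 1) + (1 / 2) *: e (i - 1 + 1) =
  P (i + 1) - (1 / 2 + eps * l) *: e i + (- eps * q) *: e (i + 1).
  by rewrite subrK E; apply: eq_rV2; rewrite /edge !mxE; field.
rewrite pE in hv.
have a0 : 0 < 1 / 2 + eps * l by lra.
have ab : 1 / 2 + eps * l + - eps * q < 1 by lra.
have V2 := corner_image a0 q1 ab hv.
move: V2; rewrite V1 subrK !ratioE (addrAC i) => V2.
have F : ((ratio (i - 1) - ratio i) * l) *: e i +
         ((ratio (i - 1) - ratio (i + 1)) * q) *: e (i + 1) = 0.
  have PE : P (i + n%:R + 1) = P (i + n%:R) + ratio i *: e i.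
    by rewrite -ratioE /edge [RHS]addrC subrK.
  rewrite PE in V2.
  have W : eps *: (ratio (i - 1) *: e (i - 1)) =
    eps *: ((ratio i * l) *: e i + (ratio (i + 1) * q) *: e (i + 1)).
    transitivity (P (i + n%:R) + (1 / 2) *: (ratio i *: e i) -
      (P (i + n%:R) - eps *: (ratio (i - 1) *: e (i - 1)) + (1 / 2) *: (ratio i *: e i))).
      by apply: eq_rV2; rewrite !mxE; ring.
    by rewrite V2; apply: eq_rV2; rewrite !mxE; field.
  have W2 := @scalerI _ _ eps ltac:(by rewrite gt_eqF) _ _ W.
  rewrite E in W2; apply/eqP; rewrite -subr_eq0 subr0; apply/eqP.
  transitivity (ratio (i - 1) *: (l *: e i + q *: e (i + 1)) -
    ((ratio i * l) *: e i + (ratio (i + 1) * q) *: e (i + 1))).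
    by apply: eq_rV2; rewrite !mxE; ring.
  by rewrite W2 subrr.
have tn := edge_turn hP i.
split.
  have : ((ratio (i - 1) - ratio i) * l) * det2 (e i) (e (i + 1)) = 0.
    transitivity (det2 (((ratio (i - 1) - ratio i) * l) *: e i +
      ((ratio (i - 1) - ratio (i + 1)) * q) *: e (i + 1)) (e (i + 1))).
      by rewrite /det2 !mxE; ring.
    by rewrite F /det2 !mxE; ring.
  by move=> /eqP; rewrite mulf_eq0 (gt_eqF tn) orbF => /eqP.
have : ((ratio (i - 1) - ratio (i + 1)) * q) * det2 (e i) (e (i + 1)) = 0.
  transitivity (det2 (e i) (((ratio (i - 1) - ratio i) * l) *: e i +
    ((ratio (i - 1) - ratio (i + 1)) * q) *: e (i + 1))).
    by rewrite /det2 !mxE; ring.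
  by rewrite F /det2 !mxE; ring.
by move=> /eqP; rewrite mulf_eq0 (gt_eqF tn) orbF => /eqP.
Qed.

Lemma basis_coord (u1 u2 w : 'rV[R]_2) : det2 u1 u2 != 0 ->
  w = (det2 w u2 / det2 u1 u2) *: u1 + (det2 u1 w / det2 u1 u2) *: u2.
Proof.
move=> h; apply: eq_rV2; rewrite !mxE; apply: (mulIf h); rewrite mulrDl;
  rewrite mulrAC divfK // [X in _ + X]mulrAC divfK // /det2; ring.
Qed.

(** The ratios have period 2 along the sides, and the product of opposite ones is 1. If n is even,
    opposite ratios are equal, hence -1. If n is odd and some [e j] is not parallel to [e (j + 2)],
    neighbouring ratios agree, hence all do. Otherwise all edges of even offset from [e 0] are
    parallel to it; so is [e (n - 1)], which is adjacent to the edge [e n], itself parallel to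
    [e 0]: a contradiction. *)
Lemma energy0_ratio : (forall p, inI P p -> energy P p = 0) -> forall i, ratio i = - 1.
Proof.
move=> hE.
have rel i : ratio (i - 1) = ratio (i + 1) /\ (det2 (e (i - 1)) (e (i + 1)) != 0 -> ratio (i - 1) = ratio i).
  have tn : det2 (e i) (e (i + 1)) != 0 by rewrite gt_eqF // edge_turn.
  have [h1 h2] := ratio_relation hE (basis_coord (e (i - 1)) tn).
  split.
    move/eqP: h2; rewrite !mulf_eq0 invr_eq0 (negbTE tn) orbF subr_eq0.
    by rewrite det2C oppr_eq0 (gt_eqF (edge_turn1 hP i)) orbF => /eqP.
  move=> d0; move/eqP: h1; rewrite !mulf_eq0 invr_eq0 (negbTE tn) orbF subr_eq0.
  by rewrite (negbTE d0) orbF => /eqP.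
have per2 i : ratio (i + 1 + 1) = ratio i by have [<- _] := rel (i + 1); rewrite addrK.
have done_ i : ratio (i + n%:R) = ratio i -> ratio i = - 1.
  by move=> h; have := ratio_mul i; have := ratio_lt0 i; rewrite h; nra.
have even i (m : nat) : ratio (i + (m.*2)%:R) = ratio i.
  elim: m => [|m IH]; first by rewrite addr0.
  by rewrite doubleS -natr1 -natr1 !addrA per2.
move=> i; apply: done_.
have [k [nk|nk]] : exists k, n = k.*2 \/ n = k.*2.+1.
  by exists n./2; have := odd_double_half n; case: (odd n) => h; [right|left]; rewrite -{1}h.
  have nE : n%:R = (k.*2)%:R :> 'Z_(n.*2) := congr1 (fun m : nat => m%:R) nk.
  by rewrite nE even.
have [[j dj]|all0] := pselect (exists j, det2 (e j) (e (j + 1 + 1)) != 0).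
  have ej : ratio (j + 1) = ratio j.
    by have [_ h] := rel (j + 1); rewrite addrK in h; rewrite -(h dj).
  have all (m : nat) : ratio (j + m%:R) = ratio j /\ ratio (j + m%:R + 1) = ratio j.
    elim: m => [|m [IH1 IH2]]; first by rewrite addr0.
    by rewrite -natr1 addrA per2.
  have const m : ratio m = ratio j.
    by have [k' _ ->] := Zp_offset n1 j m; case: (all k').
  by rewrite !const.
exfalso.
have par j (m : nat) : exists a, e (j + (m.*2)%:R) = a *: e j.
  elim: m => [|m [a IH]]; first by exists 1; rewrite addr0 scale1r.
  have [|b Eb] := @det2_eq0P _ (e (j + (m.*2)%:R)) (e (j + (m.*2)%:R + 1 + 1)) (edge_neq0 hP _).
    by apply/eqP/negP => /negP h; apply: all0; exists (j + (m.*2)%:R).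
  exists (b * a); rewrite doubleS -natr1 -natr1 !addrA Eb IH.
  by rewrite scalerA.
have [a Ea] := par 0 k.
have := edge_turn hP (0 + (k.*2)%:R); rewrite -addrA natr1 -nk ratioE Ea.
have -> : det2 (a *: e 0) (ratio 0 *: e 0) = 0 by rewrite /det2 !mxE; ring.
by rewrite ltxx.
Qed.

(** When opposite edges are opposite vectors, the sum P (m + n) + P m does not depend on m; the
    centre is half of it. *)
Lemma ratio_symmetric : (forall i, ratio i = - 1) -> exists c, vertex_symmetric c.
Proof.
move=> h; exists (2^-1 *: (P 0 + P n%:R)).
have S (m : nat) : P (m%:R + n%:R) + P m%:R = P 0 + P n%:R.
  elim: m => [|m IH]; first by rewrite add0r addrC.
  rewrite -IH -natr1 (addrAC _ 1).
  have := ratioE m%:R; rewrite h scaleN1r /edge => E.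
  have -> : P (m%:R + n%:R + 1) = P (m%:R + n%:R) + (P (m%:R + n%:R + 1) - P (m%:R + n%:R)).
    by rewrite [RHS]addrC subrK.
  by rewrite E; apply: eq_rV2; rewrite !mxE; ring.
move=> i; have [m _ ->] := Zp_offset n1 0 i; rewrite add0r.
have -> : P (m%:R + n%:R) = (P (m%:R + n%:R) + P m%:R) - P m%:R by rewrite addrK.
by rewrite S; apply: eq_rV2; rewrite !mxE; field.
Qed.

Theorem energy0_symmetric : (forall p, inI P p -> energy P p = 0) -> centrally_symmetric P.
Proof.
by move=> /energy0_ratio/ratio_symmetric[c]; apply: vertex_centrally_symmetric.
Qed.

End Symmetry.

(** * Affine images *)

Lemma det_M2 (R : realType) (A : 'M[R]_2) : \det A = A 0 0 * A 1 1 - A 0 1 * A 1 0.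
Proof.
rewrite (expand_det_row _ 0) !big_ord_recl big_ord0 addr0 /cofactor !det_mx11 !mxE /=.
have e1 : lift 0 0 = 1 :> 'I_2 by apply/val_inj.
have e0 : lift 1 0 = 0 :> 'I_2 by apply/val_inj.
rewrite ?e1 ?e0 expr0 mul1r expr1; ring.
Qed.

Section AffineImage.
Context {R : realType} {n : nat} {P : 'Z_(n.*2) -> 'rV[R]_2}.
Hypothesis hP : CPPOS P.
Let n1 := cppos_size hP.
Variables (A : 'M[R]_2) (b : 'rV[R]_2).
Hypothesis hA : A \in unitmx.
Implicit Types (i j : 'Z_(n.*2)) (s t : R) (u v x y z p : 'rV[R]_2).
Local Notation Q := (affine_image A b P).
Local Notation F := (affmap A b).
Local Notation D := (\det A).

Lemma mulM2 z (j : 'I_2) : (z *m A) 0 j = z 0 0 * A 0 j + z 0 1 * A 1 j.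
Proof.
rewrite mxE !big_ord_recl big_ord0 addr0 (_ : lift 0 0 = 1) //.
exact/val_inj.
Qed.

Lemma det_neq0 : D != 0.
Proof. by move: hA; rewrite unitmxE unitfE. Qed.

Lemma det2_mulM u v : det2 (u *m A) (v *m A) = D * det2 u v.
Proof. by rewrite /det2 !mulM2 det_M2; ring. Qed.

Lemma affmap_conv z w (k : R) : F ((1 - k) *: z + k *: w) = (1 - k) *: F z + k *: F w.
Proof.
rewrite /affmap mulmxDl -!scalemxAl !scalerDr addrACA -[in RHS]scalerDl.
by rewrite subrK scale1r.
Qed.

Lemma affmapB z w : F z - F w = (z - w) *m A.
Proof. by rewrite /affmap mulmxBl opprD addrACA subrr addr0. Qed.

Lemma affmap_inj : injective F.
Proof. by move=> z w /addIr; apply: (can_inj (mulmxK hA)). Qed.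

Lemma affmap_surj z : exists y, z = F y.
Proof. by exists ((z - b) *m invmx A); rewrite /affmap mulmxKV // subrK. Qed.

Lemma det2_neq0_free u v : det2 u v != 0 -> free [:: u; v].
Proof.
move=> h; apply/freeP => k; rewrite !big_ord_recl big_ord0 /= addr0 => E.
have E0 := congr1 (fun z : 'rV_2 => z 0 0) E; have E1 := congr1 (fun z : 'rV_2 => z 0 1) E.
rewrite !mxE in E0 E1.
have k0 : k 0 = 0.
  apply: (mulIf h); rewrite mul0r.
  transitivity ((k 0 * u 0 0 + k (lift 0 0) * v 0 0) * v 0 1 -
                (k 0 * u 0 1 + k (lift 0 0) * v 0 1) * v 0 0); first by rewrite /det2; ring.
  by rewrite E0 E1; ring.
have k1 : k (lift 0 0) = 0.
  apply: (mulIf h); rewrite mul0r.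
  transitivity (u 0 0 * (k 0 * u 0 1 + k (lift 0 0) * v 0 1) -
                u 0 1 * (k 0 * u 0 0 + k (lift 0 0) * v 0 0)); first by rewrite /det2; ring.
  by rewrite E0 E1; ring.
by move=> i; case: (unliftP 0 i) => [l ->|-> //]; rewrite (ord1 l).
Qed.

(** The side of P whose image is side i of the image polygon; in reversed order, the side from -i to
    -i - 1 is side -i - 1 of P run backwards. *)
Definition side_map i : 'Z_(n.*2) := if 0 < D then i else - i - 1.

Lemma edge_image i : edge Q i = Num.sg D *: (edge P (side_map i) *m A).
Proof.
rewrite /edge /affine_image /side_map; have [h|h] := ltP 0 D.
  by rewrite gtr0_sg // scale1r affmapB.
have {}h : D < 0 by rewrite lt_neqAle det_neq0.
by rewrite ltr0_sg // scaleN1r affmapB -mulNmx [in RHS]opprB subrK opprD.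
Qed.

Lemma height_image i z : height Q i (F z) = `|D| * height P (side_map i) z.
Proof.
rewrite /height edge_image /affine_image affmapB /side_map.
have [h|h] := ltP 0 D.
  by rewrite gtr0_sg // scale1r det2_mulM gtr0_norm.
have {}h : D < 0 by rewrite lt_neqAle det_neq0.
rewrite ltr0_sg // ltr0_norm // scaleN1r -mulNmx det2_mulM /edge subrK.
by rewrite /det2 !mxE; ring.
Qed.

Lemma side_mapK i : side_map (side_map i) = i.
Proof.
by rewrite /side_map; case: (0 < D); rewrite ?opprD ?opprK ?addrK.
Qed.

Lemma inK_image z : inK Q (F z) <-> inK P z.
Proof.
have D0 : 0 < `|D| by rewrite normr_gt0 det_neq0.
split=> h i; last by rewrite height_image mulr_ge0 // ltW.
by have := h (side_map i); rewrite height_image side_mapK pmulr_rge0.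
Qed.

Lemma inI_image z : inI Q (F z) <-> inI P z.
Proof.
have D0 : 0 < `|D| by rewrite normr_gt0 det_neq0.
split=> h i; last by rewrite height_image mulr_gt0.
by have := h (side_map i); rewrite height_image side_mapK pmulr_rgt0.
Qed.

Lemma side_map_half i : side_map (i + n%:R) = side_map i + n%:R.
Proof.
rewrite /side_map; case: ifP => // _.
have nn : - n%:R = n%:R :> 'Z_(n.*2).
  by apply/eqP; rewrite eq_sym -addr_eq0 -natrD addnn ZpN.
by rewrite opprD nn addrAC.
Qed.

Lemma CPPOS_image : CPPOS Q.
Proof.
split=> [||i j|i|i]; first exact: n1.
- move=> i j /affmap_inj/(cppos_inj hP); case: ifP => // _; exact: oppr_inj.
- have -> : det2 (edge Q i) (Q j - Q i) = height Q i (Q j) by [].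
  by rewrite [Q j]/affine_image height_image mulr_ge0 // height_vertex_ge0.
- apply: det2_neq0_free; rewrite !edge_image.
  have -> : det2 (Num.sg D *: (edge P (side_map i) *m A))
      (Num.sg D *: (edge P (side_map (i + 1)) *m A)) =
    Num.sg D ^+ 2 * det2 (edge P (side_map i) *m A) (edge P (side_map (i + 1)) *m A).
    by rewrite /det2 !mxE; ring.
  rewrite sqr_sg det_neq0 mul1r det2_mulM mulf_neq0 ?det_neq0 // /side_map.
  case: ifP => _; first by rewrite gt_eqF // edge_turn.
  have := edge_turn hP (- i - 1 - 1); rewrite subrK => h.
  by rewrite det2C oppr_eq0 opprD gt_eqF.
- have [c E] := cppos_parallel hP (side_map i); exists c.
  rewrite !edge_image side_map_half E -scalemxAl !scalerA.
  by rewrite mulrC.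
Qed.

Lemma side_pt_image i s : F (side_pt P i s) =
  side_pt Q (side_map i) (if 0 < D then s else 1 - s).
Proof.
rewrite !side_ptE affmap_conv /affine_image /side_map; case: ifP => // _.
have -> : - (- i - 1) = i + 1 :> 'Z_(n.*2) by ring.
have -> : - (- i - 1 + 1) = i :> 'Z_(n.*2) by ring.
by rewrite subKr addrC.
Qed.

Lemma srel_image x x' : srel P x x' -> srel Q (F x) (F x').
Proof.
move=> [i [s [s01 -> ->]]]; apply/srel_closed => //.
exists (side_map i), (if 0 < D then s else 1 - s).
rewrite -side_map_half -!side_pt_image; split=> //.
by case: ifP => _; lra.
Qed.

Lemma region_image : region Q = F @` region P.
Proof.
rewrite (regionE hP) (regionE CPPOS_image); apply/seteqP; split=> z.
  by have [y ->] := affmap_surj z => /inK_image hy; exists y.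
by move=> [y hy <-]; apply/inK_image.
Qed.

Lemma area_image : area Q = `|D| * area P.
Proof.
rewrite /area mulrCA; congr (_ * _).
have step i : det2 (Q i) (Q (i + 1)) =
  det2 b (edge Q i) + Num.sg D * D * det2 (P (side_map i)) (P (side_map i + 1)).
  have E u v : det2 (u + b) (v + b) = det2 b (v - u) + det2 u v.
    by rewrite /det2 !mxE; ring.
  rewrite edge_image /affine_image /side_map /edge /affmap E -mulmxBl.
  have [h|h] := ltP 0 D; first by rewrite gtr0_sg // mul1r scale1r det2_mulM.
  have {}h : D < 0 by rewrite lt_neqAle det_neq0.
  rewrite ltr0_sg // mulN1r mulNr -mulrN -det2C -det2_mulM scaleN1r subrK opprD.
  by rewrite -[(- i - 1)]opprD -mulNmx opprB.
under eq_bigr do rewrite step.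
rewrite big_split /= -mulr_sumr.
have -> : \sum_i det2 b (edge Q i) = 0.
  have -> : \sum_i det2 b (edge Q i) = \sum_i det2 b (Q (i + 1)) - \sum_i det2 b (Q i).
    by rewrite -sumrB; apply: eq_bigr => i _; rewrite /edge /det2 !mxE; ring.
  by rewrite [X in _ - X](reindex_inj (addIr 1)) subrr.
rewrite add0r -normrEsg; congr (_ * _).
have inj : injective side_map by apply: can_inj side_mapK.
by rewrite [RHS](reindex_inj inj).
Qed.

(** No direction is required of the image chord, because an affine map may turn [tvec f] into either
    direction along the image line. *)
Lemma level_of_chord (P0 : 'Z_(n.*2) -> 'rV[R]_2) p x x' y y' k t : CPPOS P0 ->
  inI P0 p -> srel P0 x x' -> srel P0 y y' -> 0 < k < 1 ->
  p = (1 - k) *: x + k *: y -> dot (nvec t) x' = dot (nvec t) y' ->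
  level P0 p t = dot (nvec t) x'.
Proof.
move=> h0 hp hx hy k01 pE hn.
have [xy' _] := pchord_of_line h0 hp hx hy k01 pE.
have E : line x' y' = normal_line p t (dot (nvec t) (x' - p)).
  by apply/line_eq_normal => //; rewrite !dotBr hn.
have [_ [hc|hc]] := normal_pchord h0 hp hx hy k01 pE E.
  exact: levelE hc.
by rewrite hn; apply: levelE hc.
Qed.

(** The hypothesis says that the linear form [dot (nvec t)] pulls back along A to r times the form
    of angle f, so image lines of angle f go to image lines of angle t. *)
Lemma level_image p t f r : inI P p ->
  (forall z, dot (nvec t) (z *m A) = r * dot (nvec f) z) ->
  level Q (F p) t = r * level P p f + dot (nvec t) b.
Proof.
move=> hp hr; have [x [x' [y [y' hc]]]] := pchord_exists hP hp f.
have [hx hy [k k01 pE] hn _] := hc.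
have FE z : dot (nvec t) (F z) = r * dot (nvec f) z + dot (nvec t) b.
  by rewrite /affmap dotDr hr.
rewrite (levelE hP hp hc) -FE.
apply: (@level_of_chord Q (F p) (F x) (F x') (F y) (F y') k t CPPOS_image) => //.
- exact/inI_image.
- exact: srel_image.
- exact: srel_image.
- by rewrite -affmap_conv -pE.
- by rewrite !FE hn.
Qed.

End AffineImage.

(** * Lifting the action of a matrix on directions *)

Section PolarLift.
Context {R : realType}.
Implicit Types (s t u a b c : R).

Lemma is_derive_opp t : is_derive t 1 (fun s : R => - s) (- 1 : R).
Proof. exact: is_deriveN. Qed.

Lemma sin_atan u : sin (atan u) = u / Num.sqrt (1 + u ^+ 2).
Proof.
have cn : cos (atan u) != 0 by rewrite gt_eqF // cos_gt0_pihalf // atan_gtNpi2 atan_ltpi2.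
by rewrite -cos_atan -{2}(atanK u) /tan divfK.
Qed.

(* Up to the rotation by the polar angle of A, the matrix is symmetric and      *)
(* positive definite, so the turning angle of its image curve is an arctangent. *)
Lemma polar_lift_pos (a00 a01 a10 a11 : R) : 0 < a00 * a11 - a01 * a10 ->
  let w0 t := cos t * a00 + sin t * a01 in let w1 t := cos t * a10 + sin t * a11 in
  let N t := w0 t ^+ 2 + w1 t ^+ 2 in
  exists phi : R -> R, forall t, [/\ is_derive t 1 phi ((a00 * a11 - a01 * a10) / N t),
    w0 t = Num.sqrt (N t) * cos (phi t), w1 t = Num.sqrt (N t) * sin (phi t)
    & phi (t + pi) = phi t + pi].
Proof.
move=> D0 w0 w1 N; set D := a00 * a11 - a01 * a10 in D0 *.
pose q0 := a00 + a11; pose q1 := a10 - a01; pose q := Num.sqrt (q0 ^+ 2 + q1 ^+ 2).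
have qq : 0 < q0 ^+ 2 + q1 ^+ 2.
  have : q0 ^+ 2 + q1 ^+ 2 = (a00 - a11) ^+ 2 + (a10 + a01) ^+ 2 + 4 * D by rewrite /q0 /q1 /D; ring.
  have := sqr_ge0 (a00 - a11); have := sqr_ge0 (a10 + a01); lra.
have q_gt0 : 0 < q by rewrite sqrtr_gt0.
have q2 : q ^+ 2 = q0 ^+ 2 + q1 ^+ 2 by rewrite sqr_sqrtr // ltW.
have [a [ca sa]] : exists a, q0 / q = cos a /\ q1 / q = sin a.
  by apply: polar_unit; rewrite !expr_div_n -mulrDl -q2 divff // expf_neq0 // gt_eqF.
pose m00 := a00 * cos a + a10 * sin a; pose m := a01 * cos a + a11 * sin a.
pose m11 := a11 * cos a - a01 * sin a.
have mE : m = a10 * cos a - a00 * sin a.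
  by rewrite /m -ca -sa /q0 /q1; field; rewrite gt_eqF.
have detm : m00 * m11 - m * m = D.
  transitivity (D * (cos a ^+ 2 + sin a ^+ 2)); last by rewrite cos2Dsin2 mulr1.
  by rewrite {1}mE /m00 /m11 /m /D; ring.
have trm : 0 < m00 + m11.
  have -> : m00 + m11 = q0 * cos a + q1 * sin a by rewrite /m00 /m11 /q0 /q1; ring.
  have -> : q0 * cos a + q1 * sin a = q ^+ 2 / q by rewrite -ca -sa q2; ring.
  by rewrite divr_gt0 // exprn_gt0.
have m0 : 0 < m00 by have := sqr_ge0 m; rewrite expr2 => ?; nra.
(* C and S are the coordinates of (w0, w1) in the frame turned by t + a. C is a positive definite
   quadratic form in (cos t, sin t), so the remaining angle is atan (S / C). *)
pose C t := w0 t * cos (t + a) + w1 t * sin (t + a).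
pose S t := w1 t * cos (t + a) - w0 t * sin (t + a).
have C0 t : 0 < C t.
  have cs := cos2Dsin2 t.
  have CE : C t = m00 * cos t ^+ 2 + 2 * m * (cos t * sin t) + m11 * sin t ^+ 2.
    have -> : 2 * m = m + (a10 * cos a - a00 * sin a) by rewrite -mE; ring.
    by rewrite /C /w0 /w1 /m00 /m11 /m cosD sinD; ring.
  have : m00 * C t = (m00 * cos t + m * sin t) ^+ 2 + D * sin t ^+ 2.
    by rewrite CE -detm; ring.
  have := sqr_ge0 (m00 * cos t + m * sin t); have := sqr_ge0 (sin t) => s0 h0 E.
  rewrite -(pmulr_rgt0 _ m0) E.
  have [s1|s1] := eqVneq (sin t) 0; last first.
    by apply: ltr_wpDl => //; rewrite mulr_gt0 // lt_neqAle eq_sym expf_neq0.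
  have c1 : cos t ^+ 2 = 1 by rewrite -cs s1; ring.
  by rewrite s1 !mulr0 addr0 expr0n /= mulr0 addr0 exprMn c1 mulr1 exprn_gt0.
have rot t := cos2Dsin2 (t + a).
have NE t : N t = C t ^+ 2 + S t ^+ 2.
  transitivity (N t * (cos (t + a) ^+ 2 + sin (t + a) ^+ 2)); first by rewrite rot mulr1.
  by rewrite /N /C /S; ring.
have N0 t : 0 < N t by rewrite NE ltr_wpDr ?sqr_ge0 // exprn_gt0.
have W0 t : w0 t = C t * cos (t + a) - S t * sin (t + a).
  transitivity (w0 t * (cos (t + a) ^+ 2 + sin (t + a) ^+ 2)); first by rewrite rot mulr1.
  by rewrite /C /S; ring.
have W1 t : w1 t = C t * sin (t + a) + S t * cos (t + a).
  transitivity (w1 t * (cos (t + a) ^+ 2 + sin (t + a) ^+ 2)); first by rewrite rot mulr1.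
  by rewrite /C /S; ring.
have root t : Num.sqrt (1 + (S t / C t) ^+ 2) = Num.sqrt (N t) / C t.
  have -> : 1 + (S t / C t) ^+ 2 = (Num.sqrt (N t) / C t) ^+ 2.
    by rewrite !expr_div_n sqr_sqrtr ?ltW // NE; field; rewrite gt_eqF.
  by rewrite sqrtr_sqr ger0_norm // divr_ge0 ?sqrtr_ge0 // ltW.
have sN t : Num.sqrt (N t) != 0 by rewrite gt_eqF // sqrtr_gt0.
have Cn t : C t != 0 by rewrite gt_eqF.
exists (fun t => t + a + atan (S t / C t)) => t; split.
- pose w0' := - sin t * a00 + cos t * a01; pose w1' := - sin t * a10 + cos t * a11.
  have d0 : is_derive t 1 w0 w0' by apply: is_derive_eq; rewrite /w0' /GRing.scale /=; ring.
  have d1 : is_derive t 1 w1 w1' by apply: is_derive_eq; rewrite /w1' /GRing.scale /=; ring.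
  have dc : is_derive t 1 (fun t => cos (t + a)) (- sin (t + a)).
    by apply: is_derive_eq; rewrite /GRing.scale /=; ring.
  have ds : is_derive t 1 (fun t => sin (t + a)) (cos (t + a)).
    by apply: is_derive_eq; rewrite /GRing.scale /=; ring.
  pose C' := w0' * cos (t + a) + w1' * sin (t + a) + S t.
  pose S' := w1' * cos (t + a) - w0' * sin (t + a) - C t.
  have dC : is_derive t 1 C C' by apply: is_derive_eq; rewrite /C' /S /GRing.scale /=; ring.
  have dS : is_derive t 1 S S' by apply: is_derive_eq; rewrite /S' /C /GRing.scale /=; ring.
  have dV := @is_deriveV R C t _ 1 (Cn t) dC.
  have dq : is_derive t 1 (fun t => S t / C t) ((S' * C t - S t * C') / C t ^+ 2).
    by apply: is_derive_eq; rewrite /GRing.scale /=; field.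
  have da : is_derive t 1 (fun t => atan (S t / C t))
      ((1 + (S t / C t) ^+ 2)^-1 * ((S' * C t - S t * C') / C t ^+ 2)).
    exact: (@is_derive1_comp R atan (fun t => S t / C t)).
  apply: is_derive_eq.
  have key : S' * C t - S t * C' = D - N t.
    have -> : D = (w0 t * w1' - w1 t * w0').
      transitivity (D * (cos t ^+ 2 + sin t ^+ 2)); first by rewrite cos2Dsin2 mulr1.
      by rewrite /D /w0 /w1 /w0' /w1'; ring.
    by rewrite W0 W1 NE /S' /C'; ring.
  have Nn : C t ^+ 2 + S t ^+ 2 != 0 by rewrite -NE gt_eqF.
  by rewrite key NE; field; rewrite Cn Nn.
- by rewrite cosD cos_atan sin_atan root {1}W0; field; rewrite Cn sN.
- by rewrite sinD cos_atan sin_atan root {1}W1; field; rewrite Cn sN.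
- have e0 : w0 (t + pi) = - w0 t by rewrite /w0 cosDpi sinDpi; ring.
  have e1 : w1 (t + pi) = - w1 t by rewrite /w1 cosDpi sinDpi; ring.
  have eC : C (t + pi) = C t by rewrite /C e0 e1 (addrAC t) cosDpi sinDpi; ring.
  have eS : S (t + pi) = S t by rewrite /S e0 e1 (addrAC t) cosDpi sinDpi; ring.
  by rewrite eC eS; ring.
Qed.

(** A negative determinant is made positive by negating the second column and reversing t. *)
Lemma polar_lift (a00 a01 a10 a11 : R) : a00 * a11 - a01 * a10 != 0 ->
  let w0 t := cos t * a00 + sin t * a01 in let w1 t := cos t * a10 + sin t * a11 in
  let N t := w0 t ^+ 2 + w1 t ^+ 2 in
  exists phi : R -> R, forall t, [/\ is_derive t 1 phi ((a00 * a11 - a01 * a10) / N t),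
    w0 t = Num.sqrt (N t) * cos (phi t), w1 t = Num.sqrt (N t) * sin (phi t)
    & phi (t + pi) = phi t + Num.sg (a00 * a11 - a01 * a10) * pi].
Proof.
move=> Dn w0 w1 N; have [D0|D0] := ltP 0 (a00 * a11 - a01 * a10).
  by rewrite gtr0_sg // mul1r; exact: polar_lift_pos.
have {}D0 : a00 * a11 - a01 * a10 < 0 by rewrite lt_neqAle Dn.
have [|phi H] := @polar_lift_pos a00 (- a01) a10 (- a11); first by lra.
exists (fun t => phi (- t)) => t; have [d c s _] := H (- t).
have [_ _ _ p] := H (- t - pi).
rewrite cosN sinN !mulrNN -/(w0 t) -/(w1 t) -/(N t) in d c s.
split=> //; last by rewrite ltr0_sg // mulN1r -[- t in RHS](subrK pi) p opprD addrK.
have dn := is_derive_opp t.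
have := @is_derive1_comp R phi (fun s => - s) t _ _ d dn.
by move=> d'; apply: is_derive_eq; ring.
Qed.

End PolarLift.

(** * Transformation of the Dirichlet form *)

Section Reparametrization.
Context {R : realType}.
Implicit Types (c t x y : R) (f g h phi : R -> R).
Local Notation mu := (@lebesgue_measure R).
Local Notation int a b f := (\int[mu]_(t in `[a, b]) f t).

Lemma derive_neq0_inj phi (phi1 : R -> R) : (forall t, is_derive t 1 phi (phi1 t)) ->
  (forall t, phi1 t != 0) -> injective phi.
Proof.
move=> d n0; suff lt_inj x y : x < y -> phi x != phi y.
  move=> x y E; by have [xy|yx|//] := ltgtP x y; [have := lt_inj _ _ xy|have := lt_inj _ _ yx]; rewrite E eqxx.
move=> xy; have [|c _ E] := @MVT R phi phi1 x y xy (fun t _ => d t).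
  by apply: continuous_subspaceT => t; apply: is_derive_continuous (d t).
rewrite eq_sym -subr_eq0 E mulf_neq0 // gt_eqF //; lra.
Qed.

Lemma near_dnbhs_inj phi (Q : R -> Prop) c : injective phi -> {for c, continuous phi} ->
  (\forall t \near (phi c)^', Q t) -> \forall t \near c^', Q (phi t).
Proof.
move=> ip cp; rewrite !near_withinE => /cp; rewrite !near_simpl => N.
apply: filterS N => t Nt tc; apply: Nt.
by apply: contra_neq tc => /ip.
Qed.

Lemma dirichlet_image (T T' : set R) h g (a00 a01 a10 a11 b0 b1 : R) phi :
  let D := a00 * a11 - a01 * a10 in
  let w0 t := cos t * a00 + sin t * a01 in let w1 t := cos t * a10 + sin t * a11 in
  let N t := w0 t ^+ 2 + w1 t ^+ 2 in
  D != 0 -> (forall t, is_derive t 1 phi (D / N t)) ->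
  phi pi = phi 0 + Num.sg D * pi ->
  pwC2 T h -> pwC2 T' g -> (forall t, h (t + pi) = - h t) ->
  (forall t, g t = Num.sqrt (N t) * h (phi t) + (cos t * b0 + sin t * b1)) ->
  dirichlet g = `|D| * dirichlet h.
Proof.
move=> D w0 w1 N Dn dphi phipi H G ah gE.
have p0 := pi_gt0 R.
pose w0' t := - sin t * a00 + cos t * a01; pose w1' t := - sin t * a10 + cos t * a11.
have detw t : w0 t * w1' t - w1 t * w0' t = D.
  transitivity (D * (cos t ^+ 2 + sin t ^+ 2)); last by rewrite cos2Dsin2 mulr1.
  by rewrite /D /w0 /w1 /w0' /w1'; ring.
have N0 t : 0 < N t.
  rewrite lt_neqAle addr_ge0 ?sqr_ge0 // andbT eq_sym paddr_eq0 ?sqr_ge0 // !sqrf_eq0.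
  apply: contraNN Dn => /andP[/eqP e0 /eqP e1]; rewrite -(detw t) e0 e1 !mul0r subrr //.
have Nn t : N t != 0 by rewrite gt_eqF.
have sN t : 0 < Num.sqrt (N t) by rewrite sqrtr_gt0.
have sNn t : Num.sqrt (N t) != 0 by rewrite gt_eqF.
have sN2 t : Num.sqrt (N t) ^+ 2 = N t by rewrite sqr_sqrtr // ltW.
have cphi t : {for t, continuous phi} by apply: is_derive_continuous (dphi t).
have iphi : injective phi.
  by apply: (derive_neq0_inj dphi) => t; rewrite mulf_neq0 ?invr_eq0.
pose h1 := h^`()%classic; pose k t := h1 t * h1 t - h t * h t.
pose g1 := g^`()%classic.
have kp c : pwc_at k c.
  by apply: pwcB; apply: pwcM; [apply: (pw_derive_pwc H)..|apply: (pw_pwc H)|apply: (pw_pwc H)].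
have gp c : pwc_at (fun t => g1 t * g1 t - g t * g t) c.
  by apply: pwcB; apply: pwcM; [apply: (pw_derive_pwc G)..|apply: (pw_pwc G)|apply: (pw_pwc G)].
(* A lower bound of phi on [0, pi] provides a base point for an antiderivative W of k valid on the
   whole range of phi. *)
have [c0 _ c0min] := @EVT_min R phi 0 pi (ltW p0) (continuous_subspaceT cphi).
have low c : 0 <= c <= pi -> phi c0 - 1 < phi c.
  by move=> hc; have := c0min c; rewrite in_itv /= hc => /(_ isT); lra.
have [W HW] := @pwc_antiderivative R k (phi c0 - 1) kp.
pose N1 t := 2 * (w0 t * w0' t + w1 t * w1' t).
pose be t := cos t * b0 + sin t * b1; pose be1 t := - sin t * b0 + cos t * b1.
(* Up to D times the pullback by phi of [h'^2 - h^2], the integrand is exact,  *)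
(* thanks to [N N'' / 2 - N'^2 / 4 + N^2 = D^2].                               *)
pose Z t := D * W (phi t) + N1 t / 2 * h (phi t) ^+ 2 +
  2 * (Num.sqrt (N t) * h (phi t)) * be1 t + be t * be1 t.
have d0 t : is_derive t 1 w0 (w0' t) by apply: is_derive_eq; rewrite /w0' /GRing.scale /=; ring.
have d1 t : is_derive t 1 w1 (w1' t) by apply: is_derive_eq; rewrite /w1' /GRing.scale /=; ring.
have d0' t : is_derive t 1 w0' (- w0 t) by apply: is_derive_eq; rewrite /w0 /GRing.scale /=; ring.
have d1' t : is_derive t 1 w1' (- w1 t) by apply: is_derive_eq; rewrite /w1 /GRing.scale /=; ring.
pose N2 t := 2 * (w0' t ^+ 2 + w1' t ^+ 2 - N t).
have dN t : is_derive t 1 N (N1 t).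
  by apply: is_derive_eq; rewrite /N1 /GRing.scale /=; ring.
have dN1 t : is_derive t 1 N1 (N2 t).
  by apply: is_derive_eq; rewrite /N2 /N /GRing.scale /=; ring.
have dbe t : is_derive t 1 be (be1 t) by apply: is_derive_eq; rewrite /be1 /GRing.scale /=; ring.
have dbe1 t : is_derive t 1 be1 (- be t) by apply: is_derive_eq; rewrite /be /GRing.scale /=; ring.
have dsN t : is_derive t 1 (fun t => Num.sqrt (N t)) (N1 t / (2 * Num.sqrt (N t))).
  have ds := is_derive1_sqrt (N0 t).
  have := @is_derive1_comp R Num.sqrt N t _ _ ds (dN t).
  by move=> d; apply: is_derive_eq; field.
have key t : N t * N2 t / 2 - (N1 t) ^+ 2 / 4 + (N t) ^+ 2 = D ^+ 2.
  by rewrite -(detw t) /N2 /N1 /N; field.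
have ch t : {for t, continuous h} by apply: (pw_continuous H).
have chphi c : {for c, continuous (fun t => h (phi t))}.
  by apply: (@continuous_comp _ _ _ phi h).
have [] := @pw_ftc R Z (fun t => g1 t * g1 t - g t * g t) 0 pi (ltW p0).
  move=> c hc; split; last 2 first.
  - exact: gp.
  - have [_ dW] := HW _ (low c hc).
    have n1 := near_dnbhs_inj iphi (@cphi c) dW.
    have n2 := near_dnbhs_inj iphi (@cphi c) (pw_derive H (phi c)).
    have n3 := pw_derive G c.
    near=> t.
    have e1 : is_derive (phi t) 1 W (k (phi t)) by near: t.
    have e2 : is_derive (phi t) 1 h (h1 (phi t)) by near: t.
    have e3 : is_derive t 1 g (g1 t) by near: t.
    have f1 := @is_derive1_comp R W phi t _ _ e1 (dphi t).
    have f2 := @is_derive1_comp R h phi t _ _ e2 (dphi t).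
    have g1E : g1 t = N1 t / (2 * Num.sqrt (N t)) * h (phi t) +
        D / Num.sqrt (N t) * h1 (phi t) + be1 t.
      case: e3 => _ <-; have -> : g = (fun t => Num.sqrt (N t) * h (phi t) + be t) by apply/funext.
      have : is_derive t 1 (fun t => Num.sqrt (N t) * h (phi t) + be t)
        (N1 t / (2 * Num.sqrt (N t)) * h (phi t) + D / Num.sqrt (N t) * h1 (phi t) + be1 t).
        apply: is_derive_eq; have := sN2 t; have := sNn t.
        by rewrite /GRing.scale /=; set r := Num.sqrt (N t) => rn <-; field.
      by case.
    have N2E : N2 t = 2 * (D ^+ 2 - Num.sqrt (N t) ^+ 4 + N1 t ^+ 2 / 4) / Num.sqrt (N t) ^+ 2.
      by rewrite -(key t) -[4%N]/(2 * 2)%N exprM sN2; field.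
    apply: is_derive_eq; rewrite /GRing.scale /= g1E gE /k -/(be t) N2E.
    have := sN2 t; have := sNn t.
    by set r := Num.sqrt (N t) => rn <-; field.
  have [cW _] := HW _ (low c hc).
  have cWp : {for c, continuous (fun t => W (phi t))}.
    by apply: (@continuous_comp _ _ _ phi W).
  have cN1 := is_derive_continuous (dN1 c); have csN := is_derive_continuous (dsN c).
  have cb := is_derive_continuous (dbe c); have cb1 := is_derive_continuous (dbe1 c).
  have cst (r : R) : {for c, continuous (fun=> r)} by apply: cst_continuous.
  have ch2 : {for c, continuous (fun t => h (phi t) ^+ 2)}.
    rewrite (_ : (fun t => h (phi t) ^+ 2) = (fun t => h (phi t) * h (phi t))).
      exact: continuousM.
    by apply/funext => t; rewrite expr2.
  apply: continuousD; last exact: continuousM.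
  apply: continuousD; last by apply: continuousM => //; apply: continuousM => //; apply: continuousM.
  apply: continuousD; first exact: continuousM.
  by apply: continuousM => //; apply: continuousM.
move=> _ E; rewrite {1}/dirichlet -/g1 E.
(* All terms of Z other than D W are products of two factors that are both periodic or both
   antiperiodic, so only W contributes, over one period run in the direction given by the sign of
   D. *)
have period (s : R) : Num.sg D = s -> s ^+ 2 = 1 -> W (phi pi) - W (phi 0) = s * int 0 pi k ->
  2^-1 * (Z pi - Z 0) = `|D| * dirichlet h.
  move=> sE s2 WE.
  have hs : h (phi pi) = - h (phi 0).
    rewrite phipi; have [D0|D0] := ltP 0 D; first by rewrite gtr0_sg // mul1r ah.
    have {}D0 : D < 0 by rewrite lt_neqAle Dn.
    by rewrite ltr0_sg // mulN1r -[phi 0 in RHS](subrK pi) ah opprK.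
  have e0 : w0 pi = - w0 0 by rewrite /w0 cospi sinpi cos0 sin0; ring.
  have e1 : w1 pi = - w1 0 by rewrite /w1 cospi sinpi cos0 sin0; ring.
  have e0' : w0' pi = - w0' 0 by rewrite /w0' cospi sinpi cos0 sin0; ring.
  have e1' : w1' pi = - w1' 0 by rewrite /w1' cospi sinpi cos0 sin0; ring.
  have eb : be pi = - be 0 by rewrite /be cospi sinpi cos0 sin0; ring.
  have eb1 : be1 pi = - be1 0 by rewrite /be1 cospi sinpi cos0 sin0; ring.
  have eN : N pi = N 0 by rewrite /N e0 e1; ring.
  have eN1 : N1 pi = N1 0 by rewrite /N1 e0 e1 e0' e1'; ring.
  rewrite /dirichlet -/h1 -/k normrEsg sE.
  have -> : Z pi - Z 0 = D * (W (phi pi) - W (phi 0)).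
    by rewrite /Z hs eb eb1 eN eN1; ring.
  by rewrite WE; ring.
have step c : phi c0 - 1 < c -> W (c + pi) - W c = int 0 pi k.
  move=> hc; rewrite -(energy_shift ch (pw_derive_pwc H) (pw_derive H) ah c).
  have [||_ ->//] := @pw_ftc R W k c (c + pi); first by rewrite lerDl ltW.
  move=> x hx; have [|cW dW] := HW x; first lra.
  by split.
have [D0|D0] := ltP 0 D.
  apply: (period 1); rewrite ?expr1n ?gtr0_sg // mul1r phipi gtr0_sg // mul1r.
  by apply: step; apply: low; lra.
have {}D0 : D < 0 by rewrite lt_neqAle Dn.
apply: (period (- 1)); rewrite ?sqrrN ?expr1n ?ltr0_sg // mulN1r.
have := step (phi pi); rewrite phipi ltr0_sg // mulN1r subrK => <-; first by rewrite opprB.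
by have := low pi; rewrite phipi ltr0_sg // mulN1r lexx ltW // => /(_ isT).
Unshelve. all: by end_near. Qed.

End Reparametrization.

Section EnergyImage.
Context {R : realType} {n : nat} {P : 'Z_(n.*2) -> 'rV[R]_2}.
Hypothesis hP : CPPOS P.
Variables (A : 'M[R]_2) (b : 'rV[R]_2).
Hypothesis hA : A \in unitmx.

Lemma energy_image p :
  energy (affine_image A b P) (affmap A b p) = `|\det A| * energy P p.
Proof.
have hQ := CPPOS_image hP b hA.
have [hp|hp] := pselect (inI P p); last first.
  by rewrite !energy_boundary ?mulr0 // => /(inI_image b hA).
have hq : inI (affine_image A b P) (affmap A b p) by apply/(inI_image b hA).
rewrite !energyE // det_M2.
have Dn := det_neq0 hA; rewrite det_M2 in Dn.
have [phi Hphi] := polar_lift Dn.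
apply: (dirichlet_image (phi := phi) (b0 := b 0 0) (b1 := b 0 1) Dn _ _
  (level_pwC2 hP hp) (level_pwC2 hQ hq)).
- by move=> t; case: (Hphi t).
- by have [_ _ _] := Hphi 0; rewrite add0r.
- by move=> t; apply: level_antiperiodic.
- move=> t; have [_ c s _] := Hphi t.
  rewrite (@level_image _ _ _ hP A b hA p t (phi t) (Num.sqrt
    ((cos t * A 0 0 + sin t * A 0 1) ^+ 2 + (cos t * A 1 0 + sin t * A 1 1) ^+ 2))) //.
    by rewrite /dot !mxE.
  move=> z; set r := Num.sqrt _ in c s *.
  transitivity ((cos t * A 0 0 + sin t * A 0 1) * z 0 0 +
                (cos t * A 1 0 + sin t * A 1 1) * z 0 1).
    by rewrite /dot !mulM2 !mxE /=; ring.
  by rewrite c s /dot !mxE /=; ring.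
Qed.

End EnergyImage.

(** * Continuity of the energy *)

Section CompactFiber.
Context {R : realType}.

Section Continuity.
Variables (T : topologicalType) (f g : T -> R) (v : T).
Hypotheses (cf : {for v, continuous f}) (cg : {for v, continuous g}).

Lemma contD : {for v, continuous (fun w => f w + g w)}.
Proof. exact: (@cvgD _ _ _ _ _ f g). Qed.

Lemma contB : {for v, continuous (fun w => f w - g w)}.
Proof. exact: (@cvgB _ _ _ _ _ f g). Qed.

Lemma contM : {for v, continuous (fun w => f w * g w)}.
Proof. exact: (@cvgM _ _ _ _ f g). Qed.

Lemma cont_norm : {for v, continuous (fun w => `|f w|)}.
Proof. exact: (@cvg_norm _ _ _ _ _ f). Qed.

End Continuity.

(** F + |eps - G| + (eps - G) is positive on K, because F = 0 implies G = 0; let del be its minimum.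
    It reduces to F where G is at least eps, so there F is at least del. *)
Lemma compact_fiber (d : nat) (K : set 'rV[R]_d) (F G : 'rV[R]_d -> R) :
  compact K -> (forall v, {for v, continuous F}) -> (forall v, {for v, continuous G}) ->
  (forall v, 0 <= F v) -> (forall v, 0 <= G v) -> (forall v, K v -> F v = 0 -> G v = 0) ->
  forall eps, 0 < eps -> exists2 del, 0 < del & forall v, K v -> F v < del -> G v < eps.
Proof.
move=> cK cF cG F0 G0 FG eps eps0.
have [K0|/set0P K0] := eqVneq K set0; first by exists 1 => // v; rewrite K0.
have cM : {within K, continuous (fun v => F v + `|eps - G v| + (eps - G v))}.
  apply: continuous_subspaceT => v.
  have cb := contB (@cst_continuous _ _ eps v) (cG v).
  exact: contD (contD (cF v) (cont_norm cb)) cb.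
have [c cKc cmin] := EVT_min_rV K0 cK cM.
rewrite inE in cKc.
exists (F c + `|eps - G c| + (eps - G c)).
  have [fc|fc] := eqVneq (F c) 0; last first.
    have f1 : 0 < F c by rewrite lt_neqAle eq_sym fc F0.
    by have := ler_norm (G c - eps); rewrite distrC; lra.
  by rewrite fc (FG c cKc fc) subr0; have := normr_ge0 eps; lra.
move=> v Kv Fv; rewrite ltNge; apply/negP => Gv.
have := cmin v; rewrite inE => /(_ Kv); have := normr_ge0 (eps - G c).
have -> : `|eps - G v| = G v - eps by rewrite ler0_norm ?opprB // subr_le0.
lra.
Qed.

Lemma cube_compact (d : nat) : compact [set v : 'rV[R]_d | forall i, 0 <= v 0 i <= 1].
Proof.
have := @rV_compact R d (fun=> `[0, 1]%classic) (fun=> @segment_compact R 0 1).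
congr compact; apply/seteqP; split=> v /= h i; have := h i; rewrite /= in_itv //=.
Qed.

End CompactFiber.

(** * Limits of chords *)

Section ChordLimit.
Context {R : realType} {n : nat} {P : 'Z_(n.*2) -> 'rV[R]_2}.
Hypothesis hP : CPPOS P.
Let n1 := cppos_size hP.
Implicit Types (i j l : 'Z_(n.*2)) (s u t k q : R) (p v x y z : 'rV[R]_2).
Local Notation e := (edge P).
Local Notation ht := (height P).
Local Notation pt := (side_pt P).
Local Notation W1 := (weight1 (P := P)).
Local Notation W2 := (weight2 (P := P)).
Local Notation ac := (acoef (P := P)).

(* The barycentric weight q of the envelope point on the image chord is kept as *)
(* a coordinate, subject to a polynomial equation, because it has no limit when *)
(* the chord shrinks to a point.                                                *)
Definition config t p i j s u k q :=
  [/\ 0 <= s <= 1, 0 <= u <= 1, 0 <= k <= 1, 0 <= q <= 1 &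
  [/\ p = (1 - k) *: pt i s + k *: pt j u,
    dot (nvec t) (pt (i + n%:R) s) = dot (nvec t) (pt (j + n%:R) u) &
    q * ((1 - k) * (- ac j t) * ht i (pt j u) + k * ac i t * ht j (pt i s))
      = k * ac i t * ht j (pt i s)]].

Definition touch t i j s u q :=
  dot (tvec t) (pt (i + n%:R) s) +
  q * (dot (tvec t) (pt (j + n%:R) u) - dot (tvec t) (pt (i + n%:R) s)).

Lemma pchord_config p t : inI P p -> ~ transitions P p t -> exists i j s u k q,
  [/\ config t p i j s u k q, 0 < ac i t, ac j t < 0,
     level P p t = dot (nvec t) (pt (i + n%:R) s)
     & is_derive t 1 (level P p) (touch t i j s u q)].
Proof.
move=> hp nT; have [x [x' [y [y' hc]]]] := pchord_exists hP hp t.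
have [hx hy [k k01 pE] hn ht0] := hc; have lE := levelE hP hp hc.
move: hx hy pE hn lE; case=> [i [s [s01 xE x'E]]]; case=> [j [u [u01 yE y'E]]] pE hn lE.
have sn : s != 0.
  apply/eqP => s0; apply: nT; apply/(transitionsP hP hp hc); exists i; left.
  by rewrite xE s0 side_pt0.
have un : u != 0.
  apply/eqP => u0; apply: nT; apply/(transitionsP hP hp hc); exists j; right.
  by rewrite yE u0 side_pt0.
have {sn}s01' : 0 < s < 1 by have : 0 < s by [rewrite lt_neqAle eq_sym sn; case/andP: s01]; lra.
have {un}u01' : 0 < u < 1 by have : 0 < u by [rewrite lt_neqAle eq_sym un; case/andP: u01]; lra.
rewrite xE x'E yE y'E in hc; have D := level_derive hP hp s01' u01' hc.
have s01c : 0 <= s <= 1 by lra.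
have u01c : 0 <= u <= 1 by lra.
have [a1 a2] := acoef_signs hP hp hc.
have [w1 w2] := weights_gt0 hP hp hc.
rewrite xE yE in pE.
have E1 : W1 p i j t (pt j u) = (1 - k) * (- ac j t) * ht i (pt j u).
  rewrite /W1 pE /height /side_pt /det2 !mxE; ring.
have E2 : W2 p i j t (pt i s) = k * ac i t * ht j (pt i s).
  by rewrite /W2 pE /height /side_pt /det2 !mxE; ring.
exists i, j, s, u, k, (W2 p i j t (pt i s) /
  (W1 p i j t (pt j u) + W2 p i j t (pt i s))).
have wn : W1 p i j t (pt j u) + W2 p i j t (pt i s) != 0.
  by rewrite gt_eqF // addr_gt0.
split=> //; last by apply: is_derive_eq; rewrite /touch; field.
  split=> //; first lra.
    apply/andP; split; first by rewrite divr_ge0 ?addr_ge0 ?ltW.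
    by rewrite ler_pdivrMr ?addr_gt0 // mul1r lerDr ltW.
  by split=> //; [rewrite -x'E -y'E|rewrite -E1 -E2 divfK].
by rewrite -x'E.
Qed.

Lemma same_side t l x x' y y' : ac l t != 0 -> srel P x x' -> srel P y y' ->
  ht l x = 0 -> ht l y = 0 -> dot (nvec t) x' = dot (nvec t) y' -> x = y.
Proof.
move=> a0 hx hy hlx hly hn.
have [s s01 xE] := inK_height0 hP (srel_inK hP hx).1 hlx.
have [u u01 yE] := inK_height0 hP (srel_inK hP hy).1 hly.
rewrite xE yE in hx hy *.
rewrite -(srel_fun hP (srel_pt (P := P) l s01) hx) in hn.
rewrite -(srel_fun hP (srel_pt (P := P) l u01) hy) in hn.
suff -> : s = u by [].
apply: (mulIf a0); apply/eqP; rewrite -subr_eq0 -mulrBl; apply/eqP.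
transitivity (dot (nvec t) (pt (l + n%:R) s) - dot (nvec t) (pt (l + n%:R) u)).
  by rewrite /acoef /dot /side_pt !mxE; ring.
by rewrite hn subrr.
Qed.

(** The signs of [acoef] exclude the chord in the reverse order, so the configuration is the
    [pchord] of angle t and q is the ratio of [level_derive]. *)
Lemma config_interior t p i j s u k q : inI P p -> ~ transitions P p t ->
  0 < ac i t -> ac j t < 0 -> config t p i j s u k q ->
  dot (nvec t) (pt (i + n%:R) s) = level P p t /\
  touch t i j s u q = (level P p)^`()%classic t.
Proof.
move=> hp nT ai aj [s01 u01 k01 q01 [pE hn qE]].
have hx := srel_pt (P := P) i s01; have hy := srel_pt (P := P) j u01.
have k0 : k != 0.
  apply/eqP => k0; apply: (inI_nboundary hP hp); exists i, s; split=> //.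
  by rewrite pE k0 subr0 scale1r scale0r addr0.
have k1 : k != 1.
  apply/eqP => k1; apply: (inI_nboundary hP hp); exists j, u; split=> //.
  by rewrite pE k1 subrr scale1r scale0r add0r.
have {k0 k1}k01' : 0 < k < 1.
  by move/andP: k01 => [h0 h1]; rewrite !lt_neqAle eq_sym k0 k1 h0 h1.
have [xy' _] := pchord_of_line hP hp hx hy k01' pE.
have hc : pchord P p t (pt i s) (pt (i + n%:R) s) (pt j u) (pt (j + n%:R) u).
  have [h|h|h] := ltgtP (dot (tvec t) (pt (j + n%:R) u - pt (i + n%:R) s)) 0.
  - have hc : pchord P p t (pt j u) (pt (j + n%:R) u) (pt i s) (pt (i + n%:R) s).
      split=> //; first by exists (1 - k); [lra|rewrite subKr addrC].
      by move: h; rewrite !dotBr; lra.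
    by have [aj' _] := acoef_signs hP hp hc; lra.
  - by split=> //; exists k.
  - case/eqP: xy'; apply/esym/subr0_eq.
    have /dot_nt_eq0-> : dot (nvec t) (pt (j + n%:R) u - pt (i + n%:R) s) = 0.
      by rewrite dotBr hn subrr.
    by rewrite h scale0r.
split; first by rewrite (levelE hP hp hc).
have open0 l r (z : 'rV[R]_2) : z = pt l r -> (z = pt i s) \/ (z = pt j u) -> r != 0 /\ r != 1.
  move=> zE hz; have bad m : z = P m -> False.
    move=> zm; apply: nT; apply/(transitionsP hP hp hc); exists m.
    by rewrite -zm; case: hz => ->; [left|right].
  split; apply/eqP => r0; rewrite zE r0 ?side_pt0 ?side_pt1 ?side_pt0 in bad; exact: (bad _ erefl).
have [s0 s1] := open0 i s _ erefl (or_introl erefl).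
have [u0 u1] := open0 j u _ erefl (or_intror erefl).
have s01' : 0 < s < 1.
  by move/andP: s01 => [h0 h1]; rewrite !lt_neqAle eq_sym s0 s1 h0 h1.
have u01' : 0 < u < 1.
  by move/andP: u01 => [h0 h1]; rewrite !lt_neqAle eq_sym u0 u1 h0 h1.
have D := level_derive hP hp s01' u01' hc.
have [w1 w2] := weights_gt0 hP hp hc.
rewrite derive1E; case: D => _ ->.
have E1 : W1 p i j t (pt j u) = (1 - k) * (- ac j t) * ht i (pt j u).
  by rewrite /W1 pE /height /side_pt /det2 !mxE; ring.
have E2 : W2 p i j t (pt i s) = k * ac i t * ht j (pt i s).
  by rewrite /W2 pE /height /side_pt /det2 !mxE; ring.
rewrite -E1 -E2 in qE.
have wn : W1 p i j t (pt j u) + W2 p i j t (pt i s) != 0.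
  by rewrite gt_eqF // addr_gt0.
by rewrite /touch -[q](mulfK wn) qE; field.
Qed.

(** Either the chord is reduced to p, or p is one of its ends and the equation forces q to select
    this end, or p is inside a chord lying on a side; the last is impossible because sigma takes
    distinct levels on distinct points of a side when [acoef] is nonzero. *)
Lemma config_boundary t p p' i j s u k q : srel P p p' -> (forall l, ac l t != 0) ->
  config t p i j s u k q ->
  dot (nvec t) (pt (i + n%:R) s) = dot (nvec t) p' /\
  touch t i j s u q = dot (tvec t) p'.
Proof.
move=> hp a0 [s01 u01 k01 q01 [pE hn qE]].
have hx := srel_pt (P := P) i s01; have hy := srel_pt (P := P) j u01.
have hside l hl1 hl2 := same_side (a0 l) hx hy hl1 hl2 hn.
have [xy|xy] := eqVneq (pt i s) (pt j u).
  have px : p = pt i s by rewrite pE -xy -scalerDl subrK scale1r.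
  have xE := srel_fun hP hp (eq_ind_r (fun z => srel P z _) hx px).
  have yE := srel_fun hP hp (eq_ind_r (fun z => srel P z _) hy (etrans px xy)).
  by rewrite /touch -xE -yE subrr mulr0 addr0.
have hi : ht i (pt j u) != 0.
  by apply/eqP => h; case/eqP: xy; apply: (hside i) => //; rewrite height_self.
have hj : ht j (pt i s) != 0.
  by apply/eqP => h; case/eqP: xy; apply: (hside j) => //; rewrite height_self.
have [k0|k0] := eqVneq k 0.
  have px : p = pt i s by rewrite pE k0 subr0 scale1r scale0r addr0.
  have xE := srel_fun hP hp (eq_ind_r (fun z => srel P z _) hx px).
  have q0 : q = 0.
    move: qE; rewrite k0 !mul0r addr0 subr0 mul1r => /eqP.
    by rewrite !mulf_eq0 oppr_eq0 (negPf (a0 j)) (negPf hi) !orbF => /eqP.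
  by rewrite /touch -xE q0 mul0r addr0.
have [k1|k1] := eqVneq k 1.
  have py : p = pt j u by rewrite pE k1 subrr scale1r scale0r add0r.
  have yE := srel_fun hP hp (eq_ind_r (fun z => srel P z _) hy py).
  have q1 : q = 1.
    move: qE; rewrite k1 subrr !mul0r add0r mul1r => qE.
    apply: (mulIf (mulf_neq0 (a0 i) hj)); rewrite mul1r -[RHS]qE; ring.
  by rewrite /touch hn -yE q1 mul1r addrC subrK.
have [_ [l hl]] := (boundaryP hP p).1 (srel_boundary hP hp).1.
have hlx := height_side_ge0 hP l i s01; have hly := height_side_ge0 hP l j u01.
case/eqP: xy; apply: (hside l); move: hl; rewrite pE height_conv.
  have : 0 < 1 - k by rewrite subr_gt0 lt_neqAle k1; case/andP: k01.
  by case/andP: k01 => ? _ ? ?; nra.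
have : 0 < k by rewrite lt_neqAle eq_sym k0; case/andP: k01.
by case/andP: k01 => _ ? ? ?; nra.
Qed.

End ChordLimit.

Section LevelNear.
Context {R : realType} {n : nat} {P : 'Z_(n.*2) -> 'rV[R]_2}.
Hypothesis hP : CPPOS P.
Implicit Types (i j l : 'Z_(n.*2)) (s u t k q eps del : R) (p x y z : 'rV[R]_2) (v : 'rV[R]_4).
Local Notation e := (edge P).
Local Notation ht := (height P).
Local Notation pt := (side_pt P).
Local Notation ac := (acoef (P := P)).

Lemma dot_side w i s : dot w (pt i s) = dot w (P i) + s * dot w (e i).
Proof. by rewrite /dot /side_pt !mxE; ring. Qed.

Lemma side_coord i s (c : 'I_2) : pt i s 0 c = P i 0 c + s * e i 0 c.
Proof. by rewrite /side_pt !mxE. Qed.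

Lemma height_side i j s : ht i (pt j s) = ht i (P j) + s * det2 (e i) (e j).
Proof. exact: height_shift. Qed.

(** Applies [compact_fiber] on the cube of (s, u, k, q): F adds up the defects of the equations of
    [config] at p0, and G the deviations from L and d. *)
Lemma config_near t p0 i j (L d : R) :
  (forall s u k q, config (P := P) t p0 i j s u k q ->
     dot (nvec t) (pt (i + n%:R) s) = L /\ touch (P := P) t i j s u q = d) ->
  forall eps, 0 < eps -> exists2 del, 0 < del &
    forall p s u k q, config (P := P) t p i j s u k q ->
     `|p 0 0 - p0 0 0| + `|p 0 1 - p0 0 1| < del ->
     `|dot (nvec t) (pt (i + n%:R) s) - L| + `|touch (P := P) t i j s u q - d| < eps.
Proof.
move=> fiber eps eps0.
pose o0 := @Ordinal 4 0 isT; pose o1 := @Ordinal 4 1 isT.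
pose o2 := @Ordinal 4 2 isT; pose o3 := @Ordinal 4 3 isT.
pose pc (c : 'I_2) (v : 'rV[R]_4) := (1 - v 0 o2) * (P i 0 c + v 0 o0 * e i 0 c)
  + v 0 o2 * (P j 0 c + v 0 o1 * e j 0 c).
pose X w (v : 'rV[R]_4) := dot w (P (i + n%:R)) + v 0 o0 * dot w (e (i + n%:R)).
pose Y w (v : 'rV[R]_4) := dot w (P (j + n%:R)) + v 0 o1 * dot w (e (j + n%:R)).
pose w1 (v : 'rV[R]_4) := (1 - v 0 o2) * (- ac j t) * (ht i (P j) + v 0 o1 * det2 (e i) (e j)).
pose w2 (v : 'rV[R]_4) := v 0 o2 * ac i t * (ht j (P i) + v 0 o0 * det2 (e j) (e i)).
pose F (v : 'rV[R]_4) := `|pc 0 v - p0 0 0| + `|pc 1 v - p0 0 1| + `|X (nvec t) v - Y (nvec t) v|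
  + `|v 0 o3 * (w1 v + w2 v) - w2 v|.
pose G (v : 'rV[R]_4) := `|X (nvec t) v - L| +
  `|X (tvec t) v + v 0 o3 * (Y (tvec t) v - X (tvec t) v) - d|.
have cc (r : R) (v : 'rV[R]_4) : {for v, continuous (fun=> r)} by apply: cst_continuous.
have co o (v : 'rV[R]_4) : {for v, continuous (fun w : 'rV[R]_4 => w 0 o)} by apply: coord_continuous.
have cpc c v : {for v, continuous (pc c)}.
  apply: contD; apply: contM; try exact: co.
  - by apply: contB; [apply: cc|apply: co].
  - by apply: contD; [apply: cc|apply: contM; [apply: co|apply: cc]].
  - by apply: contD; [apply: cc|apply: contM; [apply: co|apply: cc]].
have cX w v : {for v, continuous (X w)}.
  by apply: contD; [apply: cc|apply: contM; [apply: co|apply: cc]].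
have cY w v : {for v, continuous (Y w)}.
  by apply: contD; [apply: cc|apply: contM; [apply: co|apply: cc]].
have cw1 v : {for v, continuous w1}.
  apply: contM; first by apply: contM; [apply: contB; [apply: cc|apply: co]|apply: cc].
  by apply: contD; [apply: cc|apply: contM; [apply: co|apply: cc]].
have cw2 v : {for v, continuous w2}.
  apply: contM; first by apply: contM; [apply: co|apply: cc].
  by apply: contD; [apply: cc|apply: contM; [apply: co|apply: cc]].
have cF v : {for v, continuous F}.
  apply: contD; [apply: contD; [apply: contD|]|]; apply: cont_norm; apply: contB; try exact: cc.
  - exact: cpc.
  - exact: cpc.
  - exact: cX.
  - exact: cY.
  - by apply: contM; [apply: co|apply: contD; [apply: cw1|apply: cw2]].
  - exact: cw2.
have cG v : {for v, continuous G}.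
  apply: contD; apply: cont_norm; apply: contB; try exact: cc; first exact: cX.
  apply: contD; first exact: cX.
  by apply: contM; [apply: co|apply: contB; [apply: cY|apply: cX]].
have F0 v : 0 <= F v by rewrite !addr_ge0.
have G0 v : 0 <= G v by rewrite !addr_ge0.
have pcE v c : ((1 - v 0 o2) *: pt i (v 0 o0) + v 0 o2 *: pt j (v 0 o1)) 0 c = pc c v.
  by rewrite /pc -!side_coord !mxE.
have tE v : touch (P := P) t i j (v 0 o0) (v 0 o1) (v 0 o3) =
    X (tvec t) v + v 0 o3 * (Y (tvec t) v - X (tvec t) v).
  by rewrite /touch !dot_side.
have FG v : (forall o, 0 <= v 0 o <= 1) -> F v = 0 -> G v = 0.
  move=> hv /eqP; rewrite !paddr_eq0 ?addr_ge0 // !normr_eq0 !subr_eq0.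
  case/andP => /andP[/andP[/eqP e0 /eqP e1] /eqP e2] /eqP e3.
  have [|E1 E2] := fiber (v 0 o0) (v 0 o1) (v 0 o2) (v 0 o3).
    split=> //; split; first by apply: eq_rV2; rewrite pcE.
      by rewrite !dot_side.
    by rewrite !height_side.
  by rewrite /G -tE -E1 -E2 dot_side !subrr normr0 addr0.
have [del del0 H] := compact_fiber (@cube_compact R 4) cF cG F0 G0 FG eps0.
exists del => // p s u k q [s01 u01 k01 q01 [pE hn qE]] hp.
pose v : 'rV[R]_4 := \row_o nth 0 [:: s; u; k; q] o.
have [v0 v1 v2 v3] : [/\ v 0 o0 = s, v 0 o1 = u, v 0 o2 = k & v 0 o3 = q] by rewrite !mxE.
have := H v; rewrite /G -tE v0 v1 v3 /X v0 -dot_side; apply.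
  by case; case=> [|[|[|[|]]]] // hm; rewrite mxE.
have E c : pc c v = p 0 c by rewrite -pcE v0 v1 v2 -pE.
rewrite /F !E (_ : X _ v = Y (nvec t) v).
  rewrite subrr normr0 addr0 v3 /w1 /w2 v0 v1 v2 -!height_side qE subrr normr0 addr0 //.
by rewrite /X /Y v0 v1 -!dot_side.
Qed.

Lemma level_near t p0 (L d : R) :
  (forall i j s u k q, 0 < ac i t -> ac j t < 0 -> config (P := P) t p0 i j s u k q ->
     dot (nvec t) (pt (i + n%:R) s) = L /\ touch (P := P) t i j s u q = d) ->
  forall eps, 0 < eps -> exists2 del, 0 < del &
    forall p, inI P p -> ~ transitions P p t ->
     `|p 0 0 - p0 0 0| + `|p 0 1 - p0 0 1| < del ->
     `|level P p t - L| + `|(level P p)^`()%classic t - d| < eps.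
Proof.
move=> fiber eps eps0.
have step (ij : 'Z_(n.*2) * 'Z_(n.*2)) : exists2 del, 0 < del & forall p s u k q,
    0 < ac ij.1 t -> ac ij.2 t < 0 ->
    config (P := P) t p ij.1 ij.2 s u k q -> `|p 0 0 - p0 0 0| + `|p 0 1 - p0 0 1| < del ->
    `|dot (nvec t) (pt (ij.1 + n%:R) s) - L| + `|touch (P := P) t ij.1 ij.2 s u q - d| < eps.
  have [ai|ai] := ltP 0 (ac ij.1 t); last by exists 1.
  have [aj|aj] := ltP (ac ij.2 t) 0; last by exists 1.
  have [s u k q|del del0 H] := @config_near t p0 ij.1 ij.2 L d _ eps eps0; first exact: fiber.
  by exists del => // p s u k q _ _; apply: H.
have [del hdel] := choice (fun ij => (exists2P _ _).1 (step ij)).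
pose m := \big[Num.min/1]_ij del ij.
have m0 : 0 < m by rewrite /m; elim/big_ind: _ => // [a b ha hb|ij _]; [rewrite lt_min ha|case: (hdel ij)].
exists m => // p hp nT pm.
have [i [j [s [u [k [q [hc ai aj lE dl]]]]]]] := pchord_config hP hp nT.
have [_ H] := hdel (i, j).
have := H p s u k q ai aj hc; rewrite lE derive1E; case: dl => _ -> /=; apply.
by apply: lt_le_trans pm _; exact: bigmin_le.
Qed.

End LevelNear.

Lemma ae_countable (R : realType) (B Q : set R) : countable B -> (forall t, ~ B t -> Q t) ->
  \forall t \ae (@lebesgue_measure R), Q t.
Proof.
move=> cB H; exists B; split.
- apply: countable_measurable => // t; exact: measurable_set1.
- exact: countable_lebesgue_measure0.
- by move=> t /= nQ; apply: contrapT => /H.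
Qed.

(** * Passing to the limit in the energy *)

Section EnergyLimit.
Context {R : realType} {n : nat} {P : 'Z_(n.*2) -> 'rV[R]_2}.
Hypothesis hP : CPPOS P.
Implicit Types (i j l : 'Z_(n.*2)) (s u t k q eps del : R) (p x y z : 'rV[R]_2) (m : nat).
Local Notation e := (edge P).
Local Notation ac := (acoef (P := P)).
Local Notation mu := (@lebesgue_measure R).
Local Notation int a b f := (\int[mu]_(t in `[a, b]) f t).

Lemma normal_zeros (v : 'rV[R]_2) : v != 0 -> finite_set [set t | 0 <= t <= pi /\ dot (nvec t) v = 0].
Proof.
move=> v0; have [[t1 [h1 z1]]|h] := pselect (exists t1, 0 <= t1 <= pi /\ dot (nvec t1) v = 0); last first.
  by rewrite (_ : [set _ | _] = set0) //; apply/seteqP; split=> // t /= ht; case: h; exists t.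
apply: (@sub_finite_set _ _ [set t1; t1 + pi; t1 - pi]); last by rewrite !finite_setU.
move=> t /= [ht zt].
have vE := dot_nt_eq0 z1.
have c0 : dot (tvec t1) v != 0 by apply: contra_neq v0 => c0; rewrite vE c0 scale0r.
have st : sin (t - t1) = 0.
  apply: (mulIf c0); rewrite mul0r -[RHS]zt {2}vE sinB /dot !mxE /=; ring.
have p0 := pi_gt0 R.
have [lt|lt|->] := ltgtP t t1; last by left; left.
- right; apply/eqP; rewrite eq_le; apply/andP; split; last by lra.
  rewrite leNgt; apply/negP => h; have : 0 < sin (t1 - t) by apply: sin_gt0_pi; lra.
  by rewrite -opprB sinN st oppr0 ltxx.
- left; right; apply/eqP; rewrite eq_le; apply/andP; split; first by lra.
  rewrite leNgt; apply/negP => h; have : 0 < sin (t - t1) by apply: sin_gt0_pi; lra.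
  by rewrite st ltxx.
Qed.

Lemma acoef_zeros : countable [set t | 0 <= t <= pi /\ exists l, ac l t = 0].
Proof.
apply: finite_set_countable.
rewrite (_ : [set _ | _] = \bigcup_(l in [set: 'Z_(n.*2)]) [set t | 0 <= t <= pi /\ ac l t = 0]).
  apply: bigcup_finite => [|l _]; first exact: finite_finset.
  exact: normal_zeros (edge_neq0 hP _).
apply/seteqP; split=> t /=; first by move=> [ht [l hl]]; exists l.
by move=> [l _ [ht hl]]; split=> //; exists l.
Qed.

Lemma transitions_countable p : inI P p -> countable [set t | 0 <= t <= pi /\ transitions P p t].
Proof.
move=> hp; apply: finite_set_countable.
(* The half-open interval is extended beyond pi so that it contains pi. *)
have [F _] := @piece_area R n P p (level_pwC2 hP hp) 0 (pi + 1) ltac:(have := pi_gt0 R; lra).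
by apply: sub_finite_set F => t /= [ht hT]; split=> //; rewrite in_itv /=; lra.
Qed.

Lemma touch_bound t p i j s u k q : config (P := P) t p i j s u k q ->
  `|touch (P := P) t i j s u q| <= 2 * bound P.
Proof.
move=> [s01 u01 _ q01 _].
have tb z : inK P z -> `|dot (tvec t) z| <= 2 * bound P.
  move=> hz; apply: le_trans (ler_normD _ _) _; rewrite !mxE /= !normrM normrN.
  have c1 : `|sin t| <= 1 by rewrite ler_norml sin_geN1 sin_le1.
  have c2 : `|cos t| <= 1 by rewrite ler_norml cos_geN1 cos_le1.
  have b0 := region_bound hP 0 hz; have b1 := region_bound hP 1 hz.
  have := normr_ge0 (z 0 0); have := normr_ge0 (z 0 1).
  have := normr_ge0 (sin t); have := normr_ge0 (cos t); nra.
have hx := tb _ (side_pt_inK hP (i + n%:R) s01); have hy := tb _ (side_pt_inK hP (j + n%:R) u01).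
rewrite /touch; set X := dot _ _ in hx *; set Y := dot _ _ in hy *.
rewrite (_ : X + q * (Y - X) = (1 - q) * X + q * Y); last by ring.
apply: le_trans (ler_normD _ _) _; rewrite !normrM.
have -> : `|1 - q| = 1 - q by rewrite ger0_norm; lra.
have -> : `|q| = q by rewrite ger0_norm; lra.
nra.
Qed.

Lemma level_derive_bound p t : inI P p -> ~ transitions P p t ->
  `|(level P p)^`()%classic t| <= 2 * bound P.
Proof.
move=> hp nT; have [i [j [s [u [k [q [hc _ _ _ dl]]]]]]] := pchord_config hP hp nT.
by rewrite derive1E; case: dl => _ ->; apply: touch_bound hc.
Qed.

(** Off a countable set of angles, levels and derivatives converge by [level_near]; both are bounded
    by [2 * bound P] uniformly in p, so dominated convergence applies. *)
Lemma dirichlet_cvg (p_ : nat -> 'rV[R]_2) p0 (L d : R -> R) (N0 : set R) :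
  (forall m, inI P (p_ m)) ->
  (forall eps, 0 < eps -> \forall m \near \oo, `|p_ m 0 0 - p0 0 0| + `|p_ m 0 1 - p0 0 1| < eps) ->
  countable [set t | 0 <= t <= pi /\ N0 t] ->
  (forall c, pwc_at L c) -> (forall c, pwc_at d c) ->
  (forall t, ~ N0 t -> forall i j s u k q, 0 < ac i t -> ac j t < 0 ->
     config (P := P) t p0 i j s u k q ->
     dot (nvec t) (side_pt P (i + n%:R) s) = L t /\ touch (P := P) t i j s u q = d t) ->
  dirichlet (level P (p_ m)) @[m --> \oo] --> 2^-1 * int 0 pi (fun t => d t * d t - L t * L t).
Proof.
move=> hp hcv cN pL pd fiber.
pose f m t := (level P (p_ m))^`()%classic t * (level P (p_ m))^`()%classic t -
  level P (p_ m) t * level P (p_ m) t.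
pose g t := d t * d t - L t * L t.
have itg h : (forall c, pwc_at h c) -> mu.-integrable `[0, pi] (EFin \o h).
  by move=> hh; apply: pwc_integrable => //; apply: pi_ge0.
have fi m : mu.-integrable `[0, pi] (EFin \o f m).
  have H := level_pwC2 hP (hp m).
  apply: itg => c; apply: pwcB; apply: pwcM; try exact: (pw_pwc H); exact: (pw_derive_pwc H).
have gi : mu.-integrable `[0, pi] (EFin \o g).
  by apply: itg => c; apply: pwcB; apply: pwcM.
pose M := (2 * bound P) * (2 * bound P).
(* Index 0 stands for N0 and index m + 1 for the transitions of [p_ m]. *)
pose B := \bigcup_m [set t | 0 <= t <= pi /\ (if m is m'.+1 then transitions P (p_ m') else N0) t].
have cB : countable B.
  by apply: bigcup_countable => // -[|m] _ //; exact: transitions_countable.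
have good t : ~ B t -> 0 <= t <= pi -> (forall m, ~ transitions P (p_ m) t) /\ ~ N0 t.
  move=> nB ht; split=> [m hm|hN]; apply: nB; [exists m.+1|exists 0%N] => //.
have mD : measurable `[(0 : R), pi]%classic by exact: measurable_itv.
have [] := @dominated_convergence _ _ R mu _ mD (fun m => EFin \o f m) (EFin \o g)
  (fun=> (2 * M)%:E).
- by move=> m; apply: measurable_int (fi m).
- exact: measurable_int gi.
- apply: ae_countable cB _ => t nB; rewrite /= in_itv /= => ht.
  have [nT nN] := good t nB ht.
  apply: cvg_EFin; first by near=> m.
  have key eps : 0 < eps -> \forall m \near \oo,
      `|level P (p_ m) t - L t| + `|(level P (p_ m))^`()%classic t - d t| < eps.
    move=> eps0; have [del del0 H] := level_near hP (fiber t nN) eps0.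
    by apply: filterS (hcv del del0) => m; apply: H.
  have cl : level P (p_ m) t @[m --> \oo] --> L t.
    apply/cvgrPdist_lt => r r0; apply: filterS (key r r0) => m; rewrite distrC.
    by apply: le_lt_trans; rewrite lerDl.
  have cd : (level P (p_ m))^`()%classic t @[m --> \oo] --> d t.
    apply/cvgrPdist_lt => r r0; apply: filterS (key r r0) => m; rewrite [X in _ + X]distrC.
    by apply: le_lt_trans; rewrite lerDr.
  by apply: cvgB; apply: cvgM.
- apply: itg (fun=> 2 * M) _ => c; apply: pwc_cont; near=> t; exact: cst_continuous.
- apply: ae_countable cB _ => t nB m; rewrite /= in_itv /= => ht.
  have [nT nN] := good t nB ht.
  rewrite lee_fin; apply: le_trans (ler_normB _ _) _; rewrite !normrM.
  have b1 := level_derive_bound (hp m) (nT m); have b2 := level_bound hP t (hp m).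
  by rewrite mulrDl mul1r lerD // /M ler_pM.
move=> _ _ C; have fin := @integrable_fin_num _ _ _ mu _ mD _ gi.
have {}C : (\int[mu]_(t in `[0%R, pi]) (EFin \o f m) t)%E @[m --> \oo] -->
    (int 0 pi g)%:E by rewrite /Rintegral fineK.
have := fine_cvg C => {}C.
by apply: cvgMr; exact: C.
Unshelve. all: by end_near. Qed.

End EnergyLimit.

Section EnergyContinuous.
Context {R : realType} {n : nat} {P : 'Z_(n.*2) -> 'rV[R]_2}.
Hypothesis hP : CPPOS P.
Implicit Types (i j l : 'Z_(n.*2)) (s u t k q eps del : R) (p x y z : 'rV[R]_2) (m : nat).
Local Notation mu := (@lebesgue_measure R).
Local Notation int a b f := (\int[mu]_(t in `[a, b]) f t).
Local Notation dist p z := (`|p 0 0 - z 0 0| + `|p 0 1 - z 0 1|).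

(** At an interior limit the configurations determine h and h'. At a boundary limit the limiting
    level is the sinusoid of [sigma p0], whose Dirichlet form is 0, the value assigned to the energy
    there. *)
Lemma energy_cvg (p_ : nat -> 'rV[R]_2) p0 : inK P p0 -> (forall m, inI P (p_ m)) ->
  (forall eps, 0 < eps -> \forall m \near \oo, dist (p_ m) p0 < eps) ->
  energy P (p_ m) @[m --> \oo] --> energy P p0.
Proof.
move=> hp0 hp hcv.
have -> : (fun m => energy P (p_ m)) = (fun m => dirichlet (level P (p_ m))).
  by apply/funext => m; apply: energyE.
have [h0|hb] := inK_cases hP hp0.
  rewrite energyE //; have H := level_pwC2 hP h0.
  apply: (dirichlet_cvg hP hp hcv (transitions_countable hP h0)).
  - exact: (pw_pwc H).
  - exact: (pw_derive_pwc H).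
  - by move=> t nT i j s u k q ai aj; apply: config_interior.
have [p' hp'] := (boundary_srel p0).1 hb.
rewrite energy_boundary; last by move=> /(inI_nboundary hP).
rewrite -(dirichlet_sinusoid p') /dirichlet.
have dE : (fun t => dot (nvec t) p')^`()%classic = (fun t => dot (tvec t) p').
  by apply/funext => t; rewrite derive1E; case: (is_derive_dot_nvec p' t) => _ ->.
rewrite dE; apply: (dirichlet_cvg hP hp hcv (acoef_zeros hP)).
- by move=> c; apply: pwc_cont; near=> t; apply: dot_nvec_continuous.
- by move=> c; apply: pwc_cont; near=> t; apply: dot_tvec_continuous.
- move=> t nz i j s u k q ai aj; apply: config_boundary => // l.
  by apply/eqP => h; apply: nz; exists l.
Unshelve. all: by end_near. Qed.

Lemma near_dist p del : 0 < del -> \forall z \near p, dist (z : 'rV[R]_2) p < del.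
Proof.
move=> del0.
have c (o : 'I_2) : {for p, continuous (fun z : 'rV[R]_2 => `|z 0 o - p 0 o|)}.
  by apply: cont_norm; apply: contB; [apply: coord_continuous|apply: cst_continuous].
by apply: (continuous_near_lt (contD (c 0) (c 1))); rewrite !subrr normr0 addr0.
Qed.

Lemma dist_near p (Q : 'rV[R]_2 -> Prop) : (\forall z \near p, Q (z : 'rV[R]_2)) ->
  exists2 del, 0 < del & forall z, dist z p < del -> Q z.
Proof.
move=> /nbhs_ballP[eps /= eps0 H]; exists eps => // z hz; apply: H.
split=> // a b; rewrite ord1 /ball /= distrC; have := normr_ge0 (z 0 0 - p 0 0); have := normr_ge0 (z 0 1 - p 0 1).
have [->|->] : b = 0 \/ b = 1 by case: b => -[|[|]] // ?; [left|right]; apply/val_inj.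
all: lra.
Qed.

(** Otherwise some sequence tends to p0 with energies at distance at least eps. Its points may be
    taken in the interior: if p0 is interior, by openness; if p0 is on the boundary, because
    boundary points have the same energy 0. This contradicts [energy_cvg]. *)
Lemma energy_continuous p0 eps : inK P p0 -> 0 < eps ->
  exists2 del, 0 < del & forall p, inK P p -> dist p p0 < del -> `|energy P p - energy P p0| < eps.
Proof.
move=> hp0 eps0; apply: contrapT => H.
have [r r0 hr] : exists2 r, 0 < r & forall p, dist p p0 < r ->
    eps <= `|energy P p - energy P p0| -> inI P p.
  have [h0|hb] := inK_cases hP hp0.
    have N : \forall z \near p0, inI P (z : 'rV[R]_2).
      by rewrite -(interior_regionE hP) in h0 *; exact: (nbhs_interior h0).
    by have [r r0 hr] := dist_near N; exists r => // p hp _; apply: hr.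
  exists 1 => // p _ he; apply: contrapT => hp; move: he.
  rewrite !energy_boundary //; last by move=> /(inI_nboundary hP).
  by rewrite subrr normr0 leNgt eps0.
have bad (m : nat) : exists p, inI P p /\ dist p p0 < m.+1%:R^-1 /\ eps <= `|energy P p - energy P p0|.
  apply: contrapT => Hm; apply: H; exists (Num.min r m.+1%:R^-1).
    by rewrite lt_min r0 invr_gt0 ltr0n.
  move=> p hp; rewrite lt_min => /andP[d1 d2]; rewrite ltNge; apply/negP => he.
  by apply: Hm; exists p; split=> //; apply: hr.
have [p_ hp_] := choice bad.
have : energy P (p_ m) @[m --> \oo] --> energy P p0.
  apply: energy_cvg => // [m|del del0]; first by case: (hp_ m).
  have N := near_infty_natSinv_lt (PosNum del0).
  by apply: filterS N => m /=; apply: lt_trans; case: (hp_ m) => _ [].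
move=> /cvgrPdist_lt/(_ eps eps0)[m0 _ hm].
by have := hm m0 (leqnn m0); rewrite distrC ltNge; case: (hp_ m0) => _ [_ ->].
Qed.

Lemma energy_within_continuous : {within region P, continuous (energy P)}.
Proof.
apply/subspace_continuousP => p; rewrite (regionE hP) => hp.
apply/cvgrPdist_lt => eps eps0; have [del del0 H] := energy_continuous hp eps0.
rewrite near_withinE; apply: filterS (near_dist p del0) => z hz hzK.
by rewrite distrC; apply: H.
Qed.

Lemma region_closed : closed (region P).
Proof.
rewrite (regionE hP) (_ : inK P = \bigcap_(i in [set: 'Z_(n.*2)]) (height P i @^-1` [set x | 0 <= x])).
  apply: closed_bigI => i _; apply: preimage_closed; last exact: closed_ge.
  by move=> z _; apply: height_continuous.
by apply/seteqP; split=> z /= h i => [_|]; apply: h.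
Qed.

Lemma region_compact : compact (region P).
Proof.
have cB := @rV_compact R 2 (fun=> `[- bound P, bound P]%classic)
  (fun=> @segment_compact R (- bound P) (bound P)).
apply: (@subclosed_compact _ _ _ region_closed cB) => z.
by rewrite (regionE hP) => hz i /=; rewrite in_itv /= -ler_norml; exact: region_bound.
Qed.

Lemma region_neq0 : region P !=set0.
Proof. by exists (P 0); rewrite (regionE hP) => i; apply: height_vertex_ge0. Qed.

Lemma energy_max : exists2 p, region P p & forall z, region P z -> energy P z <= energy P p.
Proof.
have [c hc H] := compact_EVT_max region_neq0 region_compact energy_within_continuous.
by exists c => [|z hz]; [rewrite inE in hc|apply: H; rewrite inE].
Qed.

Lemma max_energyE p : C_ART P p -> max_energy P = energy P p.
Proof.
move=> [hp H]; apply/le_anti/andP; split.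
  by apply: ge_sup => [|_ [z hz <-]]; [exists (energy P p), p|apply: H].
by apply: ub_le_sup => [|]; [exists (energy P p) => _ [z hz <-]; apply: H|exists p].
Qed.

Lemma C_ART_compact : compact (C_ART P).
Proof.
apply: (subclosed_compact _ region_compact) => [|z []//].
move=> p hp.
have hpK : region P p.
  apply: region_closed => B /hp[z [[hz _] Bz]].
  by exists z; split; [exact: hz|exact: Bz].
split; first exact: hpK.
move=> z hz; rewrite leNgt; apply/negP => lt.
have e0 : 0 < energy P z - energy P p by rewrite subr_gt0.
have hpK' : inK P p by rewrite -(regionE hP).
have [del del0 H] := energy_continuous hpK' e0.
have [w [[hw wmax] /= dw]] := hp _ (near_dist p del0).
rewrite (regionE hP) in hw; have := H w hw dw; rewrite ltNge; case/negP.
by apply: le_trans (ler_norm _); rewrite lerD2r; apply: wmax.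
Qed.

End EnergyContinuous.

(** * The maximum of the energy *)

Section Capacity.
Context {R : realType} {n : nat} {P : 'Z_(n.*2) -> 'rV[R]_2}.
Hypothesis hP : CPPOS P.
Let n1 := cppos_size hP.

(** Fan triangulation from P 0: the heights of P 0 over the sides are twice the areas of the
    triangles, all nonnegative, and the one over side 1 is positive. *)
Lemma area_gt0 : 0 < area P.
Proof.
rewrite /area mulr_gt0 ?invr_gt0 ?ltr0n //.
have E i : det2 (P i) (P (i + 1)) =
    height P i (P 0) + (det2 (P 0) (P (i + 1)) - det2 (P 0) (P i)).
  by rewrite /height /edge /det2 !mxE; ring.
under eq_bigr do rewrite E.
have T : \sum_i (det2 (P 0) (P (i + 1)) - det2 (P 0) (P i)) = 0.
  by rewrite sumrB [X in _ - X](reindex_inj (addIr 1)) subrr.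
rewrite big_split /= T addr0.
rewrite (bigD1 1) //= ltr_pwDl ?sumr_ge0 // => [|i _]; last exact: height_vertex_ge0.
rewrite lt_neqAle eq_sym height_vertex_ge0 // andbT; apply/eqP => /(height_vertex_eq0 hP)[].
  move=> h; have /eqP := @Zp_addS_neq _ n1 0 1 ltac:(lia); by rewrite add0r mulr1n -h.
move=> h; have /eqP := @Zp_addS_neq _ n1 0 2 ltac:(lia); by rewrite add0r mulr2n -h.
Qed.

Lemma C_ART_neq0 : C_ART P !=set0.
Proof. by have [p hp H] := energy_max hP; exists p. Qed.

Lemma C_ART_image (A : 'M[R]_2) (b : 'rV[R]_2) : A \in unitmx ->
  C_ART (affine_image A b P) = affmap A b @` C_ART P.
Proof.
move=> hA; have D0 : 0 < `|\det A| by rewrite normr_gt0 det_neq0.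
have rE := region_image hP b hA.
apply/seteqP; split=> z.
  move=> []; rewrite rE => -[p hp <-] H; exists p; last by [].
  split; first exact: hp.
  move=> q hq; have hq' : (affmap A b @` region P) (affmap A b q) by exists q.
  by have := H _ hq'; rewrite !(energy_image hP b hA) ler_pM2l.
move=> [p [hp H] <-]; split; first by rewrite rE; exists p.
move=> w; rewrite rE => -[q hq <-]; rewrite !(energy_image hP b hA) (ler_pM2l D0).
exact: H.
Qed.

Lemma max_energy_image (A : 'M[R]_2) (b : 'rV[R]_2) : A \in unitmx ->
  max_energy (affine_image A b P) = `|\det A| * max_energy P.
Proof.
move=> hA; have [p hp] := C_ART_neq0.
rewrite (max_energyE hp) -(energy_image hP b hA); apply: max_energyE.
by rewrite C_ART_image //; exists p.
Qed.

Lemma delta_ART_image (A : 'M[R]_2) (b : 'rV[R]_2) : A \in unitmx ->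
  delta_ART (affine_image A b P) = delta_ART P.
Proof.
move=> hA; rewrite /delta_ART max_energy_image // (area_image b hA).
by rewrite -mulf_div divff ?mul1r // normr_eq0 det_neq0.
Qed.

Lemma scale_affine_image (c : R) : 0 < c ->
  (fun i => c *: P i) = affine_image c%:M 0 P.
Proof.
move=> c0; apply/funext => i.
by rewrite /affine_image det_scalar exprn_gt0 // /affmap addr0 mul_mx_scalar.
Qed.

(** A zero maximum of a nonnegative energy makes it vanish at every interior point. *)
Lemma delta_ART_eq0 : delta_ART P = 0 -> centrally_symmetric P.
Proof.
move=> /eqP; rewrite mulf_eq0 invr_eq0 (gt_eqF area_gt0) orbF => /eqP m0.
apply: (energy0_symmetric hP) => p hp; have [c hc] := C_ART_neq0.
apply/le_anti; rewrite (energy_ge0 hP) andbT -m0 (max_energyE hc).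
by apply: hc.2; rewrite (regionE hP); apply: inI_inK.
Qed.

Lemma C_ART_interior : 0 < max_energy P -> C_ART P `<=` (region P)°.
Proof.
move=> m0 p hp; rewrite (interior_regionE hP); apply: contrapT => np.
by move: m0; rewrite (max_energyE hp) energy_boundary // ltxx.
Qed.

Lemma symmetric_energy : centrally_symmetric P ->
  (forall p, region P p -> energy P p = 0) /\ delta_ART P = 0 /\ C_ART P = region P.
Proof.
move=> /(centrally_symmetric_vertex hP)[c hc].
have E p : energy P p = 0 by apply: (energy_symmetric hP) hc.
split=> //; split.
  by have [p hp] := C_ART_neq0; rewrite /delta_ART (max_energyE hp) E mul0r.
apply/seteqP; split=> [p [hp _]|p hp]; first exact: hp.
by split; [exact: hp|move=> z _; rewrite !E].
Qed.

End Capacity.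

Theorem proposition6p21 (R : realType) (n : nat)
    (P : 'Z_(n.*2) -> 'rV[R]_2) (hP : CPPOS P) :
  (forall c : R, 0 < c -> delta_ART (fun i => c *: P i) = delta_ART P) /\
  (forall (A : 'M[R]_2) (b : 'rV[R]_2), A \in unitmx ->
     delta_ART (affine_image A b P) = delta_ART P) /\
  C_ART P !=set0 /\
  compact (C_ART P) /\
  (forall (A : 'M[R]_2) (b : 'rV[R]_2), A \in unitmx ->
     C_ART (affine_image A b P) = affmap A b @` C_ART P) /\
  (0 < max_energy P -> C_ART P `<=` (region P)°) /\
  (delta_ART P = 0 <-> centrally_symmetric P) /\
  (centrally_symmetric P ->
     (forall p, region P p -> energy P p = 0) /\
     delta_ART P = 0 /\
     C_ART P = region P).
Proof.
split.
  move=> c c0; rewrite scale_affine_image // delta_ART_image //.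
  by rewrite unitmxE det_scalar unitfE expf_neq0 // gt_eqF.
split; first exact: delta_ART_image hP.
split; first exact: C_ART_neq0 hP.
split; first exact: C_ART_compact hP.
split; first exact: C_ART_image hP.
split; first exact: C_ART_interior hP.
split; last exact: symmetric_energy hP.
split; first exact: delta_ART_eq0.
by case/(symmetric_energy hP) => _ [].
Qed.
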